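(* Let $d\ge2$, let $\omega\subset\mathbb R^{d-1}$ be a bounded connected open set with Lipschitz boundary, and let $\Omega_\varepsilon=\omega\times(0,\varepsilon)$. Let $s_\varepsilon\in(0,1)$ with $s_\varepsilon\to s_0\in[0,\frac12)$ as $\varepsilon\to0$. Then the $\Gamma$-limit, with respect to the weak dimension-reduction convergence in $L^2$, of the functionals $$F_\varepsilon(u)=\frac1{\varepsilon^2}\int_{\Omega_\varepsilon}\int_{\Omega_\varepsilon}\frac{(u(x)-u(y))^2}{|x-y|^{d+2s_\varepsilon}}\,dx\,dy,\qquad u\in H^{s_\varepsilon}(\Omega_\varepsilon),$$ is given on $L^2(\omega)$ by the squared $H^{\frac12+s_0}$-Gagliardo seminorm in $\omega$, that is (noting that $d-1+2(\frac12+s_0)=d+2s_0$), by $$F^{s_0}(u)=\int_\omega\int_\omega\frac{|u(x')-u(y')|^2}{|x'-y'|^{d+2s_0}}\,dx'\,dy'$$ (equal to $+\infty$ if the integral diverges).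
   Context: Points of $\mathbb R^d$ are written $x=(x',x_d)$ with $x'\in\mathbb R^{d-1}$. $H^s(\Omega)$, $s\in(0,1)$, is the set of $u\in L^2(\Omega)$ with $\int_{\Omega\times\Omega}\frac{|u(x)-u(y)|^2}{|x-y|^{d+2s}}dx\,dy<+\infty$. Weak dimension-reduction convergence in $L^2$: functions $u_\varepsilon$ on $\Omega_\varepsilon$ converge to $u\in L^2(\omega)$ if the scaled functions $v_\varepsilon(x',x_d)=u_\varepsilon(x',\varepsilon x_d)$ converge weakly in $L^2(\omega\times(0,1))$ to a function $v$ independent of $x_d$, with $u(x')=v(x')$. $\Gamma$-limit: $\Gamma$-$\lim_{\varepsilon\to0}F_\varepsilon=F$ with respect to a convergence $u_\varepsilon\to u$ means that for every sequence $\varepsilon_j\to0^+$ and every $u$: (i) $F(u)\le\liminf_jF_{\varepsilon_j}(u_{\varepsilon_j})$ whenever $u_{\varepsilon_j}\in H^{s_{\varepsilon_j}}(\Omega_{\varepsilon_j})$ converge to $u$; (ii) there exist $u_{\varepsilon_j}\in H^{s_{\varepsilon_j}}(\Omega_{\varepsilon_j})$ converging to $u$ with $\limsup_jF_{\varepsilon_j}(u_{\varepsilon_j})\le F(u)$. *)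

(* Defs.v *)
From HB Require Import structures.
From mathcomp Require Import all_boot all_order all_algebra.
From mathcomp Require Import all_classical all_reals all_analysis.
Set Implicit Arguments.
Unset Strict Implicit.
Unset Printing Implicit Defensive.
Import Order.TTheory GRing.Theory Num.Theory.
Import numFieldNormedType.Exports.
Local Open Scope classical_set_scope.
Local Open Scope ring_scope.

Definition measure_rV_display : measure_display -> measure_display.
Proof. exact. Qed.

(* As for n-tuples in the library, row vectors carry the product
   sigma-algebra, generated by the coordinates; over the reals it is the Borel
   sigma-algebra of R^n. *)
Section measurable_rV.
Context {d} {T : sigmaRingType d} {n : nat}.

Let coors (i : 'I_n) (x : 'rV[T]_n) : T := x ord0 i.

Let rV_set0 : g_sigma_preimage coors set0.
Proof. exact: sigma_algebra0. Qed.

Let rV_setC A : g_sigma_preimage coors A -> g_sigma_preimage coors (~` A).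
Proof. exact: sigma_algebraC. Qed.

Let rV_bigcup (F : _^nat) : (forall i, g_sigma_preimage coors (F i)) ->
  g_sigma_preimage coors (\bigcup_i (F i)).
Proof. exact: sigma_algebra_bigcup. Qed.

HB.instance Definition _ := @isMeasurable.Build (measure_rV_display d)
  'rV[T]_n (g_sigma_preimage coors) rV_set0 rV_setC rV_bigcup.

End measurable_rV.

Section measurable_rV_theory.
Context d1 d2 (T1 : measurableType d1) (T2 : measurableType d2).

Lemma measurable_coord_rV n (i : 'I_n) :
  measurable_fun [set: 'rV[T2]_n] (fun x : 'rV[T2]_n => x ord0 i).
Proof.
move=> _ Y mY; rewrite setTI; apply: sub_sigma_algebra => /=.
rewrite -bigcup_seq/=; exists i => /=; first by rewrite mem_index_enum.
by exists Y => //; rewrite setTI.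
Qed.

Lemma measurable_fun_rVP n (f : T1 -> 'rV[T2]_n) :
  measurable_fun [set: T1] f <->
  forall i, measurable_fun [set: T1] (fun x => f x ord0 i).
Proof.
split=> [mf i|mf].
  exact: (measurableT_comp (measurable_coord_rV i) mf).
pose G : set (set 'rV[T2]_n) := \big[setU/set0]_(i < n)
  preimage_set_system setT (fun x : 'rV[T2]_n => x ord0 i) measurable.
apply: (@measurability _ _ _ _ _ f G erefl) => _ [B + <-].
rewrite /G -bigcup_seq => -[i _ [C mC <-]].
by rewrite !setTI -[X in measurable X]setTI; exact: mf.
Qed.

End measurable_rV_theory.

Section lebesgue_rV.
Context {R : realType}.

Definition rV_cons n (p : 'rV[R]_n * R) : 'rV[R]_n.+1 :=
  row_mx (p.2)%:M p.1.

Definition rV_uncons n (x : 'rV[R]_n.+1) : 'rV[R]_n * R :=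
  (rsubmx (x : 'rV_(1 + n)), x ord0 ord0).

Lemma rV_consK n : cancel (@rV_cons n) (@rV_uncons n).
Proof.
move=> [x t]; rewrite /rV_uncons /rV_cons row_mxKr /=; congr (_, _).
have -> : ord0 = @lshift 1 n ord0 :> 'I_(1 + n) by exact: val_inj.
by rewrite [LHS](@row_mxEl R 1 1 n) mxE eqxx mulr1n.
Qed.

Lemma rV_unconsK n : cancel (@rV_uncons n) (@rV_cons n).
Proof.
move=> x; rewrite /rV_uncons /rV_cons /=.
have -> : (x ord0 ord0)%:M = lsubmx (x : 'rV_(1 + n)).
  apply/rowP => i; rewrite [LHS]mxE [RHS]mxE (ord1 i) mulr1n.
  by congr (x _ _); exact: val_inj.
exact: (@hsubmxK R 1 1 n).
Qed.

Lemma measurable_rV_cons n : measurable_fun setT (@rV_cons n).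
Proof.
apply/measurable_fun_rVP => i.
case: (@splitP 1 n i) => j ij.
  rewrite (_ : (fun _ => _) = snd)//; apply/funext => p; rewrite /rV_cons.
  have -> : i = lshift n j :> 'I_(1 + n) by exact: val_inj.
  by rewrite [LHS](@row_mxEl R 1 1 n) mxE (ord1 j) mulr1n.
rewrite (_ : (fun _ => _) = (fun x : 'rV[R]_n => x ord0 j) \o fst).
  by apply: measurableT_comp => //; exact: measurable_coord_rV.
apply/funext => p; rewrite /rV_cons.
have -> : i = rshift 1 j :> 'I_(1 + n) by exact: val_inj.
by rewrite [LHS](@row_mxEr R 1 1 n).
Qed.

Lemma measurable_rV_uncons n : measurable_fun setT (@rV_uncons n).
Proof.
apply/measurable_fun_pair; last exact: measurable_coord_rV.
apply/measurable_fun_rVP => i.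
rewrite (_ : (fun _ => _) = (fun x : 'rV[R]_n.+1 => x ord0 (rshift 1 i))).
  exact: measurable_coord_rV.
by apply/funext => x; rewrite mxE.
Qed.

Section lebesgue_rVS.
Local Open Scope ereal_scope.
Context n (mu : {sigma_finite_measure set 'rV[R]_n -> \bar R}).

Definition lebesgue_pair : set ('rV[R]_n * measurableTypeR R) -> \bar R :=
  mu \x lebesgue_measure.

HB.instance Definition _ := Measure.on lebesgue_pair.

Let lebesgue_pair_sigma_finite : sigma_finite setT lebesgue_pair.
Proof.
have /sigma_finiteP[F [TF ndF Foo]] := sigma_finiteT mu.
have /sigma_finiteP[G [TG ndG Goo]] := sigma_finiteT (@lebesgue_measure R).
exists (fun k => F k `*` G k).
  rewrite -setXTT TF TG predeqE => -[x y]; split.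
    move=> [/= [i _ Fix] [k _ Gky]]; exists (maxn i k) => //; split.
    - by move: x Fix; exact/subsetPset/ndF/leq_maxl.
    - by move: y Gky; exact/subsetPset/ndG/leq_maxr.
  by move=> [k _ []/= ? ?]; split; exists k.
move=> k; have [? ?] := Foo k; have [? ?] := Goo k.
split; first exact: measurableX.
by rewrite /lebesgue_pair product_measure1E// lte_mul_pinfty// ge0_fin_numE.
Qed.

HB.instance Definition _ := Measure_isSigmaFinite.Build _ _ _ lebesgue_pair
  lebesgue_pair_sigma_finite.

Definition lebesgue_rVS : set 'rV[R]_n.+1 -> \bar R :=
  pushforward lebesgue_pair (@rV_cons n).

Let nu : {measure set 'rV[R]_n.+1 -> \bar R} :=
  measure_function_pushforward__canonical__measure_function_Measure
    lebesgue_pair (@measurable_rV_cons n).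

Let lebesgue_rVS0 : lebesgue_rVS set0 = 0.
Proof. exact: (measure0 nu). Qed.

Let lebesgue_rVS_ge0 A : 0 <= lebesgue_rVS A.
Proof. exact: (measure_ge0 nu). Qed.

Let lebesgue_rVS_sigma_additive : semi_sigma_additive lebesgue_rVS.
Proof. exact: (@measure_semi_sigma_additive _ _ _ nu). Qed.

HB.instance Definition _ := isMeasure.Build _ _ _ lebesgue_rVS
  lebesgue_rVS0 lebesgue_rVS_ge0 lebesgue_rVS_sigma_additive.

Let lebesgue_rVS_sigma_finite : sigma_finite setT lebesgue_rVS.
Proof.
have [F FT Foo] := sigma_finiteT lebesgue_pair.
exists (fun k => @rV_uncons n @^-1` F k).
  by rewrite -preimage_bigcup -FT preimage_setT.
move=> k; have [mF Fk] := Foo k; split.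
  by rewrite -[X in measurable X]setTI; exact: measurable_rV_uncons.
rewrite /lebesgue_rVS /pushforward -comp_preimage.
rewrite (_ : _ \o _ = id) ?preimage_id//.
by apply/funext => x /=; rewrite rV_consK.
Qed.

HB.instance Definition _ := Measure_isSigmaFinite.Build _ _ _ lebesgue_rVS
  lebesgue_rVS_sigma_finite.

End lebesgue_rVS.

(* Lebesgue measure on R^n, as the n-fold product of the Lebesgue measure on
   the line (a unit mass on R^0). *)
Fixpoint lebesgue_rV n : {sigma_finite_measure set 'rV[R]_n -> \bar R} :=
  match n return {sigma_finite_measure set 'rV[R]_n -> \bar R} with
  | 0 => \d_(0 : 'rV[R]_0)
  | m.+1 => lebesgue_rVS (lebesgue_rV m)
  end.

End lebesgue_rV.

Section euclidean.
Context {R : realType} {n : nat}.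
Implicit Types x y : 'rV[R]_n.

Definition dotr x y : R := \sum_i x ord0 i * y ord0 i.

(* The library's norm on row vectors is the sup norm. *)
Definition eucl_dist x y : R := Num.sqrt (dotr (x - y) (x - y)).

Definition eucl_dist_pair (x y : 'rV[R]_n * R) : R :=
  Num.sqrt (dotr (x.1 - y.1) (x.1 - y.1) + (x.2 - y.2) ^+ 2).

(* Near each boundary point, A is the strict epigraph, in the direction of a
   unit vector e, of a Lipschitz function gamma of the component orthogonal to
   e; e plays the role of the last axis of a rotated coordinate system. *)
Definition lipschitz_boundary (A : set 'rV[R]_n) : Prop :=
  forall a, (closure A `\` interior A) a ->
  exists (e : 'rV[R]_n) (gamma : 'rV[R]_n -> R),
    [/\ dotr e e = 1, lipschitz (gamma : 'rV[R]_n -> R^o) &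
        \forall x \near a, A x <-> gamma (x - dotr x e *: e) < dotr x e].

End euclidean.

Section function_spaces.
Context {R : realType} {d} {T : measurableType d}.
Variables (mu : {measure set T -> \bar R}) (dist : T -> T -> R).

(* Functions are Borel representatives of their a.e. classes; their values
   outside D are irrelevant. *)
Definition L2 (D : set T) : set (T -> R) :=
  [set u : T -> R | measurable_fun D u /\ mu.-integrable D (fun x => ((u x) ^+ 2)%:E)].

(* Double integral over D x D, written as an iterated integral (the integrand is
   nonnegative); the integrand is 0 on the diagonal, since (u x - u x) ^+ 2 = 0. *)
Definition gagliardo (p : R) (D : set T) (u : T -> R) : \bar R :=
  (\int[mu]_(x in D) \int[mu]_(y in D)
     ((u x - u y) ^+ 2 / (dist x y) `^ p)%:E)%E.

Definition weak_cvg_L2 (D : set T) (v_ : nat -> T -> R) (v : T -> R) : Prop :=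
  [/\ forall j, L2 D (v_ j), L2 D v &
      forall phi, L2 D phi ->
        (\int[mu]_(x in D) (v_ j x * phi x)) @[j --> \oo] -->
        \int[mu]_(x in D) (v x * phi x)].

End function_spaces.

(* Gamma-convergence as eps -> 0+ of the functionals F eps, defined on
   dom eps, to F0, defined on D, for the convergence cvgto eps_ u_ u of the
   sequence u_ (along the parameters eps_) to u. *)
Definition is_Gamma_limit (R : realType) (X Y : Type)
    (cvgto : (nat -> R) -> (nat -> X) -> Y -> Prop)
    (dom : R -> set X) (F : R -> X -> \bar R)
    (D : set Y) (F0 : Y -> \bar R) : Prop :=
  forall eps_ : nat -> R, (forall j, 0 < eps_ j) -> eps_ j @[j --> \oo] --> 0 ->
  forall u : Y, D u ->
    (forall u_ : nat -> X, (forall j, dom (eps_ j) (u_ j)) ->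
       cvgto eps_ u_ u -> (F0 u <= limn_einf (fun j => F (eps_ j) (u_ j)))%E) /\
    (exists u_ : nat -> X, [/\ forall j, dom (eps_ j) (u_ j),
       cvgto eps_ u_ u & (limn_esup (fun j => F (eps_ j) (u_ j)) <= F0 u)%E]).

Section thin_domain.
Context {R : realType} (d : nat).
Implicit Types (omega : set 'rV[R]_d.-1) (eps s : R).

(* R^d is seen as R^(d-1) * R: its points are x = (x', x_d). *)
Local Notation Rd := ('rV[R]_d.-1 * measurableTypeR R)%type.

Definition lebesgue_Rd : {sigma_finite_measure set Rd -> \bar R} :=
  lebesgue_pair (lebesgue_rV d.-1).

(* The cylinder Omega_eps = omega x (0, eps) *)
Definition thin omega eps : set Rd := omega `*` `]0, eps[.

Definition Hs s (Omega : set Rd) : set (Rd -> R) :=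
  [set u : Rd -> R | L2 lebesgue_Rd Omega u /\
           (gagliardo lebesgue_Rd eucl_dist_pair (d%:R + 2 * s) Omega u < +oo)%E].

(* Convergence u_eps -> u: the rescaled functions (x', x_d) |-> u_eps(x', eps x_d)
   converge weakly in L^2(omega x (0,1)) to (x', x_d) |-> u x'. *)
Definition dimred_cvg omega (eps_ : nat -> R) (u_ : nat -> Rd -> R)
    (u : 'rV[R]_d.-1 -> R) : Prop :=
  weak_cvg_L2 lebesgue_Rd (thin omega 1)
    (fun j x => u_ j (x.1, eps_ j * x.2)) (fun x => u x.1).

Definition F_thin omega eps s (u : Rd -> R) : \bar R :=
  (((eps ^+ 2)^-1)%:E *
   gagliardo lebesgue_Rd eucl_dist_pair (d%:R + 2 * s) (thin omega eps) u)%E.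

Definition F_lim omega (s0 : R) (u : 'rV[R]_d.-1 -> R) : \bar R :=
  gagliardo (lebesgue_rV d.-1) eucl_dist (d%:R + 2 * s0) omega u.

(* F_lim is the squared Gagliardo seminorm of order 1/2 + s0 in dimension
   d - 1. *)
Lemma F_limE omega (s0 : R) (u : 'rV[R]_d.-1 -> R) : (0 < d)%N ->
  F_lim omega s0 u =
  gagliardo (lebesgue_rV d.-1) eucl_dist (d.-1%:R + 2 * (2^-1 + s0)) omega u.
Proof.
move=> d0; rewrite /F_lim.
suff -> : d%:R + 2 * s0 = d.-1%:R + 2 * (2^-1 + s0) :> R by [].
have -> : d%:R = d.-1%:R + 1 :> R by rewrite natr1 prednK.
have -> : 2 * (2^-1 + s0) = 1 + 2 * s0 :> R by rewrite mulrDr mulfV.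
by rewrite addrA.
Qed.

End thin_domain.

(* Main.v *)
Require Import Defs.
From mathcomp Require Import all_boot all_order all_algebra.
From mathcomp Require Import all_classical all_reals all_analysis.
From mathcomp Require Import measurable_realfun ring lra.
Import Order.TTheory GRing.Theory Num.Theory.
Import numFieldNormedType.Exports.
Set Implicit Arguments.
Unset Strict Implicit.
Unset Printing Implicit Defensive.
Local Open Scope classical_set_scope.
Local Open Scope ring_scope.

(** After rescaling the vertical variable, F_eps(u) is the double integral over
(omega x (0,1))^2 of (v(x) - v(y))^2 / (|x' - y'|^2 + eps^2 (x_d - y_d)^2)^(p/2)
with p = d + 2 s_eps; the kernel increases to |x' - y'|^-p as eps tends to 0.

Lower bound: on the pairs with |u| <= k and |x' - y'| >= 1/(k+1) the kernel
converges uniformly to k0 = |x' - y'|^-(d + 2 s_0). There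
(v(x) - v(y))^2 k0 >= 2 (v(x) - v(y)) (u(x') - u(y')) k0 - (u(x') - u(y'))^2 k0,
whose right-hand side is affine in v and hence continuous for the weak
convergence. Integrate, let j and then k tend to infinity.

Upper bound: if g is Lipschitz on omega, the functions (x', x_d) |-> g(x')
satisfy F_eps <= energy of g with exponent d + 2 s_eps, which tends to the energy
with exponent d + 2 s_0 < (d - 1) + 2. It remains to approximate u by Lipschitz
functions, in L2 and in energy. If u has infinite energy, density in L2 is enough.
Otherwise average u over the balls of radius r, within omega, with a Lipschitz
weight: a bounded Lipschitz domain contains a fixed proportion of each small ball
centred in it, so the error is controlled by the energy of u on the pairs at
distance less than 2r, which vanishes with r. A diagonal argument concludes. *)

(** * Integration *)

(** The weights of the averages are normalised by their mass inside [omega], which varies near the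
    boundary. The averages are therefore not convolutions, and translation invariance with Jensen's
    inequality does not bound their energy by that of u. What holds is energy(average) <= (1 +
    theta) energy(u) + K (1 + 1/theta) times the energy of u on near pairs, with K independent of r;
    fixing theta small and then letting r tend to 0 restores the constant 1 that the upper bound
    requires. With n = d - 1 and p0 = d + 2 s_0, the range 0 <= s_0 < 1/2 enters as n < p0 < n + 2.
    Above n, the kernel outside a ball of radius r has integral of order r^(n - p0); below n + 2,
    dist^2 / dist^p0 is integrable at the diagonal, so Lipschitz functions have finite energy. In
    the lower bound the exponents may approach p0 from either side, so the kernels are not monotone
    in j; they are compared up to a factor Lam > 1, absorbed at the end. The truncation at level k
    makes the test function paired with v_j bounded, whether or not u has finite energy. *)

Section integral_tools.
Local Open Scope ereal_scope.
Context {R : realType} {d} {T : measurableType d}.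
Variable mu : {measure set T -> \bar R}.

(** Nonnegative integrals are suprema over the simple functions below the integrand, so monotonicity
    needs no measurability. This spares measurability proofs for iterated integrals throughout. *)
Lemma ge0_le_integral_nomeas (D : set T) (f g : T -> \bar R) :
  (forall x, D x -> 0 <= f x) -> (forall x, D x -> f x <= g x) ->
  \int[mu]_(x in D) f x <= \int[mu]_(x in D) g x.
Proof.
move=> f0 fg; rewrite !ge0_integralE//; last first.
  by move=> x Dx; exact: le_trans (f0 x Dx) (fg x Dx).
apply: le_ereal_sup => _ [h hf <-]; exists h => // x.
by apply: le_trans (hf x) _; apply: lee_restrict.
Qed.

Lemma integral_EFin_fineK (D : set T) (f : T -> R) : measurable D ->
  mu.-integrable D (fun x => (f x)%:E) ->
  (\int[mu]_(x in D) f x)%R%:E = \int[mu]_(x in D) (f x)%:E.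
Proof. by move=> mD intf; rewrite fineK//; exact: integrable_fin_num. Qed.

Lemma integrable_bounded (D : set T) (f : T -> R) (M : R) : measurable D ->
  mu D < +oo -> measurable_fun D f -> (forall x, D x -> `|f x| <= M)%R ->
  mu.-integrable D (fun x => (f x)%:E).
Proof.
move=> mD Doo mf fM.
apply: (@le_integrable _ _ _ mu D mD _ (fun=> M%:E)).
- exact/measurable_EFinP.
- move=> x Dx; rewrite lee_fin; apply: le_trans (fM x Dx) _; exact: ler_norm.
- apply/integrableP; split; first exact: measurable_cst.
  by rewrite integral_cst// lte_mul_pinfty// fin_numE.
Qed.

Lemma integrable_dom (D : set T) (f g : T -> R) : measurable D ->
  measurable_fun D f -> mu.-integrable D (fun x => (g x)%:E) ->
  (forall x, D x -> `|f x| <= g x)%R -> mu.-integrable D (fun x => (f x)%:E).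
Proof.
move=> mD mf ig fg; apply: (@le_integrable _ _ _ mu D mD _ _ _ _ ig).
  exact/measurable_EFinP.
by move=> x Dx; rewrite lee_fin (le_trans (fg x Dx))// ler_norm.
Qed.

Lemma L2_integrable (D : set T) (f : T -> R) : measurable D -> mu D < +oo ->
  L2 mu D f -> mu.-integrable D (fun x => (f x)%:E).
Proof.
move=> mD Doo [mf if2].
apply: (@integrable_dom _ _ (fun x => 1 + f x ^+ 2)%R) => //.
  rewrite (_ : (fun x => (1 + f x ^+ 2)%:E) = (cst 1 \+ (fun x => (f x ^+ 2)%:E)))//.
  apply: integrableD => //.
  by apply: (@integrable_bounded _ (cst 1%R) 1%R) => // x _; rewrite normr1.
move=> x _; rewrite -real_normK ?num_real//.
by have := normr_ge0 (f x); have := sqr_ge0 (`|f x| - 1)%R; nra.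
Qed.

(* Cauchy-Schwarz against the constant 1, by expanding the square of |f| - a / V
   for a the integral of |f|. *)
Lemma sqr_Rintegral_le (B : set T) (f : T -> R) (V : R) : measurable B ->
  (0 < V)%R -> mu B <= V%:E -> L2 mu B f ->
  ((\int[mu]_(x in B) `|f x|) ^+ 2 <= V * \int[mu]_(x in B) f x ^+ 2)%R.
Proof.
move=> mB V0 BV f2.
have Boo : mu B < +oo by exact: le_lt_trans BV (ltry _).
have if1 := @L2_integrable _ _ mB Boo f2.
have iaf : mu.-integrable B (fun x => (`|f x|)%:E) by exact: integrable_abse if1.
set a := (\int[mu]_(x in B) `|f x|)%R.
set b := (\int[mu]_(x in B) f x ^+ 2)%R.
pose t := (a / V)%R.
have icst : mu.-integrable B (fun=> (t ^+ 2)%:E).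
  by apply: (@integrable_bounded _ (cst (t^+2)%R) (t ^+ 2)%R) => // x _;
    rewrite /= ger0_norm ?sqr_ge0.
have ita : mu.-integrable B (fun x => (- (2 * t) * `|f x|)%:E).
  under [X in integrable _ _ X]eq_fun do rewrite EFinM.
  exact: integrableZl.
have : (0 <= \int[mu]_(x in B) (f x ^+ 2 + (- (2 * t) * `|f x| + t ^+ 2)))%R.
  apply: Rintegral_ge0 => x _; rewrite -(@real_normK _ (f x)) ?num_real//.
  suff -> : (`|f x| ^+ 2 + (- (2 * t) * `|f x| + t ^+ 2) = (`|f x| - t) ^+ 2)%R.
    exact: sqr_ge0.
  by ring.
have i1 : mu.-integrable B (fun x => (- (2 * t) * `|f x| + t ^+ 2)%:E).
  by under [X in integrable _ _ X]eq_fun do rewrite EFinD; exact: integrableD.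
rewrite RintegralD//; last by case: f2.
rewrite RintegralD//.
rewrite RintegralZl// Rintegral_cst// -/a -/b => H.
have mBV : (fine (mu B) <= V)%R.
  by rewrite -lee_fin fineK// ge0_fin_numE.
have : (0 <= b + (- (2 * t) * a + t ^+ 2 * V))%R.
  by apply: le_trans H _; rewrite lerD2l lerD2l ler_wpM2l ?sqr_ge0.
rewrite (_ : _ + _ = b - a ^+ 2 / V)%R; last by rewrite /t; field; rewrite gt_eqF.
by rewrite subr_ge0 ler_pdivrMr// mulrC.
Qed.

End integral_tools.

Lemma measurable_natr_bool {R : realType} {d} {T : measurableType d} (b : T -> bool) :
  measurable_fun setT b -> measurable_fun setT (fun w => (b w)%:R : R).
Proof.
move=> mb.
rewrite (_ : (fun w => _) = \1_(b @^-1` [set true])); last first.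
  apply/funext => w; rewrite indicE; case: (boolP (b w)) => bw.
    by rewrite mem_set.
  by rewrite memNset//= => bw'; rewrite bw' in bw.
by apply: measurable_indic; rewrite -[X in measurable X]setTI; exact: mb.
Qed.

(** * Tonelli and Fubini on a product A x B *)

Section iterated_integrals.
Local Open Scope ereal_scope.
Context {R : realType} {d1 d2} {T1 : measurableType d1} {T2 : measurableType d2}.
Variables (m1 : {sigma_finite_measure set T1 -> \bar R})
  (m2 : {sigma_finite_measure set T2 -> \bar R}).
Variables (A : set T1) (B : set T2).
Hypotheses (mA : measurable A) (mB : measurable B).

Let patchX (f : T1 * T2 -> \bar R) x y :
  (f \_ (A `*` B)) (x, y) = ((fun x => ((fun y => f (x, y)) \_ B) y) \_ A) x.
Proof.
by rewrite /patch in_setX/=; case: (x \in A).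
Qed.

Let patchF (f : T1 * T2 -> \bar R) x :
  \int[m2]_y (f \_ (A `*` B)) (x, y) = ((fun x => \int[m2]_(y in B) f (x, y)) \_ A) x.
Proof.
under eq_integral do rewrite patchX.
rewrite /patch; case: ifPn => xA; last exact: integral0.
by rewrite [RHS]integral_mkcond.
Qed.

Let patchG (f : T1 * T2 -> \bar R) y :
  \int[m1]_x (f \_ (A `*` B)) (x, y) = ((fun y => \int[m1]_(x in A) f (x, y)) \_ B) y.
Proof.
under eq_integral do rewrite patchX.
rewrite -integral_mkcond /patch; case: ifPn => yB//; exact: integral0.
Qed.

(** Extension by 0 off A x B turns integrals over A and B into integrals over the whole spaces,
    where the theorems of Tonelli and Fubini apply. *)
Lemma iterated_integralE (f : T1 * T2 -> \bar R) :
  \int[m1]_(x in A) \int[m2]_(y in B) f (x, y) =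
  \int[m1]_x \int[m2]_y (f \_ (A `*` B)) (x, y).
Proof.
by rewrite integral_mkcond; apply: eq_integral => x _; rewrite patchF.
Qed.

Lemma iterated_integralE_sym (f : T1 * T2 -> \bar R) :
  \int[m2]_(y in B) \int[m1]_(x in A) f (x, y) =
  \int[m2]_y \int[m1]_x (f \_ (A `*` B)) (x, y).
Proof.
by rewrite integral_mkcond; apply: eq_integral => x _; rewrite patchG.
Qed.

Section tonelli_in.
Variable f : T1 * T2 -> \bar R.
Hypotheses (mf : measurable_fun (A `*` B) f)
  (f0 : forall z, (A `*` B) z -> 0 <= f z).

Let mfP : measurable_fun setT (f \_ (A `*` B)).
Proof. by apply/(measurable_restrictT _ _).1 => //; exact: measurableX. Qed.

Let fP0 z : 0 <= (f \_ (A `*` B)) z.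
Proof. exact: erestrict_ge0. Qed.

Lemma tonelli_in : \int[m1]_(x in A) \int[m2]_(y in B) f (x, y) =
  \int[m1 \x m2]_(z in A `*` B) f z.
Proof. by rewrite iterated_integralE [RHS]integral_mkcond fubini_tonelli1. Qed.

Lemma tonelli_in_sym : \int[m2]_(y in B) \int[m1]_(x in A) f (x, y) =
  \int[m1 \x m2]_(z in A `*` B) f z.
Proof.
by rewrite iterated_integralE_sym [RHS]integral_mkcond fubini_tonelli2.
Qed.

Lemma measurable_tonelli_in :
  measurable_fun A (fun x => \int[m2]_(y in B) f (x, y)).
Proof.
have := measurable_fun_fubini_tonelli_F (m2 := m2) _ mfP fP0.
rewrite /fubini_F; under eq_fun do rewrite patchF.
by move/(measurable_restrictT _ _).2; exact.
Qed.

End tonelli_in.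

Section fubini_in.
Variable f : T1 * T2 -> \bar R.
Hypothesis intf : (m1 \x m2).-integrable (A `*` B) f.

Let ifP : (m1 \x m2).-integrable setT (f \_ (A `*` B)).
Proof. by apply/integrable_restrict => //=; [exact: measurableX|rewrite setTI]. Qed.

Lemma fubini_in : \int[m1]_(x in A) \int[m2]_(y in B) f (x, y) =
  \int[m1 \x m2]_(z in A `*` B) f z.
Proof. by rewrite iterated_integralE [RHS]integral_mkcond integral12_prod_meas1. Qed.

Lemma fubini_in_sym : \int[m2]_(y in B) \int[m1]_(x in A) f (x, y) =
  \int[m1 \x m2]_(z in A `*` B) f z.
Proof.
by rewrite iterated_integralE_sym [RHS]integral_mkcond integral21_prod_meas1.
Qed.

End fubini_in.

Lemma product_measure_setX_lty : m1 A < +oo -> m2 B < +oo ->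
  (m1 \x m2) (A `*` B) < +oo.
Proof.
by move=> Aoo Boo; rewrite product_measure1E// lte_mul_pinfty// ge0_fin_numE.
Qed.

End iterated_integrals.

(** * Lipschitz approximation in Ahlfors regular sets *)

Section powers.
Context {R : realType}.
Implicit Types a b p t : R.

Lemma powR_expn a (k : nat) p : 0 <= a -> (a ^+ k) `^ p = (a `^ p) ^+ k.
Proof.
move=> a0; have := powRAC a k%:R p.
by rewrite (powR_mulrn k a0) (powR_mulrn k (powR_ge0 a p)).
Qed.

Lemma powR_lt1 a p : 0 < a < 1 -> 0 < p -> a `^ p < 1.
Proof.
move=> /andP[a0 a1] p0; have -> : 1 = 1 `^ p by rewrite powR1.
by apply: gt0_ltr_powR => //; rewrite nnegrE ltW.
Qed.

Lemma exists_exp2_gt t : exists k, t < 2 ^+ k.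
Proof.
exists (Num.trunc t).+1; apply: lt_le_trans (truncnS_gt _) _.
by rewrite -natrX ler_nat ltnW// ltn_expl.
Qed.

Lemma dyadic_ge rho t : 0 < rho -> rho <= t ->
  exists k, rho * 2 ^+ k <= t < rho * 2 ^+ k.+1.
Proof.
move=> rho0 rhot.
have : exists k, t < rho * 2 ^+ k.+1.
  have [k tk] := exists_exp2_gt (t / rho); exists k.
  rewrite -ltr_pdivrMl// mulrC (lt_le_trans tk)// exprS ler_peMl ?exprn_ge0 ?ler1n//.
move=> h; have [k tk kmin] := ex_minnP h; exists k; rewrite tk andbT.
case: k kmin tk => [|k] kmin tk; first by rewrite expr0 mulr1.
by rewrite leNgt; apply/negP => /kmin; rewrite ltnn.
Qed.

Lemma dyadic_lt rho t : 0 < t -> t < rho ->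
  exists k, rho / 2 ^+ k / 2 <= t < rho / 2 ^+ k.
Proof.
move=> t0 trho.
have : exists k, rho / 2 ^+ k / 2 <= t.
  have [k tk] := exists_exp2_gt (rho / t); exists k.
  rewrite -mulrA -invfM ler_pdivrMr ?mulr_gt0 ?exprn_gt0// -ler_pdivrMl// mulrC.
  by rewrite (le_trans (ltW tk))// ler_peMr ?exprn_ge0// ler1n.
move=> h; have [k tk kmin] := ex_minnP h; exists k; rewrite tk/=.
case: k kmin tk => [|k] kmin tk; first by rewrite expr0 divr1.
rewrite ltNge; apply/negP => H; have := kmin k.
rewrite ltnn => K; suff: false by []; apply: K.
by apply: le_trans H; rewrite exprSr invfM mulrA.
Qed.

End powers.

(** * Integrals of radial kernels from an upper bound on the measure of balls *)

Section radial_integrals.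
Context {R : realType} {d} {T : measurableType d}.
Variables (mu : {measure set T -> \bar R}) (dist : T -> T -> R) (D : set T).
Variables (C : R) (m : nat).
Hypothesis mD : measurable D.
Hypothesis mdist : forall x, measurable_fun setT (dist x).
Hypothesis dist_ge0 : forall x y, 0 <= dist x y.
Hypothesis C0 : 0 <= C.
Hypothesis ballD : forall (x : T) (rho : R), D x -> 0 < rho ->
  (mu (D `&` [set y | (dist x y < rho)%R]) <= (C * rho ^+ m)%:E)%E.

Lemma measurable_distball x rho : measurable [set y | dist x y < rho].
Proof.
rewrite -[X in measurable X]setTI.
have := @measurable_fun_ltr _ T R setT _ _ (mdist x) (measurable_cst rho).
by move=> /(_ measurableT [set true]); apply.
Qed.

(** Wherever f is not 0, a single term of the sum over k of [b k] times the indicator of the ball of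
    radius [rho k] already dominates it. The bound on the measure of balls turns the integral of
    this sum into a geometric series of ratio q. *)
Lemma dyadic_integral_le x (f : T -> R) (b rho : nat -> R) (A q : R) :
  D x -> (forall k, 0 <= b k) -> (forall k, 0 < rho k) -> 0 <= A -> 0 < q < 1 ->
  (forall k, b k * (C * rho k ^+ m) <= A * q ^+ k) ->
  (forall y, D y -> 0 <= f y) ->
  (forall y, D y -> f y = 0 \/ exists k, dist x y < rho k /\ f y <= b k) ->
  (\int[mu]_(y in D) (f y)%:E <= (A / (1 - q))%:E)%E.
Proof.
move=> Dx b0 rho0 A0 /andP[q0 q1] bA f0 fb.
pose g k y := ((b k)%:E * (\1_[set y | dist x y < rho k] y)%:E)%E.
have g0 k y : (0 <= g k y)%E by rewrite mule_ge0// lee_fin.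
have mg k : measurable_fun D (g k).
  apply: measurable_funeM; apply/measurable_EFinP.
  by apply: measurable_indic; exact: measurable_distball.
apply: (@le_trans _ _ (\int[mu]_(y in D) \sum_(0 <= k <oo) g k y)%E).
  apply: ge0_le_integral_nomeas => y Dy; first by rewrite lee_fin f0.
  have [->|[k [xyk fk]]] := fb _ Dy; first exact: nneseries_ge0.
  apply: le_trans (nneseries_lim_ge k.+1 (fun k _ _ => g0 k y)).
  rewrite big_nat_recr//=; apply: (@le_trans _ _ (g k y)).
    by rewrite /g indicE mem_set// mule1 lee_fin.
  by rewrite leeDr// sume_ge0.
rewrite integral_nneseries//.
apply: (@le_trans _ _ (\sum_(0 <= k <oo) (A * q ^+ k)%:E)%E).
  apply: lee_nneseries => k _; first by move=> _; exact: integral_ge0.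
  rewrite /g ge0_integralZl_EFin//; last first.
    by apply/measurable_EFinP/measurable_indic; exact: measurable_distball.
  rewrite integral_indic//; last exact: measurable_distball.
  apply: (@le_trans _ _ ((b k)%:E * (C * rho k ^+ m)%:E)%E).
    by rewrite lee_wpmul2l ?lee_fin// setIC ballD.
  by rewrite -EFinM lee_fin.
apply: lime_le.
  by apply: is_cvg_nneseries => k _ _; rewrite lee_fin mulr_ge0// exprn_ge0// ltW.
apply: nearW => k; rewrite sumEFin lee_fin.
have := @geometric_le_lim R k A q A0 q0; rewrite ger0_norm ?(ltW q0)//; exact.
Qed.

(** On the shell between rho_k / 2 and rho_k, with rho_k = rho / 2^k, the integrand is at most
    rho_k^2 / (rho_k / 2)^p and the measure at most C rho_k^m. The terms C 2^p rho_k^(m + 2 - p)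
    decrease geometrically because p < m + 2. *)
Lemma radial_near (p : R) : 0 <= p < m%:R + 2 -> exists2 K : R, 0 <= K &
  forall (x : T) (rho : R), D x -> 0 < rho ->
  (\int[mu]_(y in D) ((dist x y < rho)%R%:R * (dist x y ^+ 2 / dist x y `^ p))%:E
    <= (K * rho `^ (m%:R + 2 - p))%:E)%E.
Proof.
move=> /andP[p0 pm].
pose e := m%:R + 2 - p; have e0 : 0 < e by rewrite subr_gt0.
pose q : R := 2^-1 `^ e.
have q1 : 0 < q < 1.
  by rewrite powR_gt0//= powR_lt1// invr_gt0 ltr0n invf_lt1// ltr1n.
have q1' : 0 < 1 - q by rewrite subr_gt0; case/andP: q1.
exists (C * 2 `^ p / (1 - q)).
  by rewrite divr_ge0 ?(ltW q1')// mulr_ge0// powR_ge0.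
move=> x rho Dx rho0.
pose rk k := rho / 2 ^+ k.
have rk0 k : 0 < rk k by rewrite divr_gt0// exprn_gt0.
have -> : C * 2 `^ p / (1 - q) * rho `^ e = C * 2 `^ p * rho `^ e / (1 - q).
  by rewrite mulrAC.
apply: (@dyadic_integral_le x _ (fun k => rk k ^+ 2 / (rk k / 2) `^ p) rk) => //.
- by move=> k; rewrite divr_ge0 ?powR_ge0// exprn_ge0// ltW.
- by rewrite mulr_ge0 ?powR_ge0// mulr_ge0// powR_ge0.
- move=> k.
  have -> : q ^+ k = (2 ^- k) `^ e.
    by rewrite -exprVn powR_expn.
  rewrite -[leRHS]mulrA -powRM ?invr_ge0 ?exprn_ge0 ?(ltW rho0)// -/(rk k).
  rewrite /e powRB; last by rewrite (gt_eqF (rk0 k)) implybT.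
  rewrite -natrD powR_mulrn ?(ltW (rk0 k))// exprD.
  rewrite powRM ?invr_ge0 ?(ltW (rk0 k))//.
  have -> : 2^-1 `^ p = (2 `^ p)^-1 :> R.
    by rewrite -powR_inv1// -powRrM mulN1r powRN.
 by rewrite le_eqVlt; apply/orP; left; apply/eqP; field; rewrite !gt_eqF// powR_gt0.
- by move=> y Dy; rewrite mulr_ge0// divr_ge0 ?powR_ge0// exprn_ge0.
- move=> y Dy; have [yrho|] := ltP (dist x y) rho; last by left; rewrite mul0r.
  (* Points at distance 0 lie in no dyadic shell, but there the integrand vanishes through its
     factor [dist x y ^+ 2]. *)
  have := dist_ge0 x y; rewrite le_eqVlt => /predU1P[<-|xy0].
    by left; rewrite expr0n/= mul0r mulr0.
  right; have [k /andP[k1 k2]] := dyadic_lt xy0 yrho; exists k; split => //.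
  rewrite mul1r ler_pM ?invr_ge0 ?powR_ge0 ?exprn_ge0//.
    by rewrite lerXn2r// ?nnegrE ltW.
  rewrite lef_pV2 ?posrE ?powR_gt0 ?divr_gt0//.
  by rewrite ge0_ler_powR// nnegrE ltW// divr_gt0.
Qed.

(** The same sum over growing shells of radii rho 2^k: the kernel is bounded at the inner radius and
    the measure at the outer one, whence the factor 2^m, and the ratio 2^(m - p) is less than 1
    because p > m. *)
Lemma radial_far (p : R) : m%:R < p -> exists2 K : R, 0 <= K &
  forall (x : T) (rho : R), D x -> 0 < rho ->
  (\int[mu]_(y in D) ((rho <= dist x y)%R%:R / dist x y `^ p)%:E
    <= (K * rho `^ (m%:R - p))%:E)%E.
Proof.
move=> pm.
have p0 : 0 <= p by rewrite (le_trans _ (ltW pm)).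
pose e := m%:R - p; have e0 : 0 < - e by rewrite opprB subr_gt0.
pose q : R := 2 `^ e.
have q1 : 0 < q < 1.
  rewrite /q powR_gt0//= -(opprK e) powRN invf_lt1 ?powR_gt0//.
  have : 1 `^ (- e) < 2 `^ (- e) by apply: gt0_ltr_powR; rewrite ?nnegrE ?ltr1n.
  by rewrite powR1.
have q1' : 0 < 1 - q by rewrite subr_gt0; case/andP: q1.
exists (C * 2 ^+ m / (1 - q)).
  by rewrite divr_ge0 ?(ltW q1')// mulr_ge0// exprn_ge0.
move=> x rho Dx rho0.
pose rk k := rho * 2 ^+ k.
have rk0 k : 0 < rk k by rewrite mulr_gt0// exprn_gt0.
have -> : C * 2 ^+ m / (1 - q) * rho `^ e = C * 2 ^+ m * rho `^ e / (1 - q).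
  by rewrite mulrAC.
apply: (@dyadic_integral_le x _ (fun k => (rk k `^ p)^-1) (fun k => rk k.+1)) => //.
- by move=> k; rewrite invr_ge0 powR_ge0.
- by rewrite mulr_ge0 ?powR_ge0// mulr_ge0// exprn_ge0.
- move=> k.
  have -> : q ^+ k = (2 ^+ k) `^ e by rewrite powR_expn.
  rewrite -[leRHS]mulrA -powRM ?exprn_ge0 ?(ltW rho0)// -/(rk k).
  rewrite /e powRB; last by rewrite (gt_eqF (rk0 k)) implybT.
  rewrite powR_mulrn ?(ltW (rk0 k))//.
  have -> : rk k.+1 = 2 * rk k by rewrite /rk exprS; ring.
  rewrite exprMn.
  by rewrite le_eqVlt; apply/orP; left; apply/eqP; ring.
- by move=> y Dy; rewrite mulr_ge0// invr_ge0 powR_ge0.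
- move=> y Dy; have [yrho|] := leP rho (dist x y); last by left; rewrite mul0r.
  right; have [k /andP[k1 k2]] := dyadic_ge rho0 yrho; exists k; split => //.
  rewrite mul1r lef_pV2 ?posrE ?powR_gt0 ?(lt_le_trans (rk0 k))//.
  by rewrite ge0_ler_powR// nnegrE ltW// (lt_le_trans (rk0 k)).
Qed.

End radial_integrals.

(** The inverse is the power of exponent -1, also at 0, where both take the value 0. *)
Lemma measurable_funV_ge0 {R : realType} {d} {T : measurableType d} (A : set T)
    (f : T -> R) : (forall x, A x -> 0 <= f x) ->
  measurable_fun A f -> measurable_fun A (fun x => (f x)^-1).
Proof.
move=> f0 mf; apply: (eq_measurable_fun (fun x => f x `^ (-1))).
  by move=> x /set_mem Ax; rewrite powR_inv1// f0.
exact: (measurableT_comp (measurable_powR (-1)) mf).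
Qed.

(** * Averages against normalised Lipschitz hats *)

Section hat_averages.
Context {R : realType} {d} {T : measurableType d}.
Variables (mu : {sigma_finite_measure set T -> \bar R}) (dist : T -> T -> R).
Variables (D : set T) (m : nat) (C c r0 : R).
Implicit Types (r rho : R) (x y z : T).
Hypothesis mD : measurable D.
Hypothesis Doo : (mu D < +oo)%E.
Hypothesis mdist : measurable_fun setT (fun z : T * T => dist z.1 z.2).
Hypothesis dist_ge0 : forall x y, 0 <= dist x y.
Hypothesis dist_sym : forall x y, dist x y = dist y x.
Hypothesis dist_tri : forall x y z, dist x z <= dist x y + dist y z.
Hypotheses (C0 : 0 < C) (c0 : 0 < c).
Hypothesis ball_le : forall (x : T) (rho : R), D x -> 0 < rho ->
  (mu (D `&` [set y | (dist x y < rho)%R]) <= (C * rho ^+ m)%:E)%E.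
Hypothesis ball_ge : forall (x : T) (rho : R), D x -> 0 < rho <= r0 ->
  ((c * rho ^+ m)%:E <= mu (D `&` [set y | (dist x y < rho)%R]))%E.

Lemma measurable_dist1 x : measurable_fun setT (dist x).
Proof.
apply: (measurableT_comp (f := fun z : T * T => dist z.1 z.2) mdist
  (g := fun y => (x, y))).
exact: measurable_fun_pair.
Qed.

(** A cutoff of the ball of radius r that is Lipschitz in its centre x, which makes the averages
    Lipschitz, and at least 1/2 on the half ball, which makes its mass of order r^m. *)
Definition hat (r : R) (x z : T) : R := Num.max 0 (1 - dist x z / r).

Lemma hat_ge0 r x z : 0 <= hat r x z.
Proof. by rewrite le_max lexx. Qed.

Lemma hat_le1 r x z : 0 < r -> hat r x z <= 1.
Proof. by move=> r0_; rewrite ge_max ler01/= gerBl divr_ge0// ltW. Qed.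

Lemma hat_eq0 r x z : 0 < r -> r <= dist x z -> hat r x z = 0.
Proof. by move=> r_0 h; apply/max_idPl; rewrite subr_le0 ler_pdivlMr// mul1r. Qed.

Lemma hat_ge_half r x z : 0 < r -> dist x z < r / 2 -> 2^-1 <= hat r x z.
Proof.
move=> r_0 h; rewrite le_max; apply/orP; right.
have : dist x z / r <= 2^-1 by rewrite ler_pdivrMr// mulrC ltW.
lra.
Qed.

Lemma hat_lipschitz r x y z : 0 < r ->
  `|hat r x z - hat r y z| <= dist x y / r.
Proof.
move=> r_0.
have h (a b : R) : `|Num.max 0 a - Num.max 0 b| <= `|a - b|.
  have := ler_norm (a - b); have := ler_norm (b - a); rewrite (distrC b a).
  have := normr_ge0 (a - b).
  by rewrite ler_norml /Num.max; case: ltP => ?; case: ltP => ?; lra.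
apply: le_trans (h _ _) _.
have -> : 1 - dist x z / r - (1 - dist y z / r) = (dist y z - dist x z) / r.
  by ring.
rewrite normrM (@ger0_norm _ r^-1) ?invr_ge0 ?(ltW r_0)//.
rewrite ler_pM2r ?invr_gt0// ler_norml.
have := dist_tri x y z; have := dist_tri y x z; rewrite (dist_sym y x); lra.
Qed.

Lemma measurable_hat2 r : measurable_fun setT (fun z : T * T => hat r z.1 z.2).
Proof.
apply: measurable_maxr => //; apply: measurable_funB => //.
exact: measurable_funM.
Qed.

Lemma measurable_hat r x : measurable_fun setT (hat r x).
Proof.
apply: (measurableT_comp (f := fun z : T * T => hat r z.1 z.2)
  (measurable_hat2 r) (g := fun y => (x, y))).
exact: measurable_fun_pair.
Qed.

Lemma integrable_hat r x : 0 < r -> mu.-integrable D (fun z => (hat r x z)%:E).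
Proof.
move=> r_0; apply: (@integrable_bounded _ _ _ _ D _ 1) => //.
  by apply: measurable_funTS; exact: measurable_hat.
by move=> z _; rewrite ger0_norm ?hat_ge0 ?hat_le1.
Qed.

Definition mass (r : R) (x : T) : R := \int[mu]_(z in D) hat r x z.

(** Dividing by the mass, which depends on how much of the ball lies in D, makes the averages
    preserve constants. *)
Definition weight (r : R) (x z : T) : R := hat r x z / mass r x.

Definition average (r : R) (u : T -> R) (x : T) : R :=
  \int[mu]_(z in D) (u z * weight r x z).

Let mball x rho : measurable [set y | dist x y < rho].
Proof. exact: measurable_distball (@measurable_dist1) x rho. Qed.

(** The hat is at least 1/2 on the ball of radius r / 2, whose part in D has measure at least c (r /
    2)^m. *)
Lemma mass_ge r x : D x -> 0 < r <= r0 -> c / 2 ^+ m.+1 * r ^+ m <= mass r x.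
Proof.
move=> Dx /andP[r_0 rr0].
rewrite -lee_fin integral_EFin_fineK//; last exact: integrable_hat.
apply: (@le_trans _ _ (\int[mu]_(z in D)
    ((2^-1)%:E * (\1_[set y | (dist x y < r / 2)%R] z)%:E))%E); last first.
  apply: ge0_le_integral_nomeas => z Dz.
    by rewrite mule_ge0// lee_fin.
  rewrite -EFinM lee_fin indicE.
  have [h|h] := ltP (dist x z) (r / 2).
    by rewrite mem_set// mulr1 hat_ge_half.
  by rewrite memNset ?mulr0 ?hat_ge0//=; apply/negP; rewrite -leNgt.
rewrite ge0_integralZl_EFin//; last first.
  apply/measurable_EFinP/measurable_indic; exact: mball.
rewrite integral_indic//.
rewrite setIC.
have -> : c / 2 ^+ m.+1 * r ^+ m = 2^-1 * (c * (r / 2) ^+ m).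
  by rewrite expr_div_n exprS invfM; ring.
rewrite EFinM lee_wpmul2l ?lee_fin//; apply: ball_ge => //.
by apply/andP; split; lra.
Qed.

Let A1 : R := 2 ^+ m.+1 / c.

Let A10 : 0 < A1. Proof. by rewrite divr_gt0// exprn_gt0. Qed.

Lemma mass_gt0 r x : D x -> 0 < r <= r0 -> 0 < mass r x.
Proof.
move=> Dx rr; apply: lt_le_trans (mass_ge Dx rr).
by case/andP: rr => r_0 _; rewrite mulr_gt0 ?exprn_gt0// divr_gt0// exprn_gt0.
Qed.

Let massV_le r x : D x -> 0 < r <= r0 -> (mass r x)^-1 <= A1 / r ^+ m.
Proof.
move=> Dx rr; have := mass_ge Dx rr.
case/andP: (rr) => r_0 _.
have -> : A1 / r ^+ m = (c / 2 ^+ m.+1 * r ^+ m)^-1.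
  by rewrite /A1; field; rewrite !expf_neq0// !gt_eqF.
rewrite lef_pV2 ?posrE ?mass_gt0// mulr_gt0 ?exprn_gt0//.
by rewrite divr_gt0// exprn_gt0.
Qed.

Lemma weight_ge0 r x z : 0 <= weight r x z.
Proof. by rewrite divr_ge0 ?hat_ge0// Rintegral_ge0// => t _; exact: hat_ge0. Qed.

Lemma weight_eq0 r x z : 0 < r -> r <= dist x z -> weight r x z = 0.
Proof. by move=> r_0 rx; rewrite /weight hat_eq0// mul0r. Qed.

(** The first term pays for the variation of the numerator of the weight, the second for the
    variation of its mass as bounded by [mass_lip]. *)
Let A2 : R := A1 + A1 ^+ 2 * C * 2 ^+ m.

Let A2_ge : A1 <= A2.
Proof. by rewrite lerDl mulr_ge0 ?exprn_ge0// mulr_ge0 ?exprn_ge0// ltW. Qed.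

Let weight_le1 r x z : D x -> 0 < r <= r0 -> weight r x z <= A1 / r ^+ m.
Proof.
move=> Dx rr; apply: le_trans (massV_le Dx rr).
by rewrite ler_piMl ?invr_ge0 ?(ltW (mass_gt0 Dx rr))// hat_le1//; case/andP: rr.
Qed.

Lemma integral_weight r x : D x -> 0 < r <= r0 ->
  \int[mu]_(z in D) weight r x z = 1.
Proof.
move=> Dx rr; rewrite RintegralZr//; last by apply: integrable_hat; case/andP: rr.
by rewrite divff// gt_eqF// mass_gt0.
Qed.

(** As y is within r of x, both hats vanish outside the ball of radius 2 r about x. On that ball
    they differ by at most [dist x y / r]. *)
Let mass_lip r x y : D x -> D y -> 0 < r -> dist x y <= r ->
  `|mass r x - mass r y| <= dist x y / r * (C * (2 * r) ^+ m).
Proof.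
move=> Dx Dy r_0 xyr.
rewrite -(RintegralB mD (integrable_hat x r_0) (integrable_hat y r_0)).
have mdiff : measurable_fun D (fun z => hat r x z - hat r y z).
  by apply: measurable_funTS; apply: measurable_funB; exact: measurable_hat.
have idiff : mu.-integrable D (fun z => (hat r x z - hat r y z)%:E).
  exact: (integrableB mD (integrable_hat x r_0) (integrable_hat y r_0)).
apply: le_trans (le_normr_Rintegral mD idiff) _.
rewrite -lee_fin integral_EFin_fineK//; last exact: (integrable_abse idiff).
apply: (@le_trans _ _ (\int[mu]_(z in D)
    ((dist x y / r)%:E * (\1_[set z | (dist x z < 2 * r)%R] z)%:E))%E).
  apply: ge0_le_integral_nomeas => z Dz; first by rewrite lee_fin.
  rewrite -EFinM lee_fin indicE.
  have [h|h] := ltP (dist x z) (2 * r).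
    by rewrite mem_set// mulr1 hat_lipschitz.
  rewrite memNset ?mulr0//=; last by apply/negP; rewrite -leNgt.
  have yz : r <= dist y z by have := dist_tri x y z; lra.
  by rewrite !hat_eq0// ?subrr ?normr0//; lra.
rewrite ge0_integralZl_EFin//; last 2 first.
  by apply/measurable_EFinP/measurable_indic; exact: mball.
  by rewrite divr_ge0// ltW.
rewrite integral_indic//.
rewrite setIC [leRHS]EFinM lee_wpmul2l ?lee_fin ?divr_ge0 ?(ltW r_0)//.
by apply: ball_le => //; rewrite mulr_gt0.
Qed.

(** If [dist x y] exceeds r, the second bound follows from the first, since the factor
    [dist x y / r] is then above 1. Otherwise the quotient rule separates the variation of the hat
    from that of the mass. *)
Lemma weight_bounds : exists2 A : R, 0 < A & forall r, 0 < r <= r0 ->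
  (forall x z, D x -> weight r x z <= A / r ^+ m) /\
  (forall x y z, D x -> D y ->
    `|weight r x z - weight r y z| <= dist x y / r * (A / r ^+ m)).
Proof.
exists A2; first exact: lt_le_trans A2_ge.
move=> r rr; case/andP: (rr) => r_0 _.
have A12 : A1 / r ^+ m <= A2 / r ^+ m.
  by rewrite ler_pM2r// invr_gt0 exprn_gt0.
split=> [x z Dx|x y z Dx Dy].
  exact: le_trans (weight_le1 z Dx rr) A12.
have [xyr|ryx] := leP (dist x y) r; last first.
  apply: (@le_trans _ _ (A1 / r ^+ m)).
    have := weight_le1 z Dx rr; have := weight_le1 z Dy rr.
    have := weight_ge0 r x z; have := weight_ge0 r y z.
    by rewrite ler_norml; lra.
  apply: le_trans A12 _; rewrite ler_peMl//; last by rewrite ler_pdivlMr// mul1r ltW.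
  by rewrite divr_ge0 ?exprn_ge0 ?(ltW r_0)// (le_trans _ A2_ge)// ltW.
have mx := mass_gt0 Dx rr; have my := mass_gt0 Dy rr.
have -> : weight r x z - weight r y z = (hat r x z - hat r y z) / mass r x +
    hat r y z * ((mass r y - mass r x) / (mass r x * mass r y)).
  by rewrite /weight; field; rewrite !gt_eqF.
apply: le_trans (ler_normD _ _) _.
set t := dist x y / r.
have t0 : 0 <= t by rewrite divr_ge0// ltW.
have h1 : `|(hat r x z - hat r y z) / mass r x| <= t * (A1 / r ^+ m).
  rewrite normrM (@ger0_norm _ (mass r x)^-1) ?invr_ge0 ?(ltW mx)//.
  by rewrite ler_pM ?invr_ge0 ?(ltW mx) ?massV_le// hat_lipschitz.
have h2 : `|hat r y z * ((mass r y - mass r x) / (mass r x * mass r y))| <=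
    t * (C * (2 * r) ^+ m) * (A1 / r ^+ m * (A1 / r ^+ m)).
  rewrite normrM (@ger0_norm _ (hat r y z)) ?hat_ge0//.
  apply: (@le_trans _ _ (`|(mass r y - mass r x) / (mass r x * mass r y)|)).
    by rewrite ler_piMl// hat_le1.
  rewrite normrM (@ger0_norm _ (mass r x * mass r y)^-1); last first.
    by rewrite invr_ge0 mulr_ge0// ltW.
  rewrite ler_pM ?invr_ge0 ?mulr_ge0 ?(ltW mx) ?(ltW my)//.
    by rewrite distrC mass_lip.
  by rewrite invfM ler_pM ?invr_ge0 ?(ltW mx) ?(ltW my) ?massV_le.
apply: le_trans (lerD h1 h2) _.
rewrite /A2 le_eqVlt exprMn; apply/orP; left; apply/eqP; field.
by rewrite expf_neq0// gt_eqF.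
Qed.

(** Tonelli's theorem applies to the positive and negative parts separately, so no integrability is
    asked of f: where the integral is infinite, [fine] still yields a measurable function. *)
Lemma measurable_Rintegral_in (A : set T) (f : T * T -> R) : measurable A ->
  measurable_fun (A `*` D) f ->
  measurable_fun A (fun x => \int[mu]_(z in D) f (x, z)).
Proof.
move=> mA mf; have mef : measurable_fun (A `*` D) (EFin \o f) by exact/measurable_EFinP.
have mAD : measurable (A `*` D) by exact: measurableX.
apply: (measurable_comp (F := setT) (f := fine)) => //.
under eq_fun do rewrite integralE.
apply: emeasurable_funB.
  have mp : measurable_fun (A `*` D) ((EFin \o f)^\+)%E by exact: measurable_funepos.
  have H := (@measurable_tonelli_in _ _ _ _ _ mu A D mA mD
    ((EFin \o f)^\+)%E mp (fun w _ => funepos_ge0 _ w)).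
  apply: eq_measurable_fun H => x _.
  by apply: eq_integral => y _; rewrite !funeposE.
have mn : measurable_fun (A `*` D) ((EFin \o f)^\-)%E by exact: measurable_funeneg.
have H := (@measurable_tonelli_in _ _ _ _ _ mu A D mA mD
  ((EFin \o f)^\-)%E mn (fun w _ => funeneg_ge0 _ w)).
apply: eq_measurable_fun H => x _.
by apply: eq_integral => y _; rewrite !funenegE.
Qed.

Lemma measurable_mass r : measurable_fun setT (mass r).
Proof.
have mh : measurable_fun (setT `*` D) (fun w : T * T => hat r w.1 w.2).
  by apply: measurable_funTS; exact: measurable_hat2.
have H := measurable_Rintegral_in measurableT mh.
exact: H.
Qed.

Lemma measurable_weight2 r :
  measurable_fun setT (fun z : T * T => weight r z.1 z.2).
Proof.
apply: measurable_funM; first exact: measurable_hat2.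
apply: measurable_funV_ge0 => [w _|]; first by apply: Rintegral_ge0 => t _; exact: hat_ge0.
exact: (measurableT_comp (measurable_mass r)).
Qed.

Lemma measurable_average r u : measurable_fun setT u ->
  measurable_fun setT (average r u).
Proof.
move=> mu_.
have mh : measurable_fun (setT `*` D) (fun w : T * T => u w.2 * weight r w.1 w.2).
  apply: measurable_funTS; apply: measurable_funM; last exact: measurable_weight2.
  exact: measurableT_comp.
have H := measurable_Rintegral_in measurableT mh.
exact: H.
Qed.

End hat_averages.

(** * Error and Lipschitz bounds for the averages *)

Section average_bounds.
Context {R : realType} {d} {T : measurableType d}.
Variables (mu : {sigma_finite_measure set T -> \bar R}) (dist : T -> T -> R).
Variables (D : set T) (m : nat) (C c r0 : R).
Implicit Types (r rho : R) (x y z : T).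
Hypothesis mD : measurable D.
Hypothesis Doo : (mu D < +oo)%E.
Hypothesis mdist : measurable_fun setT (fun z : T * T => dist z.1 z.2).
Hypothesis dist_ge0 : forall x y, 0 <= dist x y.
Hypothesis dist_sym : forall x y, dist x y = dist y x.
Hypothesis dist_tri : forall x y z, dist x z <= dist x y + dist y z.
Hypotheses (C0 : 0 < C) (c0 : 0 < c).
Hypothesis ball_le : forall (x : T) (rho : R), D x -> 0 < rho ->
  (mu (D `&` [set y | (dist x y < rho)%R]) <= (C * rho ^+ m)%:E)%E.
Hypothesis ball_ge : forall (x : T) (rho : R), D x -> 0 < rho <= r0 ->
  ((c * rho ^+ m)%:E <= mu (D `&` [set y | (dist x y < rho)%R]))%E.
Variable u : T -> R.
Hypothesis u2 : L2 mu D u.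

Local Notation weight := (weight mu dist D).
Local Notation average := (average mu dist D).

(** Deliberately not divided by the measure of the ball: its integral in x then compares directly
    with the energy of u on near pairs. *)
Definition oscillation rho x : \bar R :=
  (\int[mu]_(z in D) ((dist x z < rho)%R%:R * (u z - u x) ^+ 2)%:E)%E.

Let mball x rho : measurable [set y | dist x y < rho].
Proof. by apply: measurable_distball => x0; exact: (measurable_dist1 mdist). Qed.

Lemma integral_ball (f : T -> R) x rho :
  (\int[mu]_(z in D `&` [set z | (dist x z < rho)%R]) (f z)%:E =
   \int[mu]_(z in D) ((dist x z < rho)%R%:R * f z)%:E)%E.
Proof.
rewrite integral_mkcondr; apply: eq_integral => z _; rewrite /patch.
case: ifPn => [/set_mem/= ->|/negP h]; first by rewrite mul1r.
suff /negbTE -> : ~~ (dist x z < rho) by rewrite mul0r.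
by apply/negP => zr; apply: h; exact: mem_set.
Qed.

Lemma L2_subcst a : L2 mu D (fun z => u z - a).
Proof.
split; first by apply: measurable_funB => //; case: u2.
have iu := L2_integrable mD Doo u2.
rewrite (_ : (fun x => _) = (fun x => (u x ^+ 2)%:E) \+
    (fun x => (- (2 * a))%:E * (u x)%:E) \+ (fun=> (a ^+ 2)%:E))%E; last first.
  by apply/funext => x; rewrite -EFinM -!EFinD; congr EFin; ring.
apply: integrableD => //; last first.
  by apply: (@integrable_bounded _ _ _ _ D (cst (a ^+ 2)) `|a ^+ 2|).
by apply: integrableD => //; [case: u2|exact: integrableZl].
Qed.

(** Cauchy-Schwarz on the ball of radius rho, which carries the whole integral of g and meets D in
    measure at most C rho^m. *)
Lemma sqr_integral_local x (f g : T -> R) (M rho : R) : D x -> 0 < rho -> 0 <= M ->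
  L2 mu D f -> measurable_fun D g -> (forall z, D z -> `|g z| <= M * `|f z|) ->
  (forall z, D z -> rho <= dist x z -> g z = 0) ->
  (((\int[mu]_(z in D) g z)%R ^+ 2)%:E <= (M ^+ 2 * (C * rho ^+ m))%:E *
    \int[mu]_(z in D) ((dist x z < rho)%R%:R * f z ^+ 2)%:E)%E.
Proof.
move=> Dx rho0 M0 [mf f2] mg gf g0.
pose B := D `&` [set z | dist x z < rho].
have mB : measurable B by apply: measurableI => //; exact: mball.
have BD : B `<=` D by move=> z [].
have f2B : L2 mu B f.
  by split; [exact: measurable_funS mf|exact: integrableS f2].
have Boo : (mu B < +oo)%E by apply: le_lt_trans Doo; apply: le_measure; rewrite ?inE.
have ifB := L2_integrable mB Boo f2B.
have iaf : mu.-integrable B (fun z => (`|f z|)%:E) by exact: integrable_abse ifB.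
have iMf : mu.-integrable B (fun z => (M * `|f z|)%:E).
  by under [X in integrable _ _ X]eq_fun do rewrite EFinM; exact: integrableZl.
have igB : mu.-integrable B (fun z => (g z)%:E).
  apply: (integrable_dom mB _ iMf); first exact: measurable_funS mg.
  by move=> z /BD; exact: gf.
have -> : \int[mu]_(z in D) g z = \int[mu]_(z in B) g z.
  rewrite Rintegral_mkcondr; apply: eq_Rintegral => z /set_mem Dz.
  rewrite /patch; case: ifPn => // /negP h; apply: g0 => //.
  by rewrite leNgt; apply/negP => zr; apply: h; exact: mem_set.
rewrite -integral_ball -/B.
have [_ if2] := f2B.
rewrite -(integral_EFin_fineK mB if2) -EFinM lee_fin.
have V0 : 0 < C * rho ^+ m by rewrite mulr_gt0// exprn_gt0.
have := sqr_Rintegral_le mB V0 (ball_le Dx rho0) f2B.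
set I2 := (X in _ <= _ * X); set I1 := (X in X ^+ 2 <= _) => H.
rewrite -mulrA; apply: (@le_trans _ _ (M ^+ 2 * I1 ^+ 2)); last first.
  by rewrite ler_wpM2l// sqr_ge0.
rewrite -exprMn -[leLHS]real_normK ?num_real// lerXn2r ?nnegrE//.
  by rewrite mulr_ge0// Rintegral_ge0.
apply: le_trans (le_normr_Rintegral mB igB) _.
rewrite /I1 -RintegralZl//; apply: le_Rintegral => //.
  exact: (integrable_abse igB).
by move=> z /BD; exact: gf.
Qed.

Let mweight r x : measurable_fun D (weight r x).
Proof.
apply: measurable_funTS.
apply: (measurableT_comp (measurable_weight2 mu mD mdist r) (g := fun y => (x, y))).
exact: measurable_fun_pair.
Qed.

Let weight_le r x : D x -> 0 < r <= r0 -> exists M, forall z, `|weight r x z| <= M.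
Proof.
move=> Dx rr; have [A A0 /(_ r rr)[wA _]] := weight_bounds mD Doo mdist dist_ge0
  dist_sym dist_tri C0 c0 ball_le ball_ge.
by exists (A / r ^+ m) => z; rewrite ger0_norm ?wA// weight_ge0.
Qed.

Let iweight r x : D x -> 0 < r <= r0 ->
  mu.-integrable D (fun z => (weight r x z)%:E).
Proof.
by move=> Dx rr; have [M wM] := weight_le Dx rr; exact: integrable_bounded (mweight r x) _.
Qed.

Let iuweight r x a : D x -> 0 < r <= r0 ->
  mu.-integrable D (fun z => ((u z - a) * weight r x z)%:E).
Proof.
move=> Dx rr; have [M wM] := weight_le Dx rr.
have iu := L2_integrable mD Doo (L2_subcst a).
have iau : mu.-integrable D (fun z => (M * `|u z - a|)%:E).
  under [X in integrable _ _ X]eq_fun do rewrite EFinM.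
  by apply: integrableZl => //; exact: (integrable_abse iu).
apply: (integrable_dom mD _ iau).
  apply: measurable_funM => //; by case: (L2_subcst a).
by move=> z _; rewrite normrM mulrC ler_wpM2r.
Qed.

(** The weights have integral 1, so the constant a goes under the integral sign. Taking a = u x
    brings in the oscillation of u at x. *)
Lemma average_subcst r x a : D x -> 0 < r <= r0 ->
  average r u x - a = \int[mu]_(z in D) ((u z - a) * weight r x z).
Proof.
move=> Dx rr.
have i0 := iuweight 0 Dx rr.
have h : average r u x = \int[mu]_(z in D) ((u z - 0) * weight r x z).
  by apply: eq_Rintegral => z _; rewrite subr0.
have iaw : mu.-integrable D (fun z => (a * weight r x z)%:E).
  under [X in integrable _ _ X]eq_fun do rewrite EFinM.
  by apply: integrableZl => //; exact: iweight.
have ha : \int[mu]_(z in D) (a * weight r x z) = a.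
  rewrite RintegralZl//; last exact: iweight.
  by rewrite (integral_weight mD Doo mdist dist_ge0 c0 ball_ge Dx rr) mulr1.
rewrite h -[X in _ - X = _]ha -RintegralB//; apply: eq_Rintegral => z _.
by rewrite subr0 mulrBl.
Qed.

Let subr_trans2 (p q s I1 I2 : R) : p - s = I1 -> q - s = I2 -> p - q = I1 - I2.
Proof. by move=> <- <-; ring. Qed.

(** Both bounds apply [sqr_integral_local] to u - u x on the ball of radius 2 r: multiplied by the
    weight at x, with M = A / r^m, or by the difference of the weights at x and y, with M = (dist x
    y / r) (A / r^m). When y is within r of x, both weights vanish outside this ball. The constant K
    is A^2 C 2^m, from M^2 times C (2 r)^m. *)
Lemma average_bounds : exists2 K : R, 0 < K & forall r, 0 < r <= r0 ->
  (forall x, D x -> (((average r u x - u x) ^+ 2)%:E <=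
     (K / r ^+ m)%:E * oscillation (2 * r) x)%E) /\
  (forall x y, D x -> D y -> dist x y < r ->
    (((average r u x - average r u y) ^+ 2)%:E <=
     (K / r ^+ m.+2 * dist x y ^+ 2)%:E * oscillation (2 * r) x)%E).
Proof.
have [A A0 HA] := weight_bounds mD Doo mdist dist_ge0
  dist_sym dist_tri C0 c0 ball_le ball_ge.
exists (A ^+ 2 * C * 2 ^+ m); first by rewrite !mulr_gt0 ?exprn_gt0.
move=> r rr; have [wA wL] := HA r rr.
case/andP: (rr) => r_0 _.
have r20 : 0 < 2 * r by rewrite mulr_gt0.
have Ar : 0 <= A / r ^+ m by rewrite divr_ge0 ?exprn_ge0 ?(ltW r_0) ?(ltW A0).
split=> [x Dx|x y Dx Dy xyr].
  rewrite average_subcst//.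
  have -> : A ^+ 2 * C * 2 ^+ m / r ^+ m = (A / r ^+ m) ^+ 2 * (C * (2 * r) ^+ m).
    by rewrite [(2 * r) ^+ m]exprMn; field; rewrite expf_neq0// gt_eqF.
  apply: sqr_integral_local => //; first exact: L2_subcst.
  - by apply: measurable_funM => //; case: (L2_subcst (u x)).
  - move=> z Dz; rewrite normrM mulrC ler_wpM2r// ger0_norm ?wA//.
    exact: weight_ge0.
  - move=> z Dz h; rewrite weight_eq0 ?mulr0//; lra.
have -> : average r u x - average r u y =
    \int[mu]_(z in D) ((u z - u x) * (weight r x z - weight r y z)).
  apply: etrans (subr_trans2 (average_subcst (u x) Dx rr) (average_subcst (u x) Dy rr)) _.
  rewrite -RintegralB//; [|exact: iuweight..].
  by apply: eq_Rintegral => z _; rewrite mulrBr.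
have -> : A ^+ 2 * C * 2 ^+ m / r ^+ m.+2 * dist x y ^+ 2 =
    (dist x y / r * (A / r ^+ m)) ^+ 2 * (C * (2 * r) ^+ m).
  rewrite [(2 * r) ^+ m]exprMn 2!(exprS r); field.
  by rewrite expf_neq0 ?gt_eqF.
apply: sqr_integral_local => //; first by rewrite mulr_ge0// divr_ge0// ltW.
- exact: L2_subcst.
- apply: measurable_funM; first by case: (L2_subcst (u x)).
  by apply: measurable_funB.
- by move=> z Dz; rewrite normrM mulrC ler_wpM2r// wL.
- move=> z Dz h; have := dist_tri x y z => h2.
  by rewrite !weight_eq0 ?subrr ?mulr0//; lra.
Qed.

(** The constant blows up as r tends to 0. This is harmless: r is fixed once and for all before the
    Lipschitz function is used. *)
Lemma average_lipschitz r : 0 < r <= r0 -> exists2 L : R, 0 <= L &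
  forall x y, D x -> D y -> `|average r u x - average r u y| <= L * dist x y.
Proof.
move=> rr; have [A A0 /(_ r rr)[_ wL]] := weight_bounds mD Doo mdist dist_ge0
  dist_sym dist_tri C0 c0 ball_le ball_ge.
case/andP: (rr) => r_0 _.
have iu := integrable_abse (L2_integrable mD Doo u2).
exists (A / r ^+ m.+1 * \int[mu]_(z in D) `|u z|).
  rewrite mulr_ge0 ?Rintegral_ge0// divr_ge0 ?exprn_ge0 ?(ltW r_0)//.
  exact: ltW.
move=> x y Dx Dy.
have i0 w := iuweight 0 w rr.
have -> : average r u x - average r u y =
    \int[mu]_(z in D) ((u z - 0) * weight r x z - (u z - 0) * weight r y z).
  apply: etrans (subr_trans2 (average_subcst 0 Dx rr) (average_subcst 0 Dy rr)) _.
  by rewrite -RintegralB//; exact: i0.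
have id : mu.-integrable D
    (fun z => ((u z - 0) * weight r x z - (u z - 0) * weight r y z)%:E).
  exact: (integrableB mD (i0 _ Dx) (i0 _ Dy)).
apply: le_trans (le_normr_Rintegral mD id) _.
have -> : A / r ^+ m.+1 * \int[mu]_(z in D) `|u z| * dist x y =
    dist x y / r * (A / r ^+ m) * \int[mu]_(z in D) `|u z|.
  by rewrite exprS; field; rewrite expf_neq0 gt_eqF.
rewrite -RintegralZl//; apply: le_Rintegral => //.
- exact: (integrable_abse id).
- by under [X in integrable _ _ X]eq_fun do rewrite EFinM; exact: integrableZl.
- by move=> z Dz; rewrite !subr0 -mulrBr normrM mulrC ler_wpM2r// wL.
Qed.

End average_bounds.

(** Young's inequality applied to a - b = (a' - b') + (e1 - e2), followed by (e1 - e2)^2 <= 2 e1^2 +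
    2 e2^2. In both cases the defect is an explicit square. *)
Lemma sqr_diff_le {R : realType} (theta a b a' b' : R) : 0 < theta ->
  (a - b) ^+ 2 <= (1 + theta) * (a' - b') ^+ 2 +
    2 * (1 + theta^-1) * (a - a') ^+ 2 + 2 * (1 + theta^-1) * (b - b') ^+ 2.
Proof.
move=> th0.
set e1 := a - a'; set e2 := b - b'; set f := a' - b'.
have -> : a - b = f + (e1 - e2) by rewrite /f /e1 /e2; ring.
have h1 : (f + (e1 - e2)) ^+ 2 <= (1 + theta) * f ^+ 2 + (1 + theta^-1) * (e1 - e2) ^+ 2.
  rewrite -subr_ge0.
  rewrite (_ : _ - _ = (theta * f - (e1 - e2)) ^+ 2 / theta); last first.
    by field; rewrite gt_eqF.
  by rewrite divr_ge0 ?sqr_ge0// ltW.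
apply: le_trans h1 _; rewrite -[leRHS]addrA lerD2l -subr_ge0.
rewrite (_ : _ - _ = (1 + theta^-1) * (e1 + e2) ^+ 2); last by ring.
by rewrite mulr_ge0 ?sqr_ge0// addr_ge0// invr_ge0 ltW.
Qed.

(** * Energy of the averages *)

Section average_energy.
Context {R : realType} {d} {T : measurableType d}.
Variables (mu : {sigma_finite_measure set T -> \bar R}) (dist : T -> T -> R).
Variables (D : set T) (m : nat) (C c r0 : R).
Implicit Types (r rho : R) (x y z : T).
Hypothesis mD : measurable D.
Hypothesis Doo : (mu D < +oo)%E.
Hypothesis mdist : measurable_fun setT (fun z : T * T => dist z.1 z.2).
Hypothesis dist_ge0 : forall x y, 0 <= dist x y.
Hypothesis dist_sym : forall x y, dist x y = dist y x.
Hypothesis dist_tri : forall x y z, dist x z <= dist x y + dist y z.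
Hypotheses (C0 : 0 < C) (c0 : 0 < c).
Hypothesis ball_le : forall (x : T) (rho : R), D x -> 0 < rho ->
  (mu (D `&` [set y | (dist x y < rho)%R]) <= (C * rho ^+ m)%:E)%E.
Hypothesis ball_ge : forall (x : T) (rho : R), D x -> 0 < rho <= r0 ->
  ((c * rho ^+ m)%:E <= mu (D `&` [set y | (dist x y < rho)%R]))%E.
Hypothesis dist_eq0 : forall x y, dist x y = 0 -> x = y.
Variable u : T -> R.
Hypotheses (mu_ : measurable_fun setT u) (u2 : L2 mu D u).
Variable p : R.
Hypothesis mp : m%:R < p < m%:R + 2.

Local Notation average := (average mu dist D).
Local Notation oscillation := (oscillation mu dist D u).

Definition near_energy rho : \bar R := (\int[mu]_(x in D) \int[mu]_(y in D)
  ((dist x y < rho)%R%:R * ((u x - u y) ^+ 2 / dist x y `^ p))%:E)%E.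

Let p0 : 0 < p.
Proof. by case/andP: mp => h _; exact: le_lt_trans h. Qed.

Let mdistP : measurable_fun setT (fun z : T * T => (dist z.1 z.2 `^ p)^-1).
Proof.
apply: measurable_funV_ge0 => [w _|]; first exact: powR_ge0.
exact: (measurableT_comp (measurable_powR p) mdist).
Qed.

Let mlt rho : measurable_fun setT (fun w : T * T => (dist w.1 w.2 < rho)%R%:R : R).
Proof. by apply: measurable_natr_bool; apply: measurable_fun_ltr. Qed.

Let mge rho : measurable_fun setT (fun w : T * T => (rho <= dist w.1 w.2)%R%:R : R).
Proof. by apply: measurable_natr_bool; apply: measurable_fun_ler. Qed.

Let mfst (f : T -> R) : measurable_fun setT f ->
  measurable_fun setT (fun w : T * T => f w.1).
Proof. by move=> mf; exact: measurableT_comp. Qed.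

Let msnd (f : T -> R) : measurable_fun setT f ->
  measurable_fun setT (fun w : T * T => f w.2).
Proof. by move=> mf; exact: measurableT_comp. Qed.

Let mpair (f : T * T -> R) x : measurable_fun setT f ->
  measurable_fun setT (fun y => f (x, y)).
Proof.
move=> mf; apply: (measurableT_comp mf (g := fun y => (x, y))).
exact: measurable_fun_pair.
Qed.

Let mDD : measurable (D `*` D). Proof. exact: measurableX. Qed.

Let mgag (v : T -> R) : measurable_fun setT v ->
  measurable_fun setT (fun w : T * T => (v w.1 - v w.2) ^+ 2 / dist w.1 w.2 `^ p).
Proof.
move=> mv; apply: measurable_funM => //; apply: measurable_funX.
by apply: measurable_funB; [exact: mfst|exact: msnd].
Qed.

Let mavg r : measurable_fun setT (average r u).
Proof. exact: measurable_average. Qed.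

Let mosc rho : measurable_fun D (oscillation rho).
Proof.
apply: (@measurable_tonelli_in _ _ _ _ _ mu D D mD mD
  (fun w => ((dist w.1 w.2 < rho)%R%:R * (u w.2 - u w.1) ^+ 2)%:E)) => //=.
- apply/measurable_EFinP; apply: measurable_funTS; apply: measurable_funM => //.
  by apply: measurable_funX; apply: measurable_funB; [exact: msnd|exact: mfst].
- by move=> w _; rewrite lee_fin mulr_ge0// sqr_ge0.
Qed.

Let osc_ge0 rho x : (0 <= oscillation rho x)%E.
Proof. by apply: integral_ge0 => z _; rewrite lee_fin mulr_ge0// sqr_ge0. Qed.

Let near_ge0 rho : (0 <= near_energy rho)%E.
Proof.
apply: integral_ge0 => x _; apply: integral_ge0 => y _.
by rewrite lee_fin mulr_ge0// divr_ge0 ?sqr_ge0 ?powR_ge0.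
Qed.

(** On pairs at distance less than rho, the factor rho^p / dist^p is at least 1. *)
Lemma integral_oscillation_le rho : 0 < rho ->
  (\int[mu]_(x in D) oscillation rho x <= (rho `^ p)%:E * near_energy rho)%E.
Proof.
move=> rho0.
pose n (w : T * T) : R :=
  (dist w.1 w.2 < rho)%R%:R * ((u w.1 - u w.2) ^+ 2 / dist w.1 w.2 `^ p).
have mn : measurable_fun setT n.
  by apply: measurable_funM => //; exact: mgag.
have n0 w : 0 <= n w.
  by rewrite mulr_ge0// divr_ge0 ?sqr_ge0 ?powR_ge0.
rewrite /near_energy -ge0_integralZl_EFin ?powR_ge0//; last 2 first.
- by move=> x _; apply: integral_ge0 => y _; rewrite lee_fin (n0 (x, y)).
- apply: (@measurable_tonelli_in _ _ _ _ _ mu D D mD mD (EFin \o n)).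
    by apply/measurable_EFinP; exact: measurable_funTS mn.
  by move=> w _; rewrite lee_fin n0.
apply: ge0_le_integral_nomeas => x Dx; first exact: osc_ge0.
rewrite -ge0_integralZl_EFin ?powR_ge0//; last 2 first.
- by move=> y _; rewrite lee_fin (n0 (x, y)).
- by apply/measurable_EFinP; apply: measurable_funTS; exact: (mpair x mn).
apply: ge0_le_integral_nomeas => y Dy; first by rewrite lee_fin mulr_ge0// sqr_ge0.
rewrite -EFinM lee_fin; have [h|h] := ltP (dist x y) rho; last by rewrite !mul0r mulr0.
rewrite !mul1r -sqrrN opprB.
(* At distance 0 the kernel is the inverse of 0, that is 0, and cannot bound anything; but then the
   two points coincide and the left-hand side is 0 too. *)
have := dist_ge0 x y; rewrite le_eqVlt => /predU1P[/esym/dist_eq0 ->|xy].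
  by rewrite subrr expr0n/= mul0r mulr0.
rewrite mulrCA ler_peMr ?sqr_ge0// ler_pdivlMr ?powR_gt0// mul1r.
by rewrite ge0_ler_powR ?nnegrE// ltW.
Qed.

Let mule_shuffle (a b e : R) (o : \bar R) :
  ((a * b)%:E * o * e%:E = a%:E * o * (b * e)%:E)%E.
Proof. by rewrite !EFinM !muleA; congr (_ * _)%E; rewrite muleAC. Qed.

(** The Lipschitz bound leaves dist^2 / dist^p to integrate in y. The powers of r then cancel: r^-(m
    + 2) from the bound, r^(m + 2 - p) from [radial_near], r^p from [integral_oscillation_le]. *)
Let near_part (v : T -> R) r K K4 : 0 < r -> 0 <= K -> 0 <= K4 ->
  (forall x y, D x -> D y -> dist x y < r -> (((v x - v y) ^+ 2)%:E <=
     (K / r ^+ m.+2 * dist x y ^+ 2)%:E * oscillation (2 * r) x)%E) ->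
  (forall x, D x -> (\int[mu]_(y in D)
     ((dist x y < r)%R%:R * (dist x y ^+ 2 / dist x y `^ p))%:E
     <= (K4 * r `^ (m%:R + 2 - p))%:E)%E) ->
  (\int[mu]_(x in D) \int[mu]_(y in D)
     ((dist x y < r)%R%:R * ((v x - v y) ^+ 2 / dist x y `^ p))%:E <=
   (K * K4 * 2 `^ p)%:E * near_energy (2 * r))%E.
Proof.
move=> r_0 K0 K40 vK rad.
have r20 : 0 < 2 * r by rewrite mulr_gt0.
pose k := K / r ^+ m.+2.
have k0 : 0 <= k by rewrite divr_ge0 ?exprn_ge0// ltW.
pose q (w : T * T) : R := (dist w.1 w.2 < r)%R%:R * (dist w.1 w.2 ^+ 2 / dist w.1 w.2 `^ p).
have q0 w : 0 <= q w by rewrite mulr_ge0// divr_ge0 ?powR_ge0 ?exprn_ge0.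
have mq : measurable_fun setT q.
  apply: measurable_funM => //; apply: measurable_funM => //.
  exact: measurable_funX.
have kr0 : 0 <= k * (K4 * r `^ (m%:R + 2 - p)).
  by apply: mulr_ge0 => //; apply: mulr_ge0 => //; exact: powR_ge0.
apply: (@le_trans _ _ (\int[mu]_(x in D)
    ((k * (K4 * r `^ (m%:R + 2 - p)))%:E * oscillation (2 * r) x))%E).
  apply: ge0_le_integral_nomeas => x Dx.
    by apply: integral_ge0 => y _; rewrite lee_fin mulr_ge0// divr_ge0 ?sqr_ge0 ?powR_ge0.
  apply: (@le_trans _ _ (\int[mu]_(y in D) ((k%:E * oscillation (2 * r) x) * (q (x, y))%:E))%E).
    apply: ge0_le_integral_nomeas => y Dy.
      by rewrite lee_fin mulr_ge0// divr_ge0 ?sqr_ge0 ?powR_ge0.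
    rewrite /q/=; have [h|_] := ltP (dist x y) r; last by rewrite !mul0r mule0.
    rewrite !mul1r.
    apply: (@le_trans _ _ ((((v x - v y) ^+ 2)%:E * ((dist x y `^ p)^-1)%:E)%E)).
      by rewrite -EFinM.
    apply: (@le_trans _ _ ((k * dist x y ^+ 2)%:E * oscillation (2 * r) x *
        ((dist x y `^ p)^-1)%:E)%E).
      by rewrite lee_wpmul2r ?lee_fin ?invr_ge0 ?powR_ge0// vK.
    by rewrite mule_shuffle.
  rewrite ge0_integralZl//; last 3 first.
  - by apply/measurable_EFinP; apply: measurable_funTS; exact: (mpair x mq).
  - by move=> y _; rewrite lee_fin.
  - by rewrite mule_ge0.
  rewrite (EFinM k) [leRHS]muleAC lee_wpmul2l ?rad//.
  by rewrite mule_ge0.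
rewrite ge0_integralZl//.
apply: (@le_trans _ _ ((k * (K4 * r `^ (m%:R + 2 - p)))%:E *
    (((2 * r) `^ p)%:E * near_energy (2 * r)))%E).
  by rewrite lee_wpmul2l// integral_oscillation_le.
rewrite muleA -EFinM le_eqVlt; apply/orP; left; apply/eqP; congr (_%:E * _)%E.
rewrite powRB; last by rewrite (gt_eqF r_0) implybT.
rewrite -natrD powR_mulrn ?(ltW r_0)// addn2 powRM ?(ltW r_0)// /k; field.
by rewrite !gt_eqF ?powR_gt0 ?exprn_gt0.
Qed.

(** B stands for a multiple of the squared error of the average, which depends on one point only, so
    the kernel is integrated alone in y. Again the powers of r cancel: r^-m, r^(m - p) and r^p. *)
Let far_part (B : T -> R) r K K6 : 0 < r -> 0 <= K -> 0 <= K6 ->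
  measurable_fun setT B -> (forall x, 0 <= B x) ->
  (forall x, D x -> (B x)%:E <= (K / r ^+ m)%:E * oscillation (2 * r) x)%E ->
  (forall x, D x -> (\int[mu]_(y in D) ((r <= dist x y)%R%:R / dist x y `^ p)%:E
     <= (K6 * r `^ (m%:R - p))%:E)%E) ->
  (\int[mu]_(x in D) \int[mu]_(y in D)
     (B x * ((r <= dist x y)%R%:R / dist x y `^ p))%:E <=
   (K * K6 * 2 `^ p)%:E * near_energy (2 * r))%E.
Proof.
move=> r_0 K0 K60 mB B0 BK rad.
have r20 : 0 < 2 * r by rewrite mulr_gt0.
pose q (w : T * T) : R := (r <= dist w.1 w.2)%R%:R / dist w.1 w.2 `^ p.
have q0 w : 0 <= q w by rewrite mulr_ge0// invr_ge0 powR_ge0.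
have mq : measurable_fun setT q by exact: measurable_funM.
have kr0 : 0 <= K6 * r `^ (m%:R - p) by apply: mulr_ge0 => //; exact: powR_ge0.
have k0 : 0 <= K / r ^+ m by rewrite divr_ge0 ?exprn_ge0// ltW.
apply: (@le_trans _ _ (\int[mu]_(x in D)
    ((K6 * r `^ (m%:R - p) * (K / r ^+ m))%:E * oscillation (2 * r) x))%E).
  apply: ge0_le_integral_nomeas => x Dx.
    by apply: integral_ge0 => y _; rewrite lee_fin mulr_ge0//; exact: (q0 (x, y)).
  apply: (@le_trans _ _ (\int[mu]_(y in D) ((B x)%:E * (q (x, y))%:E))%E).
    apply: ge0_le_integral_nomeas => y Dy; last by rewrite -EFinM.
    by rewrite lee_fin mulr_ge0//; exact: (q0 (x, y)).
  rewrite ge0_integralZl_EFin//; last 2 first.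
  - by move=> y _; rewrite lee_fin.
  - by apply/measurable_EFinP; apply: measurable_funTS; exact: (mpair x mq).
  rewrite (EFinM (K6 * _)) -muleA muleC; apply: lee_pmul => //.
  - by apply: integral_ge0 => y _; rewrite lee_fin.
  - by rewrite lee_fin.
  - exact: rad.
  - exact: BK.
rewrite ge0_integralZl//; last by rewrite lee_fin mulr_ge0.
apply: (@le_trans _ _ ((K6 * r `^ (m%:R - p) * (K / r ^+ m))%:E *
    (((2 * r) `^ p)%:E * near_energy (2 * r)))%E).
  by rewrite lee_wpmul2l ?integral_oscillation_le// lee_fin mulr_ge0.
rewrite muleA -EFinM le_eqVlt; apply/orP; left; apply/eqP; congr (_%:E * _)%E.
rewrite powRB; last by rewrite (gt_eqF r_0) implybT.
rewrite powR_mulrn ?(ltW r_0)// powRM ?(ltW r_0)//; field.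
by rewrite !gt_eqF ?powR_gt0 ?exprn_gt0.
Qed.

(* The pairs at distance at least r are handled by
   (a + b)^2 <= (1 + theta) a^2 + (1 + 1/theta) b^2, where b comes from
   average - u; the closer pairs by the Lipschitz bound on the average. *)
Lemma average_energy : exists2 K : R, 0 <= K & forall r, 0 < r <= r0 ->
  (\int[mu]_(x in D) ((average r u x - u x) ^+ 2)%:E <=
     (K * r `^ (p - m%:R))%:E * near_energy (2 * r))%E /\
  (forall theta : R, 0 < theta ->
    (gagliardo mu dist p D (average r u) <=
     (1 + theta)%:E * gagliardo mu dist p D u +
     (K * (1 + theta^-1))%:E * near_energy (2 * r))%E).
Proof.
have [K K0 HK] := average_bounds mD Doo mdist dist_ge0
  dist_sym dist_tri C0 c0 ball_le ball_ge u2.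
have [mp1 mp2] := andP mp.
have [|K4 K40 HK4] := radial_near mD (measurable_dist1 mdist) dist_ge0 (ltW C0) ball_le (p := p).
  by rewrite (ltW p0).
have [K6 K60 HK6] := radial_far mD (measurable_dist1 mdist) (ltW C0) ball_le mp1.
have K2p : 0 <= K * 2 `^ p by rewrite mulr_ge0 ?powR_ge0 ?(ltW K0).
(* The 1 serves the L2 error, K4 the near pairs, and 4 K6 the errors at the two points of a far
   pair, each with the factor 2 of [sqr_diff_le]. *)
exists (K * 2 `^ p * (1 + K4 + 4 * K6)).
  by rewrite mulr_ge0// !addr_ge0// mulr_ge0.
move=> r rr; have [HKx HKxy] := HK r rr.
case/andP: (rr) => r_0 _; have r20 : 0 < 2 * r by rewrite mulr_gt0.
have mdiff : measurable_fun setT (fun x => (average r u x - u x) ^+ 2).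
  by apply: measurable_funX; apply: measurable_funB.
split.
  apply: (@le_trans _ _ (\int[mu]_(x in D) ((K / r ^+ m)%:E * oscillation (2 * r) x))%E).
    apply: ge0_le_integral_nomeas => x Dx; first by rewrite lee_fin sqr_ge0.
    exact: HKx.
  have k0 : 0 <= K / r ^+ m by rewrite divr_ge0 ?exprn_ge0 ?(ltW r_0) ?(ltW K0).
  rewrite ge0_integralZl//.
  apply: (@le_trans _ _ ((K / r ^+ m)%:E *
      (((2 * r) `^ p)%:E * near_energy (2 * r)))%E).
    by rewrite lee_wpmul2l ?integral_oscillation_le.
  rewrite muleA -EFinM lee_wpmul2r// lee_fin.
  have -> : K / r ^+ m * (2 * r) `^ p = K * 2 `^ p * r `^ (p - m%:R).
    rewrite powRB; last by rewrite (gt_eqF r_0) implybT.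
    rewrite powR_mulrn ?(ltW r_0)// powRM ?(ltW r_0)//; field.
    by rewrite !gt_eqF ?powR_gt0 ?exprn_gt0.
  rewrite ler_wpM2r ?powR_ge0// ler_peMr//.
  by rewrite -addrA lerDl addr_ge0// mulr_ge0.
move=> theta theta0.
pose kap := 1 + theta^-1.
have kap1 : 1 <= kap by rewrite lerDl invr_ge0 ltW.
have kap0 : 0 <= kap by exact: le_trans kap1.
pose B x := 2 * kap * (average r u x - u x) ^+ 2.
have B0 x : 0 <= B x by rewrite mulr_ge0 ?sqr_ge0 ?mulr_ge0.
have mB : measurable_fun setT B by exact: measurable_funM.
pose F1 (w : T * T) : R := (1 + theta) * ((u w.1 - u w.2) ^+ 2 / dist w.1 w.2 `^ p).
pose F2 (w : T * T) : R := (dist w.1 w.2 < r)%R%:R *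
  ((average r u w.1 - average r u w.2) ^+ 2 / dist w.1 w.2 `^ p).
pose ph (w : T * T) : R := (r <= dist w.1 w.2)%R%:R / dist w.1 w.2 `^ p.
pose F3 (w : T * T) : R := B w.1 * ph w.
pose F4 (w : T * T) : R := B w.2 * ph w.
have ph0 w : 0 <= ph w by rewrite divr_ge0 ?powR_ge0.
have th0 : 0 <= 1 + theta by rewrite addr_ge0// ltW.
have g0 (v : T -> R) w : 0 <= (v w.1 - v w.2) ^+ 2 / dist w.1 w.2 `^ p.
  by rewrite divr_ge0 ?powR_ge0 ?sqr_ge0.
have F10 w : 0 <= F1 w by rewrite mulr_ge0// g0.
have F20 w : 0 <= F2 w by rewrite mulr_ge0// g0.
have F30 w : 0 <= F3 w by rewrite mulr_ge0.
have F40 w : 0 <= F4 w by rewrite mulr_ge0.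
have mph : measurable_fun setT ph by exact: measurable_funM.
have mF1 : measurable_fun (D `*` D) (EFin \o F1).
  apply/measurable_EFinP; apply: measurable_funTS; apply: measurable_funM => //.
  exact: mgag.
have mF2 : measurable_fun (D `*` D) (EFin \o F2).
  apply/measurable_EFinP; apply: measurable_funTS; apply: measurable_funM => //.
  exact: mgag.
have mF3 : measurable_fun (D `*` D) (EFin \o F3).
  apply/measurable_EFinP; apply: measurable_funTS; apply: measurable_funM => //.
  exact: mfst.
have mF4 : measurable_fun (D `*` D) (EFin \o F4).
  apply/measurable_EFinP; apply: measurable_funTS; apply: measurable_funM => //.
  exact: msnd.
have pointwise w : (average r u w.1 - average r u w.2) ^+ 2 / dist w.1 w.2 `^ p <=
    F1 w + F2 w + F3 w + F4 w.
  rewrite /F1 /F2 /F3 /F4 /ph; case: w => x y /=.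
  have [h|h] := ltP (dist x y) r.
    by rewrite mul1r mul0r !mulr0 !addr0 lerDr mulr_ge0// (g0 u (x, y)).
  rewrite mul0r addr0 mul1r mulrA -!mulrDl ler_wpM2r ?invr_ge0 ?powR_ge0//.
  exact: sqr_diff_le.
rewrite /gagliardo (@tonelli_in _ _ _ _ _ mu mu D D mD mD (fun w =>
  ((average r u w.1 - average r u w.2) ^+ 2 / dist w.1 w.2 `^ p)%:E)); last 2 first.
- by apply/measurable_EFinP; apply: measurable_funTS; exact: mgag.
- by move=> w _; rewrite lee_fin g0.
apply: (@le_trans _ _ (\int[mu \x mu]_(w in D `*` D)
   ((F1 w)%:E + (F2 w)%:E + (F3 w)%:E + (F4 w)%:E))%E).
  apply: ge0_le_integral_nomeas => w _; first by rewrite lee_fin g0.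
  by rewrite -!EFinD lee_fin.
rewrite ge0_integralD//; last 3 first.
- by move=> w _; rewrite -!EFinD lee_fin !addr_ge0.
- by apply: emeasurable_funD => //; exact: emeasurable_funD.
- by move=> w _; rewrite lee_fin.
rewrite ge0_integralD//; last 3 first.
- by move=> w _; rewrite -!EFinD lee_fin !addr_ge0.
- exact: emeasurable_funD.
- by move=> w _; rewrite lee_fin.
rewrite ge0_integralD//; last 2 first.
- by move=> w _; rewrite lee_fin.
- by move=> w _; rewrite lee_fin.
have I1 : (\int[mu \x mu]_(w in D `*` D) (F1 w)%:E <= (1 + theta)%:E *
    \int[mu]_(x in D) \int[mu]_(y in D) ((u x - u y) ^+ 2 / dist x y `^ p)%:E)%E.
  rewrite (@tonelli_in _ _ _ _ _ mu mu D D mD mD (fun w =>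
    ((u w.1 - u w.2) ^+ 2 / dist w.1 w.2 `^ p)%:E)); last 2 first.
  - by apply/measurable_EFinP; apply: measurable_funTS; exact: mgag.
  - by move=> w _; rewrite lee_fin g0.
  rewrite -ge0_integralZl_EFin//.
  - by move=> w _; rewrite lee_fin g0.
  - by apply/measurable_EFinP; apply: measurable_funTS; exact: mgag.
have I2 : (\int[mu \x mu]_(w in D `*` D) (F2 w)%:E <=
    (K * K4 * 2 `^ p)%:E * near_energy (2 * r))%E.
  rewrite -(@tonelli_in _ _ _ _ _ mu mu D D mD mD (EFin \o F2))//; last first.
    by move=> w _; rewrite lee_fin.
  by apply: near_part => //; [exact: ltW|move=> x Dx; exact: HK4].
have far := @far_part B r (2 * kap * K) K6 r_0.
have I3' : (\int[mu]_(x in D) \int[mu]_(y in D) (F3 (x, y))%:E <=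
    (2 * kap * K * K6 * 2 `^ p)%:E * near_energy (2 * r))%E.
  apply: far => //; [by rewrite !mulr_ge0// ltW| |by move=> x Dx; exact: HK6].
  move=> x Dx; rewrite /B -[X in (X%:E * _)%E]mulrA (EFinM _ (_ ^+ 2)).
  by rewrite (EFinM (2 * kap)) -muleA lee_wpmul2l ?HKx// lee_fin mulr_ge0.
have I3 : (\int[mu \x mu]_(w in D `*` D) (F3 w)%:E <=
    (2 * kap * K * K6 * 2 `^ p)%:E * near_energy (2 * r))%E.
  rewrite -(@tonelli_in _ _ _ _ _ mu mu D D mD mD (EFin \o F3))//.
  by move=> w _; rewrite lee_fin.
(* F4 carries the error at the second point; integrating first in the other variable and using the
   symmetry of the distance reduces it to F3. *)
have I4 : (\int[mu \x mu]_(w in D `*` D) (F4 w)%:E <=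
    (2 * kap * K * K6 * 2 `^ p)%:E * near_energy (2 * r))%E.
  rewrite -(@tonelli_in_sym _ _ _ _ _ mu mu D D mD mD (EFin \o F4)); last 2 first.
  - exact: mF4.
  - by move=> w _; rewrite lee_fin.
  apply: le_trans I3'.
  apply: ge0_le_integral_nomeas => x _.
    by apply: integral_ge0 => y _; rewrite lee_fin.
  apply: ge0_le_integral_nomeas => y _; first by rewrite lee_fin.
  by rewrite /F3 /F4 /ph/= dist_sym.
apply: le_trans (leeD (leeD (leeD I1 I2) I3) I4) _.
have c1 : 0 <= K * K4 * 2 `^ p by rewrite mulr_ge0 ?powR_ge0// mulr_ge0// ltW.
have c2 : 0 <= 2 * kap * K * K6 * 2 `^ p.
  by rewrite mulr_ge0 ?powR_ge0// mulr_ge0// mulr_ge0 ?mulr_ge0// ltW.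
move: (near_energy (2 * r)) (near_ge0 (2 * r)) => n n0.
set G := ((1 + theta)%:E * _)%E; clearbody G.
rewrite -2!addeA leeD2l// -!ge0_muleDl ?lee_fin ?addr_ge0// lee_wpmul2r//.
rewrite lee_fin -/kap.
rewrite -subr_ge0 (_ : _ - _ = K * 2 `^ p * (kap + K4 * (kap - 1))); last by ring.
by rewrite mulr_ge0// addr_ge0// mulr_ge0// subr_ge0.
Qed.

End average_energy.

(** * Dependence of the energy of Lipschitz functions on the exponent *)

Section power_bounds.
Context {R : realType}.
Implicit Types t p q M e : R.

(** For t between 1/M and M, t^(q - p) is at most M^|p - q| whatever the sign of q - p, and this
    factor is close to 1 when p is close to q. *)
Lemma invr_powR_le t p q M : 0 < t -> t <= M -> t^-1 <= M ->
  (t `^ p)^-1 <= M `^ `|p - q| / t `^ q.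
Proof.
move=> t0 tM tVM.
have M0 : 0 <= M by rewrite (le_trans _ tM)// ltW.
rewrite ler_pdivlMr ?powR_gt0// mulrC -powRB; last by rewrite (gt_eqF t0) implybT.
have [qp|pq] := leP q p.
  rewrite ger0_norm ?subr_ge0//.
  have -> : t `^ (q - p) = t^-1 `^ (p - q).
    by rewrite -(powR_inv1 (ltW t0)) -powRrM mulN1r opprB.
  by rewrite ge0_ler_powR ?nnegrE ?subr_ge0 ?invr_ge0 ?(ltW t0).
rewrite ltr0_norm ?subr_lt0// opprB.
by rewrite ge0_ler_powR ?nnegrE ?subr_ge0 ?(ltW pq) ?(ltW t0).
Qed.

Lemma powR_le_near0 M e : 1 <= M -> 0 < e -> exists2 delta : R, 0 < delta &
  forall t, t <= delta -> M `^ t <= 1 + e.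
Proof.
move=> M1 e0; have M0 : 0 < M by exact: lt_le_trans M1.
have lnM : 0 <= ln M by exact: ln_ge0.
have l0 : 0 < ln (1 + e) by rewrite ln_gt0// ltrDl.
have lM1 : 0 < ln M + 1 by rewrite ltr_wpDl.
(* The 1 in the denominator covers M = 1, where [ln M] is 0. *)
exists (ln (1 + e) / (ln M + 1)); first by rewrite divr_gt0.
move=> t td; rewrite /powR gt_eqF//.
rewrite -[leRHS](@lnK _ (1 + e)) ?posrE ?addr_gt0// ler_expR.
apply: (@le_trans _ _ (ln (1 + e) / (ln M + 1) * ln M)); first by rewrite ler_wpM2r.
rewrite mulrAC -mulrA ler_piMr ?(ltW l0)// ler_pdivrMr// mul1r.
by rewrite lerDl.
Qed.

Lemma exists_powR_le (A : R) e p : 0 <= A -> 0 < e -> 0 < p ->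
  exists2 delta : R, 0 < delta & A * delta `^ p <= e.
Proof.
move=> A0 e0 p0; have A1 : 0 < A + 1 by rewrite ltr_wpDl.
exists ((e / (A + 1)) `^ p^-1); first by rewrite powR_gt0// divr_gt0.
rewrite -powRrM mulVf ?gt_eqF// powRr1 ?divr_ge0 ?(ltW e0) ?(ltW A1)//.
by rewrite mulrA ler_pdivrMr// mulrC ler_pM2l// lerDl.
Qed.

End power_bounds.

Section lipschitz_energy.
Context {R : realType} {d} {T : measurableType d}.
Variables (mu : {sigma_finite_measure set T -> \bar R}) (dist : T -> T -> R).
Variables (D : set T) (m : nat) (C diam : R).
Implicit Types (p L : R) (x y : T) (g : T -> R).
Hypothesis mD : measurable D.
Hypothesis Doo : (mu D < +oo)%E.
Hypothesis mdist : forall x, measurable_fun setT (dist x).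
Hypothesis dist_ge0 : forall x y, 0 <= dist x y.
Hypothesis C0 : 0 <= C.
Hypothesis ball_le : forall (x : T) (rho : R), D x -> 0 < rho ->
  (mu (D `&` [set y | (dist x y < rho)%R]) <= (C * rho ^+ m)%:E)%E.
Hypothesis dist_diam : forall x y, D x -> D y -> dist x y < diam.

(** The Lipschitz bound reduces the integrand to L^2 dist^2 / dist^p, whose integral in y is
    controlled uniformly in x by [radial_near]. The constant depends on g only through L. *)
Lemma gagliardo_lipschitz_near p L : 0 <= p < m%:R + 2 -> 0 <= L ->
  exists2 K : R, 0 <= K & forall g rho,
  0 < rho -> (forall x y, D x -> D y -> `|g x - g y| <= L * dist x y) ->
  (\int[mu]_(x in D) \int[mu]_(y in D)
    ((dist x y < rho)%R%:R * ((g x - g y) ^+ 2 / dist x y `^ p))%:E <=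
  (K * rho `^ (m%:R + 2 - p))%:E)%E.
Proof.
move=> pm L0.
have [K K0 HK] := radial_near mD mdist dist_ge0 C0 ball_le pm.
exists (L ^+ 2 * K * fine (mu D)).
  by rewrite mulr_ge0 ?fine_ge0// mulr_ge0// sqr_ge0.
move=> g rho rho0 gL.
have mq x : measurable_fun D (fun y =>
    ((dist x y < rho)%R%:R * (dist x y ^+ 2 / dist x y `^ p))%:E).
  apply/measurable_EFinP; apply: measurable_funTS.
  have mlt : measurable_fun setT (fun y => (dist x y < rho)%R%:R : R).
    rewrite (_ : (fun y => _) = \1_[set y | dist x y < rho]); last first.
      apply/funext => y; rewrite indicE; have [h|h] := ltP (dist x y) rho.
        by rewrite mem_set.
      by rewrite memNset//=; apply/negP; rewrite -leNgt.
    by apply: measurable_indic; exact: measurable_distball.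
  apply: measurable_funM => //; apply: measurable_funM; first exact: measurable_funX.
  apply: measurable_funV_ge0 => [w _|]; first exact: powR_ge0.
  exact: (measurableT_comp (measurable_powR p) (mdist x)).
apply: (@le_trans _ _ (\int[mu]_(x in D) (L ^+ 2 * (K * rho `^ (m%:R + 2 - p)))%:E)%E).
  apply: ge0_le_integral_nomeas => x Dx.
    apply: integral_ge0 => y _; rewrite lee_fin mulr_ge0// divr_ge0 ?sqr_ge0//.
    exact: powR_ge0.
  apply: (@le_trans _ _ (\int[mu]_(y in D) ((L ^+ 2)%:E *
      ((dist x y < rho)%R%:R * (dist x y ^+ 2 / dist x y `^ p))%:E))%E).
    apply: ge0_le_integral_nomeas => y Dy; rewrite ?lee_fin.
      by rewrite mulr_ge0// divr_ge0 ?sqr_ge0 ?powR_ge0.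
    rewrite [leRHS]mulrCA ler_wpM2l// [leRHS]mulrA ler_wpM2r ?invr_ge0 ?powR_ge0//.
    rewrite -exprMn -[leLHS]real_normK ?num_real// lerXn2r ?nnegrE ?gL//.
    by rewrite mulr_ge0.
  rewrite ge0_integralZl_EFin ?sqr_ge0//; last first.
    by move=> y _; rewrite lee_fin mulr_ge0// divr_ge0 ?powR_ge0 ?sqr_ge0.
  by rewrite [leRHS]EFinM lee_wpmul2l ?lee_fin ?sqr_ge0// HK.
rewrite integral_cst// -[X in (_ * X <= _)%E]fineK ?ge0_fin_numE// -EFinM lee_fin.
by rewrite le_eqVlt; apply/orP; left; apply/eqP; ring.
Qed.

Lemma gagliardo_lipschitz_lty p L g : 0 <= p < m%:R + 2 -> 0 <= L ->
  (forall x y, D x -> D y -> `|g x - g y| <= L * dist x y) ->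
  (gagliardo mu dist p D g < +oo)%E.
Proof.
move=> pm L0 gL.
have [[x0 Dx0]|D0] := pselect (exists x, D x); last first.
  rewrite /gagliardo (_ : D = set0) ?integral_set0// -subset0 => x Dx.
  by apply: D0; exists x.
have diam0 : 0 < diam by exact: le_lt_trans (dist_diam Dx0 Dx0).
have [K K0 /(_ g diam diam0 gL) HK] := gagliardo_lipschitz_near pm L0.
apply: (@le_lt_trans _ _ (K * diam `^ (m%:R + 2 - p))%:E); last exact: ltry.
apply: le_trans HK; apply: ge0_le_integral_nomeas => x Dx.
  by apply: integral_ge0 => y _; rewrite lee_fin divr_ge0 ?powR_ge0 ?sqr_ge0.
apply: ge0_le_integral_nomeas => y Dy.
  by rewrite lee_fin divr_ge0 ?powR_ge0 ?sqr_ge0.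
by rewrite (dist_diam Dx Dy) mul1r.
Qed.

End lipschitz_energy.

Section energy_limits.
Context {R : realType} {d} {T : measurableType d}.
Variables (mu : {sigma_finite_measure set T -> \bar R}) (dist : T -> T -> R).
Variables (D : set T) (m : nat) (C diam : R).
Implicit Types (p L : R) (x y : T) (g : T -> R).
Hypothesis mD : measurable D.
Hypothesis Doo : (mu D < +oo)%E.
Hypothesis mdist : measurable_fun setT (fun z : T * T => dist z.1 z.2).
Hypothesis dist_ge0 : forall x y, 0 <= dist x y.
Hypothesis C0 : 0 <= C.
Hypothesis ball_le : forall (x : T) (rho : R), D x -> 0 < rho ->
  (mu (D `&` [set y | (dist x y < rho)%R]) <= (C * rho ^+ m)%:E)%E.
Hypothesis dist_diam : forall x y, D x -> D y -> dist x y < diam.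

Lemma measurable_gagliardo_integrand p g : measurable_fun setT g ->
  measurable_fun setT (fun w : T * T => (g w.1 - g w.2) ^+ 2 / dist w.1 w.2 `^ p).
Proof.
move=> mg; apply: measurable_funM.
  apply: measurable_funX; apply: measurable_funB.
    exact: (measurableT_comp mg (g := fst)).
  exact: (measurableT_comp mg (g := snd)).
apply: measurable_funV_ge0 => [w _|]; first exact: powR_ge0.
exact: (measurableT_comp (measurable_powR p) mdist).
Qed.

Lemma measurable_close rho :
  measurable_fun setT (fun w : T * T => (dist w.1 w.2 < rho)%R%:R : R).
Proof.
rewrite (_ : (fun w => _) = \1_[set w : T * T | dist w.1 w.2 < rho]); last first.
  apply/funext => w; rewrite indicE; have [h|h] := ltP (dist w.1 w.2) rho.
    by rewrite mem_set.
  by rewrite memNset//=; apply/negP; rewrite -leNgt.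
apply: measurable_indic; rewrite -[X in measurable X]setTI.
have := measurable_fun_ltr mdist (measurable_cst rho).
by move=> /(_ measurableT [set true]); apply.
Qed.

Let integrand_ge0 p g w : 0 <= (g w.1 - g w.2) ^+ 2 / dist w.1 w.2 `^ p.
Proof. by rewrite divr_ge0 ?powR_ge0 ?sqr_ge0. Qed.

Lemma gagliardoE p g : measurable_fun setT g -> gagliardo mu dist p D g =
  (\int[mu \x mu]_(w in D `*` D) ((g w.1 - g w.2) ^+ 2 / dist w.1 w.2 `^ p)%:E)%E.
Proof.
move=> mg; rewrite /gagliardo (@tonelli_in _ _ _ _ _ mu mu D D mD mD (fun w =>
  ((g w.1 - g w.2) ^+ 2 / dist w.1 w.2 `^ p)%:E))//.
  apply/measurable_EFinP; apply: measurable_funTS.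
  exact: measurable_gagliardo_integrand.
by move=> w _; rewrite lee_fin.
Qed.

Lemma near_energyE p g rho : measurable_fun setT g ->
  near_energy mu dist D g p rho = (\int[mu \x mu]_(w in D `*` D)
    ((dist w.1 w.2 < rho)%R%:R * ((g w.1 - g w.2) ^+ 2 / dist w.1 w.2 `^ p))%:E)%E.
Proof.
move=> mg; rewrite /near_energy (@tonelli_in _ _ _ _ _ mu mu D D mD mD (fun w =>
  ((dist w.1 w.2 < rho)%R%:R * ((g w.1 - g w.2) ^+ 2 / dist w.1 w.2 `^ p))%:E))//.
  apply/measurable_EFinP; apply: measurable_funTS.
  apply: measurable_funM; first exact: measurable_close.
  exact: measurable_gagliardo_integrand.
by move=> w _; rewrite lee_fin mulr_ge0.
Qed.

(* The pairs at small distance carry a small energy uniformly for p near p0, and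
   at the other pairs the kernels of exponents p and p0 have ratio close to 1. *)
Lemma gagliardo_exponent p0 L g (eta : R) : 0 < p0 < m%:R + 2 -> 0 <= L ->
  measurable_fun setT g ->
  (forall x y, D x -> D y -> `|g x - g y| <= L * dist x y) -> 0 < eta ->
  exists2 delta : R, 0 < delta & forall p, `|p - p0| < delta ->
    (gagliardo mu dist p D g <= gagliardo mu dist p0 D g + eta%:E)%E.
Proof.
move=> /andP[p00 p0m] L0 mg gL eta0.
have eta20 : 0 < eta / 2 by rewrite divr_gt0.
(* An exponent strictly between p0 and m + 2: it dominates all p near p0 on the near pairs while
   keeping the energy of Lipschitz functions finite. *)
pose pb := (p0 + m%:R + 2) / 2.
have p0pb : p0 < pb by rewrite /pb; lra.
have pbm : pb < m%:R + 2 by rewrite /pb; lra.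
have pb0 : 0 <= pb by rewrite ltW// (lt_trans p00).
have md1 := measurable_dist1 mdist.
have p0m' : 0 <= p0 < m%:R + 2 by rewrite ltW.
have pbm' : 0 <= pb < m%:R + 2 by rewrite pb0.
have E0fin : gagliardo mu dist p0 D g \is a fin_num.
  rewrite ge0_fin_numE; last first.
    apply: integral_ge0 => x _; apply: integral_ge0 => y _.
    by rewrite lee_fin (integrand_ge0 p0 g (x, y)).
  exact: (gagliardo_lipschitz_lty mD Doo md1 dist_ge0 C0 ball_le dist_diam p0m' L0 gL).
have [K K0 HK] := gagliardo_lipschitz_near mD Doo md1 dist_ge0 C0 ball_le pbm' L0.
pose M1 := 1 + `|diam|.
have M11 : 1 <= M1 by rewrite lerDl.
have e0 : 0 < m%:R + 2 - pb by rewrite subr_gt0.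
have [rho rho0 Hrho] := exists_powR_le (mulr_ge0 (powR_ge0 M1 pb) K0) eta20 e0.
(* M bounds both the distance and its inverse on the pairs at distance at least rho, as
   [invr_powR_le] requires. *)
pose M := M1 + rho^-1.
have M1M : M1 <= M by rewrite lerDl invr_ge0 ltW.
have M_1 : 1 <= M by exact: le_trans M1M.
have M0 : 0 <= M by rewrite (le_trans _ M_1).
pose E0 := fine (gagliardo mu dist p0 D g).
have E00 : 0 <= E0.
  apply: fine_ge0; apply: integral_ge0 => x _; apply: integral_ge0 => y _.
  by rewrite lee_fin (integrand_ge0 p0 g (x, y)).
have E01 : 0 < E0 + 1 by rewrite ltr_wpDl.
have [d1 d10 Hd1] := powR_le_near0 M_1 (divr_gt0 eta20 E01).
(* The three terms ensure respectively that M^|p - p0| is close to 1, that p < pb, and that p >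
   0. *)
exists (Num.min d1 (Num.min (pb - p0) p0)).
  by rewrite !lt_min d10 subr_gt0 p0pb p00.
move=> p; rewrite !lt_min => /and3P[pd1 ppb pp0].
have p_gt0 : 0 < p by move: pp0; rewrite ltr_norml; lra.
have p_pb : p < pb by move: ppb; rewrite ltr_norml; lra.
pose F1 (w : T * T) : R := M1 `^ pb *
  ((dist w.1 w.2 < rho)%R%:R * ((g w.1 - g w.2) ^+ 2 / dist w.1 w.2 `^ pb)).
pose F2 (w : T * T) : R := M `^ `|p - p0| * ((g w.1 - g w.2) ^+ 2 / dist w.1 w.2 `^ p0).
have F10 w : 0 <= F1 w by rewrite mulr_ge0 ?powR_ge0// mulr_ge0.
have F20 w : 0 <= F2 w by rewrite mulr_ge0 ?powR_ge0.
have mDD : measurable (D `*` D) by exact: measurableX.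
have mi q := measurable_gagliardo_integrand q mg.
have mn : measurable_fun setT (fun w : T * T => (dist w.1 w.2 < rho)%R%:R *
    ((g w.1 - g w.2) ^+ 2 / dist w.1 w.2 `^ pb)).
  by apply: measurable_funM => //; exact: measurable_close.
have mF1 : measurable_fun (D `*` D) (EFin \o F1).
  by apply/measurable_EFinP; apply: measurable_funTS; exact: measurable_funM.
have mF2 : measurable_fun (D `*` D) (EFin \o F2).
  by apply/measurable_EFinP; apply: measurable_funTS; exact: measurable_funM.
have pointwise w : (D `*` D) w ->
    (g w.1 - g w.2) ^+ 2 / dist w.1 w.2 `^ p <= F1 w + F2 w.
  (* At distance 0 the quotient is 0: the power of 0 is 0 because p is not 0, and so is its
     inverse. *)
  move=> [D1 D2]; have := dist_ge0 w.1 w.2; rewrite le_eqVlt => /predU1P[<-|w0].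
    by rewrite powR0 ?gt_eqF// invr0 mulr0 addr_ge0.
  have wM1 : dist w.1 w.2 <= M1.
    by have := dist_diam D1 D2; have := ler_norm diam; rewrite /M1; lra.
  have [h|h] := ltP (dist w.1 w.2) rho.
    apply: (@le_trans _ _ (F1 w)); last by rewrite lerDl.
    rewrite /F1 h mul1r mulrCA ler_wpM2l ?sqr_ge0//.
    rewrite ler_pdivlMr ?powR_gt0// mulrC -powRB; last by rewrite (gt_eqF w0) implybT.
    apply: (@le_trans _ _ (M1 `^ (pb - p))).
      by rewrite ge0_ler_powR ?nnegrE ?subr_ge0 ?(ltW p_pb) ?(ltW w0)// (le_trans _ M11).
    by rewrite ler_powR// gerBl ltW.
  apply: (@le_trans _ _ (F2 w)); last by rewrite lerDr.
  rewrite /F2 mulrCA ler_wpM2l ?sqr_ge0// invr_powR_le//.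
    exact: le_trans M1M.
  apply: (@le_trans _ _ rho^-1); first by rewrite lef_pV2.
  by rewrite lerDr (le_trans _ M11).
rewrite gagliardoE//.
apply: (@le_trans _ _ (\int[mu \x mu]_(w in D `*` D) ((F1 w)%:E + (F2 w)%:E))%E).
  apply: ge0_le_integral_nomeas => w Dw; first by rewrite lee_fin.
  by rewrite -EFinD lee_fin pointwise.
rewrite ge0_integralD//; last 2 first.
- by move=> w _; rewrite lee_fin.
- by move=> w _; rewrite lee_fin.
have I1 : (\int[mu \x mu]_(w in D `*` D) (F1 w)%:E <= (eta / 2)%:E)%E.
  rewrite /F1; under eq_integral do rewrite EFinM.
  rewrite ge0_integralZl_EFin ?powR_ge0//; last 2 first.
  - by move=> w _; rewrite lee_fin mulr_ge0.
  - by apply/measurable_EFinP; exact: measurable_funTS.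
  rewrite -near_energyE//.
  apply: (@le_trans _ _ ((M1 `^ pb)%:E * (K * rho `^ (m%:R + 2 - pb))%:E)%E).
    by rewrite lee_wpmul2l ?lee_fin ?powR_ge0// HK.
  by rewrite -EFinM lee_fin mulrA.
have I2 : (\int[mu \x mu]_(w in D `*` D) (F2 w)%:E <= (E0 + eta / 2)%:E)%E.
  rewrite /F2; under eq_integral do rewrite EFinM.
  rewrite ge0_integralZl_EFin ?powR_ge0//; last 2 first.
  - by move=> w _; rewrite lee_fin.
  - by apply/measurable_EFinP; exact: measurable_funTS.
  rewrite -gagliardoE// -[X in (_ * X <= _)%E]fineK// -EFinM lee_fin -/E0.
  apply: (@le_trans _ _ ((1 + eta / 2 / (E0 + 1)) * E0)).
    by rewrite ler_wpM2r// Hd1// ltW.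
  rewrite mulrDl mul1r lerD2l mulrAC -mulrA ler_piMr ?(ltW eta20)//.
  by rewrite ler_pdivrMr// mul1r lerDl.
apply: le_trans (leeD I1 I2) _.
rewrite -[X in (_ <= X + _)%E]fineK// -/E0 -!EFinD lee_fin.
by rewrite addrCA -splitr.
Qed.

(** Absolute continuity of the integral: off the diagonal the restriction to distance less than 1/(n
    + 1) eventually removes each pair, on the diagonal the integrand is 0, and the full integrand
    dominates. *)
Lemma near_energy_small p g (eta : R) : (forall x y, dist x y = 0 -> x = y) ->
  measurable_fun setT g -> (gagliardo mu dist p D g < +oo)%E -> 0 < eta ->
  exists2 delta : R, 0 < delta & forall rho, rho <= delta ->
    (near_energy mu dist D g p rho <= eta%:E)%E.
Proof.
move=> dist_eq0 mg gfin eta0.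
have mDD : measurable (D `*` D) by exact: measurableX.
have mi := measurable_gagliardo_integrand p mg.
pose q (w : T * T) : R := (g w.1 - g w.2) ^+ 2 / dist w.1 w.2 `^ p.
have q0 w : 0 <= q w by exact: integrand_ge0.
pose rk (n : nat) : R := n.+1%:R^-1.
pose f_ (n : nat) (w : T * T) : \bar R := ((dist w.1 w.2 < rk n)%R%:R * q w)%:E.
have iq : (mu \x mu)%E.-integrable (D `*` D) (EFin \o q).
  apply/integrableP; split; first by apply/measurable_EFinP; exact: measurable_funTS.
  suff -> : (\int[mu \x mu]_(w in D `*` D) `|(EFin \o q) w| =
    gagliardo mu dist p D g)%E by [].
  rewrite gagliardoE//; apply: eq_integral => w _.
  by rewrite gee0_abs// lee_fin (integrand_ge0 p g w).
have [] := @dominated_convergence _ _ _ (mu \x mu)%E _ mDD f_ (cst 0%E) (EFin \o q).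
- move=> n; apply/measurable_EFinP; apply: measurable_funTS.
  by apply: measurable_funM => //; exact: measurable_close.
- exact: measurable_cst.
- apply: aeW => w _.
  have := dist_ge0 w.1 w.2; rewrite le_eqVlt => /predU1P[/esym/dist_eq0 w12|w0].
    rewrite (_ : f_ ^~ w = cst 0%E); first exact: cvg_cst.
    by apply/funext => n; rewrite /f_ /q w12 subrr expr0n/= mul0r mulr0.
  apply: cvg_near_cst.
  have := near_infty_natSinv_lt (PosNum w0); apply: filterS => n /ltW/= rn.
  by rewrite /f_ ltNge rn mul0r.
- exact: iq.
- apply: aeW => w n _; rewrite /f_ /= normrM !ger0_norm ?q0//.
  by rewrite lee_fin ler_piMl ?q0//; case: (_ < _)%R.
move=> _ _; rewrite integral0 => cv.
have /fine_cvgP[fin /cvgrPdist_le/(_ _ eta0) le_eta] := cv.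
have [N _ /(_ N (leqnn N))[finN]] := filterI fin le_eta.
rewrite /= sub0r normrN => etaN.
exists (rk N); first by rewrite invr_gt0.
move=> rho rhoN; apply: (@le_trans _ _ (near_energy mu dist D g p (rk N))).
  apply: ge0_le_integral_nomeas => x _.
    by apply: integral_ge0 => y _; rewrite lee_fin mulr_ge0// (integrand_ge0 p g (x, y)).
  apply: ge0_le_integral_nomeas => y _.
    by rewrite lee_fin mulr_ge0// (integrand_ge0 p g (x, y)).
  rewrite lee_fin ler_wpM2r ?(integrand_ge0 p g (x, y))//.
  have [h|_] := ltP (dist x y) rho; last by [].
  by rewrite (lt_le_trans h rhoN).
rewrite near_energyE//.
have : (\int[mu \x mu]_(w in D `*` D) f_ N w)%E \is a fin_num by [].
by move=> /fineK <-; rewrite lee_fin (le_trans (ler_norm _)).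
Qed.

End energy_limits.

(** * Lipschitz approximation at finite energy *)

Section lipschitz_approximation.
Context {R : realType} {d} {T : measurableType d}.
Variables (mu : {sigma_finite_measure set T -> \bar R}) (dist : T -> T -> R).
Variables (D : set T) (m : nat) (C c r0 : R).
Implicit Types (r rho : R) (x y z : T).
Hypothesis mD : measurable D.
Hypothesis Doo : (mu D < +oo)%E.
Hypothesis mdist : measurable_fun setT (fun z : T * T => dist z.1 z.2).
Hypothesis dist_ge0 : forall x y, 0 <= dist x y.
Hypothesis dist_sym : forall x y, dist x y = dist y x.
Hypothesis dist_tri : forall x y z, dist x z <= dist x y + dist y z.
Hypotheses (C0 : 0 < C) (c0 : 0 < c).
Hypothesis ball_le : forall (x : T) (rho : R), D x -> 0 < rho ->
  (mu (D `&` [set y | (dist x y < rho)%R]) <= (C * rho ^+ m)%:E)%E.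
Hypothesis ball_ge : forall (x : T) (rho : R), D x -> 0 < rho <= r0 ->
  ((c * rho ^+ m)%:E <= mu (D `&` [set y | (dist x y < rho)%R]))%E.
Hypothesis r00 : 0 < r0.
Hypothesis dist_eq0 : forall x y, dist x y = 0 -> x = y.
Variables (u : T -> R) (p : R).
Hypotheses (mu_ : measurable_fun setT u) (u2 : L2 mu D u).
Hypothesis mp : m%:R < p < m%:R + 2.

Lemma lipschitz_approximation (eta : R) :
  (gagliardo mu dist p D u < +oo)%E -> 0 < eta ->
  exists v : T -> R, [/\ measurable_fun setT v,
    exists2 L : R, 0 <= L & forall x y, D x -> D y -> `|v x - v y| <= L * dist x y,
    (\int[mu]_(x in D) ((v x - u x) ^+ 2)%:E <= eta%:E)%E &
    (gagliardo mu dist p D v <= gagliardo mu dist p D u + eta%:E)%E].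
Proof.
move=> ufin eta0.
have gfin : gagliardo mu dist p D u \is a fin_num.
  rewrite ge0_fin_numE//; apply: integral_ge0 => x _; apply: integral_ge0 => y _.
  by rewrite lee_fin divr_ge0 ?powR_ge0 ?sqr_ge0.
have [K K0 HK] := average_energy mD Doo mdist dist_ge0 dist_sym dist_tri C0 c0
  ball_le ball_ge dist_eq0 mu_ u2 mp.
pose G := fine (gagliardo mu dist p D u).
have G0 : 0 <= G.
  apply: fine_ge0; apply: integral_ge0 => x _; apply: integral_ge0 => y _.
  by rewrite lee_fin divr_ge0 ?powR_ge0 ?sqr_ge0.
have G1 : 0 < G + 1 by rewrite ltr_wpDl.
(* The order of choices matters: theta first, so that theta times the energy is at most eta / 2;
   then the factor [kap], which blows up with 1/theta; last the radius r, making [kap] times the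
   near energy at most eta / 2. The added 1 avoids dividing by 0. *)
pose theta := eta / 2 / (G + 1).
have theta0 : 0 < theta by rewrite !divr_gt0.
pose kap := K * (1 + theta^-1).
have Kkap : K <= kap by rewrite ler_peMr// lerDl invr_ge0 ltW.
have kap1 : 0 < kap + 1 by rewrite ltr_wpDl// (le_trans K0).
pose eta1 := eta / 2 / (kap + 1).
have eta10 : 0 < eta1 by rewrite !divr_gt0.
have kape : kap * eta1 <= eta / 2.
  rewrite mulrCA ler_piMr ?divr_ge0 ?(ltW eta0)// ler_pdivrMr// mul1r lerDl//.
have [delta delta0 Hdelta] := near_energy_small mD mdist dist_ge0 dist_eq0 mu_ ufin eta10.
(* The bound r <= 1 makes r^(p - m) at most 1, so the L2 error is also controlled by the near
   energy. *)
pose r := Num.min r0 (Num.min 1 (delta / 2)).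
have r_0 : 0 < r by rewrite !lt_min r00 ltr01 divr_gt0.
have rr0 : r <= r0 by rewrite ge_min lexx.
have r1 : r <= 1 by rewrite !ge_min lexx !orbT.
have rdelta : 2 * r <= delta.
  by rewrite mulrC -ler_pdivlMr// !ge_min lexx !orbT.
have rr : 0 < r <= r0 by rewrite r_0.
have [H1 H2] := HK r rr.
have near := Hdelta _ rdelta.
exists (average mu dist D r u); split.
- exact: measurable_average.
- exact: (average_lipschitz mD Doo mdist dist_ge0 dist_sym dist_tri C0 c0
    ball_le ball_ge u2 rr).
- apply: le_trans H1 _.
  have mp' : 0 <= p - m%:R by case/andP: mp => /ltW; rewrite subr_ge0.
  have r_p : r `^ (p - m%:R) <= 1.
    have := @ge0_ler_powR _ _ mp' r 1; rewrite powR1; apply => //.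
    by rewrite nnegrE ltW.
    by rewrite nnegrE.
  apply: (@le_trans _ _ ((K * r `^ (p - m%:R))%:E * eta1%:E)%E).
    by rewrite lee_wpmul2l// lee_fin mulr_ge0 ?powR_ge0.
  rewrite -EFinM lee_fin; apply: (@le_trans _ _ (kap * eta1)).
    by rewrite ler_pM2r// (le_trans _ Kkap)// ler_piMr.
  by apply: le_trans kape _; lra.
- apply: le_trans (H2 _ theta0) _.
  apply: (@le_trans _ _ ((1 + theta)%:E * gagliardo mu dist p D u + kap%:E * eta1%:E)%E).
    by rewrite leeD2l// lee_wpmul2l// lee_fin (le_trans K0).
  rewrite -(fineK gfin) -/G -!EFinM -!EFinD lee_fin mulrDl mul1r -addrA lerD2l.
  rewrite [leRHS]splitr lerD//.
  by rewrite /theta mulrAC -mulrA ler_piMr ?divr_ge0 ?(ltW eta0)// ler_pdivrMr// mul1r lerDl.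
Qed.

End lipschitz_approximation.

(** * Euclidean geometry of the cross-section *)

Section euclidean_distance.
Context {R : realType} {n : nat}.
Implicit Types x y z : 'rV[R]_n.

Lemma dotr_ge0 x : 0 <= dotr x x.
Proof. by apply: sumr_ge0 => i _; rewrite -expr2 sqr_ge0. Qed.

Lemma dotrC x y : dotr x y = dotr y x.
Proof. by apply: eq_bigr => i _; rewrite mulrC. Qed.

Lemma dotrDl x y z : dotr (x + y) z = dotr x z + dotr y z.
Proof. by rewrite -big_split/=; apply: eq_bigr => i _; rewrite mxE mulrDl. Qed.

Lemma dotrZl (a : R) x y : dotr (a *: x) y = a * dotr x y.
Proof. by rewrite /dotr mulr_sumr; apply: eq_bigr => i _; rewrite mxE mulrA. Qed.

Lemma dotrDr x y z : dotr z (x + y) = dotr z x + dotr z y.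
Proof. by rewrite ![dotr z _]dotrC dotrDl. Qed.

Lemma dotrZr (a : R) x y : dotr x (a *: y) = a * dotr x y.
Proof. by rewrite ![dotr x _]dotrC dotrZl. Qed.

(** Cauchy-Schwarz: the square of the vector (y.y) x - (x.y) y equals (y.y) ((x.x)(y.y) - (x.y)^2).
    It gives the result after division by y.y, unless y = 0. *)
Lemma sqr_dotr_le x y : dotr x y ^+ 2 <= dotr x x * dotr y y.
Proof.
have := dotr_ge0 (dotr y y *: x + (- dotr x y) *: y).
rewrite !(dotrDl, dotrDr, dotrZl, dotrZr) (dotrC y x).
have := dotr_ge0 y; rewrite le_eqVlt => /predU1P[y0|y0 h].
  move=> _; have yz : y = 0.
    apply/rowP => i; rewrite mxE; apply/eqP; rewrite -sqrf_eq0 expr2.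
    move/esym/eqP: y0; rewrite psumr_eq0; last by move=> j _; rewrite -expr2 sqr_ge0.
    by move=> /allP/(_ i); rewrite mem_index_enum => /(_ isT)/=.
  by rewrite -y0 mulr0 yz /dotr big1 ?expr0n// => i _; rewrite mxE mulr0.
rewrite -subr_ge0 -(pmulr_rge0 _ y0); apply: le_trans h _.
by rewrite le_eqVlt; apply/orP; left; apply/eqP; ring.
Qed.

Lemma dotr_sqrD x y : dotr (x + y) (x + y) = dotr x x + 2 * dotr x y + dotr y y.
Proof. by rewrite dotrDl !dotrDr (dotrC y x); ring. Qed.

Lemma eucl_dist_ge0 x y : 0 <= eucl_dist x y.
Proof. exact: sqrtr_ge0. Qed.

Lemma eucl_dist_sqr x y : eucl_dist x y ^+ 2 = dotr (x - y) (x - y).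
Proof. by rewrite sqr_sqrtr// dotr_ge0. Qed.

Lemma eucl_dist_sym x y : eucl_dist x y = eucl_dist y x.
Proof.
rewrite /eucl_dist; congr Num.sqrt; apply: eq_bigr => i _.
by rewrite !mxE; ring.
Qed.

Lemma eucl_dist_tri x y z : eucl_dist x z <= eucl_dist x y + eucl_dist y z.
Proof.
have xy := eucl_dist_ge0 x y; have yz := eucl_dist_ge0 y z.
rewrite -(@ler_pXn2r _ 2) ?nnegrE ?addr_ge0 ?eucl_dist_ge0// sqrrD !eucl_dist_sqr.
have -> : x - z = (x - y) + (y - z) by rewrite addrA subrK.
rewrite dotr_sqrD.
suff : dotr (x - y) (y - z) <= eucl_dist x y * eucl_dist y z by lra.
apply: le_trans (ler_norm _) _.
rewrite -(@ler_pXn2r _ 2) ?nnegrE ?mulr_ge0// exprMn !eucl_dist_sqr.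
by rewrite real_normK ?num_real// sqr_dotr_le.
Qed.

Lemma coord_le_eucl_dist x y i : `|x ord0 i - y ord0 i| <= eucl_dist x y.
Proof.
rewrite -(@ler_pXn2r _ 2) ?nnegrE ?eucl_dist_ge0// eucl_dist_sqr real_normK ?num_real//.
rewrite /dotr (bigD1 i)//= !mxE -expr2 lerDl.
by apply: sumr_ge0 => j _; rewrite -expr2 sqr_ge0.
Qed.

Lemma eucl_dist_eq0 x y : eucl_dist x y = 0 -> x = y.
Proof.
move=> xy0; apply/rowP => i; apply/eqP; rewrite -subr_eq0 -normr_le0 -xy0.
exact: coord_le_eucl_dist.
Qed.

Lemma eucl_dist_le_coord x y (t : R) : (forall i, `|x ord0 i - y ord0 i| <= t) ->
  eucl_dist x y <= n%:R * `|t|.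
Proof.
move=> xyt; rewrite -(@ler_pXn2r _ 2) ?nnegrE ?mulr_ge0 ?eucl_dist_ge0//.
rewrite eucl_dist_sqr exprMn real_normK ?num_real//.
apply: (@le_trans _ _ (\sum_(i < n) t ^+ 2)).
  apply: ler_sum => i _; rewrite !mxE -expr2 -real_normK ?num_real//.
  rewrite lerXn2r ?nnegrE// ?(le_trans _ (xyt i))//.
rewrite sumr_const card_ord -[X in X <= _]mulr_natl ler_wpM2r ?sqr_ge0//.
by rewrite -natrX ler_nat; case: (n) => // k; rewrite expnS leq_pmulr// expn1.
Qed.

Lemma measurable_eucl_dist :
  measurable_fun setT (fun w : 'rV[R]_n * 'rV[R]_n => eucl_dist w.1 w.2).
Proof.
suff md : measurable_fun setT
    (fun w : 'rV[R]_n * 'rV[R]_n => dotr (w.1 - w.2) (w.1 - w.2)).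
  exact: (measurableT_comp (continuous_measurable_fun (@sqrt_continuous R)) md).
rewrite /dotr; apply: measurable_sum => i.
have mi : measurable_fun setT (fun w : 'rV[R]_n * 'rV[R]_n => (w.1 - w.2) ord0 i).
  rewrite (_ : (fun w => _) =
      (fun w : 'rV[R]_n * 'rV[R]_n => w.1 ord0 i - w.2 ord0 i)); last first.
    by apply/funext => w; rewrite !mxE.
  by apply: measurable_funB; apply: (measurableT_comp (measurable_coord_rV i)).
exact: measurable_funM.
Qed.

(** Cubes have a measure that is computed coordinate by coordinate. Euclidean balls are only ever
    compared with cubes. *)
Definition box x (t : R) : set 'rV[R]_n :=
  [set y | forall i, `|x ord0 i - y ord0 i| < t].

Lemma measurable_box x t : measurable (box x t).
Proof.
have -> : box x t = \bigcap_(i in [set: 'I_n])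
    ((fun y : 'rV[R]_n => y ord0 i) @^-1` [set s | `|x ord0 i - s| < t]).
  by rewrite predeqE => y; split=> [h i _|h i]; [exact: h|exact: h i I].
apply: fin_bigcap_measurable => // i _; rewrite -[X in measurable X]setTI.
apply: measurable_coord_rV => //.
apply: open_measurable.
rewrite (_ : [set _ | _] = ball (x ord0 i) t)//.
exact: ball_open.
Qed.

End euclidean_distance.

(** * Measure of cubes and measurability of open sets *)

Section lebesgue_boxes.
Context {R : realType}.

Lemma rV_cons_ord0 n (p : 'rV[R]_n * R) : rV_cons p ord0 ord0 = p.2.
Proof.
rewrite /rV_cons; have -> : ord0 = @lshift 1 n ord0 :> 'I_(1 + n) by exact: val_inj.
by rewrite [LHS](@row_mxEl R 1 1 n) mxE eqxx mulr1n.
Qed.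

Lemma rV_cons_rshift n (p : 'rV[R]_n * R) (j : 'I_n) :
  rV_cons p ord0 (rshift 1 j) = p.1 ord0 j.
Proof. by rewrite /rV_cons [LHS](@row_mxEr R 1 1 n). Qed.

Lemma lebesgue_rV_box n (x : 'rV[R]_n) (t : R) : 0 < t ->
  lebesgue_rV n (box x t) = ((2 * t) ^+ n)%:E.
Proof.
move=> t0; elim: n x => [|n IH] x.
  rewrite /= diracE mem_set//= => i; by case: i.
have -> : lebesgue_rV n.+1 (box x t) =
    lebesgue_pair (lebesgue_rV n) (@rV_cons R n @^-1` box x t) by [].
have -> : @rV_cons R n @^-1` box x t =
    box (rV_uncons x).1 t `*` ball ((rV_uncons x).2) t.
  rewrite predeqE => -[y s]; split => /= [h|[h1 h2] i].
    split => /= [i|]; first by have := h (rshift 1 i); rewrite rV_cons_rshift mxE.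
    by have := h ord0; rewrite rV_cons_ord0.
  case: (@splitP 1 n i) => j ij.
    have -> : i = ord0 by apply: val_inj; rewrite /= ij (ord1 j).
    by rewrite rV_cons_ord0.
  have -> : i = rshift 1 j :> 'I_(1 + n) by exact: val_inj.
  by rewrite rV_cons_rshift; have := h1 j; rewrite mxE.
rewrite /lebesgue_pair product_measure1E; last 2 first.
- exact: measurable_box.
- exact: measurable_ball.
transitivity (lebesgue_rV n (box (rV_uncons x).1 t) *
  lebesgue_measure (ball (rV_uncons x).2 t))%E; first by [].
rewrite IH lebesgue_measure_ball ?(ltW t0)// -EFinM; congr EFin.
by rewrite exprSr mulr_natl.
Qed.

End lebesgue_boxes.

Section open_sets_measurable.
Context {R : realType} {n : nat}.

(** The sigma-algebra is the one generated by the coordinates, so the topology has to be recovered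
    countably: A is the union of the cubes contained in it with rational centre and half-side 1/(k +
    1). *)
Lemma open_measurable_rV (A : set 'rV[R]_n) : open A -> measurable A.
Proof.
move=> oA.
pose q (p : 'rV[rat]_n) : 'rV[R]_n := map_mx ratr p.
pose B (p : 'rV[rat]_n * nat) := box (q p.1) (p.2.+1%:R^-1).
have -> : A = \bigcup_(p in [set: 'rV[rat]_n * nat])
    (if `[< B p `<=` A >] then B p else set0).
  apply/seteqP; split=> [x Ax|x [p _]]; last by case: asboolP => // h; exact: h.
  have [e/= e0 xeA] := (nbhs_ballP x A).1 (open_nbhs_nbhs (conj oA Ax)).
  have e20 : 0 < e / 2 by rewrite divr_gt0.
  (* Half of e: a cube of half-side below e / 2 whose centre is within e / 2 of x stays in the ball
     of radius e. *)
  have [k _ /(_ k (leqnn k))/= ke] := near_infty_natSinv_lt (PosNum e20).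
  have [qi Hq] : exists f : 'I_n -> rat, forall i, `|ratr (f i) - x ord0 i| < k.+1%:R^-1.
    have h i : exists f : rat, `|ratr f - x ord0 i| < k.+1%:R^-1.
      have kk : x ord0 i - k.+1%:R^-1 < x ord0 i + k.+1%:R^-1.
        by rewrite ltrD2l gtrN// invr_gt0.
      have [f] := rat_in_itvoo kk.
      by rewrite in_itv/= => fi; exists f; rewrite ltr_distl.
    by have [f Hf] := choice h; exists f.
  have Bx y : B (\row_i qi i, k) y <-> forall i, `|ratr (qi i) - y ord0 i| < k.+1%:R^-1.
    by split=> h i; have := h i; rewrite !mxE.
  exists (\row_i qi i, k) => //.
  suff -> : `[< B (\row_i qi i, k) `<=` A >] by exact/Bx.
  apply/asboolP => y /Bx By; apply: xeA; split=> // j i.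
  have ke2 : k.+1%:R^-1 < e / 2 by exact: ke.
  rewrite (ord1 j) /ball/= (le_lt_trans (ler_distD (ratr (qi i)) _ _))//.
  have Hi := Hq i; rewrite distrC in Hi.
  by apply: lt_trans (ltrD Hi (By i)) _; rewrite [ltRHS]splitr ltrD.
apply: countable_bigcupT_measurable => [|p]; first exact: countableP.
by case: ifP => _ //; exact: measurable_box.
Qed.

End open_sets_measurable.

(** * The interior cone property of bounded Lipschitz domains *)

Section interior_boxes.
Context {R : realType} {n : nat}.
Implicit Types (x y z a e : 'rV[R]_n) (A : set 'rV[R]_n).

Lemma rV_norm_le x (t : R) : 0 <= t -> (forall i, `|x ord0 i| <= t) -> `|x| <= t.
Proof.
move=> t0 h; rewrite [leLHS]/Num.norm /= mx_normrE; apply/bigmax_leP; split => //.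
by move=> [i j] _ /=; rewrite (ord1 i).
Qed.

Lemma le_rV_norm x i : `|x ord0 i| <= `|x|.
Proof.
rewrite [leRHS]/Num.norm /= mx_normrE.
by apply/bigmax_geP; right => /=; exists (ord0, i).
Qed.

Lemma bounded_closure A : bounded_set A -> bounded_set (closure A).
Proof.
move=> /pinfty_ex_gt0[M M0 AM]; exists (M + 1); split; first exact: num_real.
move=> M' MM' x clAx.
have [y [Ay xy]] := clAx _ (nbhsx_ballx x 1 ltr01).
have := AM y Ay; have := xy; rewrite -ball_normE /= => h1 h2.
have h3 : `|x| <= `|x - y| + `|y| by rewrite -{1}(subrK y x) ler_normD.
by apply: le_trans h3 _; apply: le_trans (lerD (ltW h1) h2) _; rewrite addrC ltW.
Qed.

(* The cone property; the constant kappa also bounds the scales r. *)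
Definition has_inner_boxes (kappa : R) A x := A x -> forall r, 0 < r <= kappa ->
  exists z, box z (kappa * r) `<=` A `&` box x r.

(** This monotonicity is what allows local constants to be replaced by a uniform one through
    compactness. *)
Lemma has_inner_boxes_le (kappa kappa' : R) A x : 0 < kappa' <= kappa ->
  has_inner_boxes kappa A x -> has_inner_boxes kappa' A x.
Proof.
move=> /andP[k'0 k'k] H Ax r /andP[r0 rk'].
have [|z Hz] := H Ax r; first by rewrite r0 (le_trans rk').
exists z => y hy; apply: Hz => i; apply: lt_le_trans (hy i) _.
by rewrite ler_wpM2r// ltW.
Qed.

Lemma unit_coord_le1 e i : dotr e e = 1 -> `|e ord0 i| <= 1.
Proof.
move=> e1; rewrite -(@ler_pXn2r _ 2) ?nnegrE// expr1n real_normK ?num_real//.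
rewrite -e1 /dotr (bigD1 i)//= -expr2 lerDl.
by apply: sumr_ge0 => j _; rewrite -expr2 sqr_ge0.
Qed.

Lemma dotr_unit_le e y (t : R) : dotr e e = 1 -> (forall i, `|y ord0 i| <= t) ->
  `|dotr y e| <= n%:R * t.
Proof.
move=> e1 yt; apply: le_trans (ler_norm_sum _ _ _) _.
apply: (@le_trans _ _ (\sum_(i < n) t)); last by rewrite sumr_const card_ord mulr_natl.
apply: ler_sum => i _; rewrite normrM -[leRHS]mulr1.
by rewrite ler_pM// unit_coord_le1.
Qed.

Lemma inner_boxes_interior A a : open A -> A a ->
  exists2 kappa : R, 0 < kappa & forall x, ball a kappa x -> has_inner_boxes kappa A x.
Proof.
move=> oA Aa.
have [e/= e0 aeA] := (nbhs_ballP a A).1 (open_nbhs_nbhs (conj oA Aa)).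
have ke0 : 0 < Num.min 1 (e / 2) by rewrite lt_min ltr01 divr_gt0.
exists (Num.min 1 (e / 2)) => // x [_ ax] Ax r /andP[r0 rk].
exists x => y xy; split=> [|i].
  apply: aeA; split=> // j i; rewrite (ord1 j) [e]splitr.
  apply: (@ball_triangle _ _ (x ord0 i)).
    by apply: le_ball (ax ord0 i); rewrite ge_min lexx orbT.
  have rk2 : r <= e / 2 by rewrite (le_trans rk)// ge_min lexx orbT.
  rewrite /ball/=; apply: lt_le_trans (xy i) _; apply: le_trans rk2.
  by rewrite ler_piMl ?(ltW r0)// ge_min lexx.
apply: lt_le_trans (xy i) _.
by rewrite ler_piMl ?(ltW r0)// ge_min lexx.
Qed.

(** Moving x by r / 2 along e raises it by r / 2 above the graph and leaves its component orthogonal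
    to e unchanged. A further displacement h with coordinates at most kappa r changes the height by
    at most n kappa r and gamma by at most L (n + 1) kappa r, so the point stays above the graph if
    (L + 1) (n + 1) kappa <= 1/2. *)
Lemma inner_boxes_boundary A a e (gamma : 'rV[R]_n -> R) :
  dotr e e = 1 -> lipschitz (gamma : 'rV[R]_n -> R^o) ->
  (\forall x \near a, A x <-> gamma (x - dotr x e *: e) < dotr x e) ->
  exists2 kappa : R, 0 < kappa & forall x, ball a kappa x -> has_inner_boxes kappa A x.
Proof.
move=> e1 /pinfty_ex_gt0[L L0 gL] /nbhs_ballP[rho/= rho0 HA].
have n10 : 0 < n.+1%:R :> R by [].
have L10 : 0 < L + 1 by rewrite addr_gt0.
have den0 : 0 < 2 * n.+1%:R * (L + 1) by rewrite !mulr_gt0.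
(* The bound rho / 2 keeps all the points considered in the ball where A is an epigraph. *)
pose kappa := Num.min (rho / 2) (2 * n.+1%:R * (L + 1))^-1.
have k0 : 0 < kappa by rewrite lt_min divr_gt0// invr_gt0.
have krho : kappa <= rho / 2 by rewrite ge_min lexx.
have kden : kappa * (2 * n.+1%:R * (L + 1)) <= 1.
  by rewrite -ler_pdivlMr// div1r ge_min lexx orbT.
have khalf : kappa <= 2^-1.
  rewrite -(ler_pM2r den0); apply: le_trans kden _.
  rewrite -mulrA mulKf ?gt_eqF// -[leLHS]mulr1 ler_pM// ?ler1n//.
  by rewrite lerDr ltW.
exists kappa => // x [_ ax] Ax r /andP[r0 rk].
have Ax' : gamma (x - dotr x e *: e) < dotr x e.
  apply/HA => //; split=> // i j; apply: le_ball (ax i j).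
  by rewrite (le_trans krho)// ler_pdivrMr// ler_peMr ?(ltW rho0)// ler1n.
exists (x + (r / 2) *: e) => y zy.
have [h hE] : exists h, y = x + (r / 2) *: e + h.
  by exists (y - x - (r / 2) *: e); apply/rowP => i; rewrite !mxE; ring.
have hk i : `|h ord0 i| <= kappa * r.
  by have := zy i; rewrite hE !mxE opprD addrA subrr sub0r normrN => /ltW.
have kr2 : kappa * r <= r / 2 by rewrite mulrC ler_pM2l.
have hlt i : `|h ord0 i| < kappa * r.
  by have := zy i; rewrite hE !mxE opprD addrA subrr sub0r normrN.
have xy i : `|x ord0 i - y ord0 i| < r.
  have -> : x ord0 i - y ord0 i = - (r / 2 * e ord0 i + h ord0 i).
    by rewrite {1}hE !mxE; ring.
  rewrite normrN; apply: le_lt_trans (ler_normD _ _) _; rewrite [ltRHS]splitr.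
  apply: ler_ltD; last exact: lt_le_trans (hlt i) kr2.
  rewrite normrM ger0_norm ?divr_ge0 ?(ltW r0)//.
  by rewrite ler_piMr ?divr_ge0 ?(ltW r0)// unit_coord_le1.
split=> [|i]; last exact: xy.
have ay : ball a rho y.
  split=> // i j; rewrite (ord1 i) [rho]splitr.
  apply: (@ball_triangle _ _ (x ord0 j)); first exact: le_ball (ax ord0 j).
  by rewrite /ball/=; apply: lt_le_trans (xy j) _; rewrite (le_trans rk).
apply/HA => //.
have ye : dotr y e = dotr x e + r / 2 + dotr h e.
  by rewrite hE !(dotrDl, dotrZl) e1 mulr1.
have yperp : (y - dotr y e *: e) - (x - dotr x e *: e) = h - dotr h e *: e.
  by apply/rowP => i; rewrite ye hE !mxE; ring.
have dh := dotr_unit_le e1 hk.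
have kr0 : 0 <= kappa * r by rewrite mulr_ge0 ?(ltW k0) ?(ltW r0).
have perp_le : `|(y - dotr y e *: e) - (x - dotr x e *: e)| <= n.+1%:R * (kappa * r).
  rewrite yperp; apply: rV_norm_le => [|i]; first by rewrite mulr_ge0.
  rewrite !mxE; apply: le_trans (ler_normB _ _) _.
  rewrite -[n.+1%:R]natr1 mulrDl mul1r addrC lerD//.
  rewrite normrM; apply: le_trans dh; rewrite ler_piMr// unit_coord_le1//.
have gle : gamma (y - dotr y e *: e) - gamma (x - dotr x e *: e) <=
    L * (n.+1%:R * (kappa * r)).
  apply: le_trans (ler_norm _) _.
  have := gL (y - dotr y e *: e, x - dotr x e *: e) (conj I I) => /= h1.
  by apply: le_trans h1 _; rewrite ler_pM2l.
have krn : 2 * ((L + 1) * (n.+1%:R * (kappa * r))) <= r.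
  have -> : 2 * ((L + 1) * (n.+1%:R * (kappa * r))) =
    kappa * (2 * n.+1%:R * (L + 1)) * r by ring.
  by rewrite ler_piMl// ltW.
have dh2 : - (n.+1%:R * (kappa * r)) <= dotr h e.
  have := ler_norm (- dotr h e); rewrite normrN => h1.
  have : `|dotr h e| <= n.+1%:R * (kappa * r).
    by apply: le_trans dh _; rewrite ler_wpM2r// ler_nat.
  lra.
move: gle dh2 krn Ax'; rewrite ye.
move: (gamma _) (gamma _) (n.+1%:R * (kappa * r)) => g1 g2 w; lra.
Qed.

(** Every point of the compact closure has a neighbourhood with its own constant. Since smaller
    constants remain valid, the property holds locally for all small kappa > 0, and compactness in
    its near-covering form makes the smallness uniform. *)
Lemma uniform_inner_boxes A : bounded_set A -> open A -> lipschitz_boundary A ->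
  exists2 kappa : R, 0 < kappa & forall x, has_inner_boxes kappa A x.
Proof.
move=> bA oA lA.
have cA : compact (closure A).
  apply: bounded_closed_compact; first exact: bounded_closure.
  exact: closed_closure.
have /compact_near_coveringP cov := cA.
have local a : closure A a -> exists2 kappa : R, 0 < kappa &
    forall x, ball a kappa x -> has_inner_boxes kappa A x.
  move=> clAa; have [Aa|nAa] := pselect (A a); first exact: inner_boxes_interior.
  have [] := lA a; first by split => // /interior_subset.
  by move=> e [gamma [e1 gL HA]]; exact: inner_boxes_boundary HA.
have H : \forall kappa \near (0 : R)^'+, closure A `<=` has_inner_boxes kappa A.
  apply: cov => a /local[k k0 Hk].
  exists (ball a k, [set kappa | 0 < kappa <= k]) => /=.
    split; first exact: nbhsx_ballx.
    by near=> t; apply/andP; split; near: t; [exact: nbhs_right_gt|exact: nbhs_right_le].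
  by move=> [x kappa] /= [/Hk hx kk]; exact: has_inner_boxes_le kk hx.
have [kappa [kappa0 Hkappa]] : exists kappa : R, 0 < kappa /\
    closure A `<=` has_inner_boxes kappa A.
  have : \forall kappa \near (0 : R)^'+, 0 < kappa /\ closure A `<=` has_inner_boxes kappa A.
    by apply: filterS2 (nbhs_right_gt 0) H.
  by move/filter_ex.
by exists kappa => // x Ax; exact: Hkappa (subset_closure Ax) Ax.
Unshelve. all: by end_near. Qed.

End interior_boxes.

(** * Measure of Euclidean balls, inside the domain and in the cylinder *)

Section rV_balls.
Context {R : realType} {n : nat}.
Implicit Types (x y z : 'rV[R]_n) (A : set 'rV[R]_n).

Lemma eucl_ball_measure_le A x rho : measurable A -> 0 < rho ->
  (lebesgue_rV n (A `&` [set y | (eucl_dist x y < rho)%R]) <= (2 ^+ n * rho ^+ n)%:E)%E.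
Proof.
move=> mA rho0; rewrite -exprMn -(lebesgue_rV_box x rho0).
apply: le_measure; rewrite ?inE.
- apply: measurableI => //; apply: measurable_distball => z.
  exact: (measurable_dist1 (@measurable_eucl_dist R n)).
- exact: measurable_box.
- by move=> y [_ xy] i; exact: le_lt_trans (coord_le_eucl_dist x y i) xy.
Qed.

(** The cube of half-side r / (n + 1) about x lies in the Euclidean ball of radius r, so the inner
    cube at scale r / (n + 1) gives the bound. Dividing by n + 1 keeps the inclusion strict and
    covers n = 0. *)
Lemma eucl_ball_measure_ge A : measurable A -> bounded_set A -> open A ->
  lipschitz_boundary A ->
  exists c r0 : R, [/\ 0 < c, 0 < r0 & forall x r, A x -> 0 < r <= r0 ->
  ((c * r ^+ n)%:E <= lebesgue_rV n (A `&` [set y | (eucl_dist x y < r)%R]))%E].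
Proof.
move=> mA bA oA lA; have [kappa k0 Hk] := uniform_inner_boxes bA oA lA.
have n10 : 0 < n.+1%:R :> R by [].
exists ((2 * (kappa / n.+1%:R)) ^+ n), kappa; split=> //.
  by rewrite exprn_gt0// mulr_gt0// divr_gt0.
move=> x r Ax /andP[r0 rk].
have rn0 : 0 < r / n.+1%:R by rewrite divr_gt0.
have [|z Hz] := Hk x Ax (r / n.+1%:R).
  rewrite rn0/= (le_trans _ rk)// ler_pdivrMr// ler_peMr ?(ltW r0)//.
  by rewrite ler1n.
have kr0 : 0 < kappa * (r / n.+1%:R) by rewrite mulr_gt0.
have -> : (2 * (kappa / n.+1%:R)) ^+ n * r ^+ n = (2 * (kappa * (r / n.+1%:R))) ^+ n.
  by rewrite -exprMn; congr (_ ^+ _); ring.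
rewrite -(lebesgue_rV_box z kr0).
apply: le_measure; rewrite ?inE.
- exact: measurable_box.
- apply: measurableI => //; apply: measurable_distball => z'.
  exact: (measurable_dist1 (@measurable_eucl_dist R n)).
- move=> y /Hz[Ay xy]; split => //=.
  apply: le_lt_trans (@eucl_dist_le_coord _ _ x y (r / n.+1%:R) (fun i => ltW (xy i))) _.
  rewrite ger0_norm ?(ltW rn0)// mulrA ltr_pdivrMr// mulrC ltr_pM2l//.
  by rewrite ltr_nat.
Qed.

Lemma bounded_box A : bounded_set A -> exists2 M : R, 0 < M & A `<=` box 0 M.
Proof.
move=> /pinfty_ex_gt0[M M0 AM]; exists (M + 1); first by rewrite addr_gt0.
move=> x Ax i; rewrite mxE sub0r normrN.
by apply: le_lt_trans (le_rV_norm x i) _; apply: le_lt_trans (AM x Ax) _; rewrite ltrDl.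
Qed.

Lemma bounded_measure_lty A : measurable A -> bounded_set A ->
  (lebesgue_rV n A < +oo)%E.
Proof.
move=> mA /bounded_box[M M0 AM].
apply: (@le_lt_trans _ _ (lebesgue_rV n (box 0 M))).
  by apply: le_measure; rewrite ?inE//; exact: measurable_box.
by rewrite lebesgue_rV_box ?ltry.
Qed.

Lemma bounded_diameter A : bounded_set A -> exists2 diam : R, 0 < diam &
  forall x y, A x -> A y -> eucl_dist x y < diam.
Proof.
move=> /bounded_box[M M0 AM]; exists (n%:R * (2 * M) + 1).
  by rewrite ltr_wpDl// !mulr_ge0// ltW.
move=> x y Ax Ay; rewrite (@le_lt_trans _ _ (n%:R * `|2 * M|))//.
  apply: eucl_dist_le_coord => i.
  have := AM x Ax i; have := AM y Ay i; rewrite mxE !sub0r !normrN => h1 h2.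
  apply: le_trans (ler_normB _ _) _; have := ltW (ltrD h2 h1); lra.
by rewrite ger0_norm ?ltrDl// mulr_ge0// ltW.
Qed.

Local Notation Rd := ('rV[R]_n * measurableTypeR R)%type.

Lemma eucl_dist_le_pair (p q : 'rV[R]_n * R) : eucl_dist p.1 q.1 <= eucl_dist_pair p q.
Proof. by rewrite ler_sqrt ?addr_ge0 ?dotr_ge0 ?sqr_ge0// lerDl sqr_ge0. Qed.

Lemma snd_le_eucl_dist_pair (p q : 'rV[R]_n * R) : `|p.2 - q.2| <= eucl_dist_pair p q.
Proof.
rewrite -sqrtr_sqr ler_sqrt ?addr_ge0 ?dotr_ge0 ?sqr_ge0//.
by rewrite lerDr dotr_ge0.
Qed.

Lemma eucl_dist_pair_ge0 (p q : 'rV[R]_n * R) : 0 <= eucl_dist_pair p q.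
Proof. exact: sqrtr_ge0. Qed.

Lemma eucl_dist_pair_sqr (p q : 'rV[R]_n * R) :
  eucl_dist_pair p q ^+ 2 = eucl_dist p.1 q.1 ^+ 2 + (p.2 - q.2) ^+ 2.
Proof. by rewrite eucl_dist_sqr sqr_sqrtr// addr_ge0 ?dotr_ge0 ?sqr_ge0. Qed.

Lemma measurable_eucl_dist_pair :
  measurable_fun setT (fun w : Rd * Rd => eucl_dist_pair w.1 w.2).
Proof.
have m1 : measurable_fun setT (fun w : Rd * Rd => eucl_dist w.1.1 w.2.1).
  apply: (measurableT_comp (@measurable_eucl_dist R n) (g := fun w : Rd * Rd => (w.1.1, w.2.1))).
  by apply: measurable_fun_pair; exact: measurableT_comp.
have m2 : measurable_fun setT (fun w : Rd * Rd => (w.1.2 - w.2.2 : R)).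
  by apply: measurable_funB; exact: measurableT_comp.
suff md : measurable_fun setT (fun w : Rd * Rd =>
    eucl_dist w.1.1 w.2.1 ^+ 2 + (w.1.2 - w.2.2) ^+ 2).
  have := measurableT_comp (continuous_measurable_fun (@sqrt_continuous R)) md.
  apply: eq_measurable_fun => w _ /=.
  by rewrite -eucl_dist_pair_sqr sqrtr_sqr ger0_norm// eucl_dist_pair_ge0.
by apply: measurable_funD; exact: measurable_funX.
Qed.

Lemma eucl_pair_ball_measure_le (A : set Rd) (x : Rd) (rho : R) : measurable A -> 0 < rho ->
  (lebesgue_pair (lebesgue_rV n) (A `&` [set y | (eucl_dist_pair x y < rho)%R]) <=
   (2 ^+ n.+1 * rho ^+ n.+1)%:E)%E.
Proof.
move=> mA rho0.
apply: (@le_trans _ _ (lebesgue_pair (lebesgue_rV n) (box x.1 rho `*` ball (x.2 : R) rho))).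
  apply: le_measure; rewrite ?inE.
  - apply: measurableI => //; apply: measurable_distball => z'.
    exact: (measurable_dist1 measurable_eucl_dist_pair).
  - by apply: measurableX; [exact: measurable_box|exact: measurable_ball].
  - move=> y [_ xy]; split => /= [i|].
      apply: le_lt_trans (coord_le_eucl_dist x.1 y.1 i) _.
      exact: le_lt_trans (eucl_dist_le_pair x y) xy.
    exact: le_lt_trans (snd_le_eucl_dist_pair x y) xy.
rewrite /lebesgue_pair product_measure1E; last 2 first.
- exact: measurable_box.
- exact: measurable_ball.
apply: (@le_trans _ _ (lebesgue_rV n (box x.1 rho) * lebesgue_measure (ball (x.2 : R) rho))%E).
  by [].
rewrite lebesgue_rV_box// lebesgue_measure_ball ?(ltW rho0)// -EFinM lee_fin.
by rewrite -exprMn exprSr mulr_natl.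
Qed.

End rV_balls.

Lemma ler_norm_maxB {R : realType} (a b a' b' : R) :
  `|Num.max a b - Num.max a' b'| <= `|a - a'| + `|b - b'|.
Proof.
have := ler_norm (a - a'); have := ler_norm (a' - a); rewrite (distrC a').
have := ler_norm (b - b'); have := ler_norm (b' - b); rewrite (distrC b').
have := normr_ge0 (a - a'); have := normr_ge0 (b - b').
move: `|a - a'| `|b - b'| => p q; rewrite ler_norml /Num.max.
by case: ltP => ?; case: ltP => ?; lra.
Qed.

(** * Density of Lipschitz functions in L2 *)

Section clamp.
Context {R : realType}.
Implicit Types M s t : R.

(* min M t is written with maxima, so that stability of Lipschitz functions
   under maxima and multiples suffices. *)
Definition clamp M t : R := Num.max (- M) (- Num.max (- M) (- t)).

Lemma clamp_id M t : `|t| <= M -> clamp M t = t.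
Proof.
rewrite ler_norml => /andP[h1 h2].
by rewrite /clamp (@max_r _ _ (- M) (- t)) ?lerN2// opprK max_r.
Qed.

Lemma norm_clamp_le M t : 0 <= M -> `|clamp M t| <= M.
Proof.
move=> M0; rewrite ler_norml /clamp le_max lexx/= ge_max (_ : - M <= M); last by lra.
by rewrite lerNl le_max lexx.
Qed.

Lemma clamp_lipschitz M s t : `|clamp M s - clamp M t| <= `|s - t|.
Proof.
apply: le_trans (ler_norm_maxB _ _ _ _) _; rewrite subrr normr0 add0r -opprD normrN.
apply: le_trans (ler_norm_maxB _ _ _ _) _; rewrite subrr normr0 add0r -opprD normrN.
exact: lexx.
Qed.

Lemma norm_subr_clamp_le M t : 0 <= M -> `|t - clamp M t| <= `|t|.
Proof.
move=> M0; have [h|h] := leP `|t| M; first by rewrite clamp_id// subrr normr0.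
have [t0|t0] := leP 0 t.
  move: h; rewrite ger0_norm// => h.
  have -> : clamp M t = M.
    by rewrite /clamp (@max_l _ _ (- M) (- t)) ?lerN2 ?(ltW h)// opprK max_r//; lra.
  by rewrite ger0_norm; lra.
move: h; rewrite ltr0_norm// => h.
have -> : clamp M t = - M.
  rewrite /clamp (@max_r _ _ (- M) (- t)); last by lra.
  by rewrite opprK max_l//; lra.
by rewrite ler0_norm; lra.
Qed.

End clamp.

Section lipschitz_density.
Context {R : realType} {n : nat}.
Variable D : set 'rV[R]_n.
Hypotheses (mD : measurable D) (Doo : (lebesgue_rV n D < +oo)%E).
Implicit Types (f g h : 'rV[R]_n -> R) (A B : set 'rV[R]_n).

Local Notation mu := (lebesgue_rV n).

Definition lipschitz_rV g := measurable_fun setT g /\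
  exists2 L : R, 0 <= L & forall x y, `|g x - g y| <= L * eucl_dist x y.

Lemma lipschitz_rV_cst (a : R) : lipschitz_rV (fun=> a).
Proof. by split=> //; exists 0 => // x y; rewrite subrr normr0 mul0r. Qed.

Lemma lipschitz_rVD g h : lipschitz_rV g -> lipschitz_rV h ->
  lipschitz_rV (fun x => g x + h x).
Proof.
move=> [mg [L L0 gL]] [mh [M M0 hM]]; split; first exact: measurable_funD.
exists (L + M); first exact: addr_ge0.
move=> x y; rewrite opprD addrACA mulrDl.
exact: le_trans (ler_normD _ _) (lerD (gL x y) (hM x y)).
Qed.

Lemma lipschitz_rVZ (a : R) g : lipschitz_rV g -> lipschitz_rV (fun x => a * g x).
Proof.
move=> [mg [L L0 gL]]; split; first exact: measurable_funM.
exists (`|a| * L); first exact: mulr_ge0.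
by move=> x y; rewrite -mulrBr normrM -mulrA ler_wpM2l.
Qed.

Lemma lipschitz_rV_max g h : lipschitz_rV g -> lipschitz_rV h ->
  lipschitz_rV (fun x => Num.max (g x) (h x)).
Proof.
move=> [mg [L L0 gL]] [mh [M M0 hM]]; split; first exact: measurable_maxr.
exists (L + M); first exact: addr_ge0.
move=> x y; rewrite mulrDl; apply: le_trans (ler_norm_maxB _ _ _ _) _.
exact: lerD (gL x y) (hM x y).
Qed.

Lemma lipschitz_rV_coord (i : 'I_n) : lipschitz_rV (fun x => x ord0 i).
Proof.
split; first exact: measurable_coord_rV.
by exists 1 => // x y; rewrite mul1r coord_le_eucl_dist.
Qed.

(** Approximability is built up in L1, where sums, multiples, maxima and dominated limits are
    immediate; the return to L2 is made at the end by clamping. *)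
Definition L1_approx f := measurable_fun setT f /\ forall eta : R, 0 < eta ->
  exists g, lipschitz_rV g /\ (\int[mu]_(x in D) (`|f x - g x|)%:E <= eta%:E)%E.

Lemma L1_triangle f g h : measurable_fun setT f -> measurable_fun setT g ->
  measurable_fun setT h -> (\int[mu]_(x in D) (`|f x - h x|)%:E <=
  \int[mu]_(x in D) (`|f x - g x|)%:E + \int[mu]_(x in D) (`|g x - h x|)%:E)%E.
Proof.
move=> mf mg mh.
have md (p q : 'rV[R]_n -> R) : measurable_fun setT p -> measurable_fun setT q ->
    measurable_fun D (fun x => (`|p x - q x|)%:E).
  move=> mp mq; apply/measurable_EFinP; apply: measurable_funTS.
  by apply: measurableT_comp => //; exact: measurable_funB.
rewrite -ge0_integralD//; [|exact: md..].
apply: ge0_le_integral_nomeas => x _; first by rewrite lee_fin.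
by rewrite -EFinD lee_fin ler_distD.
Qed.

Lemma L1_approx_lipschitz g : lipschitz_rV g -> L1_approx g.
Proof.
move=> lg; split; first by case: lg.
move=> eta eta0; exists g; split => //.
under eq_integral do rewrite subrr normr0.
by rewrite integral0 lee_fin ltW.
Qed.

Lemma L1_approx_lim (f_ : nat -> 'rV[R]_n -> R) f : measurable_fun setT f ->
  (forall k, L1_approx (f_ k)) ->
  (forall eta : R, 0 < eta -> exists k,
    (\int[mu]_(x in D) (`|f x - f_ k x|)%:E <= eta%:E)%E) -> L1_approx f.
Proof.
move=> mf af H; split=> // eta eta0.
have eta20 : 0 < eta / 2 by rewrite divr_gt0.
have [k Hk] := H _ eta20; have [mfk /(_ _ eta20)[g [lg Hg]]] := af k.
exists g; split => //; apply: le_trans (L1_triangle mf mfk _) _; first by case: lg.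
by apply: le_trans (leeD Hk Hg) _; rewrite -EFinD -splitr.
Qed.

Lemma L1_approx_dominated (f_ : nat -> 'rV[R]_n -> R) f : measurable_fun setT f ->
  (forall k, L1_approx (f_ k)) -> (forall k x, `|f_ k x| <= 1) ->
  (forall x, f_ k x @[k --> \oo] --> f x) -> L1_approx f.
Proof.
move=> mf af f1 cf; apply: (L1_approx_lim mf af) => eta eta0.
have [] := @dominated_convergence _ _ _ mu D mD (fun k x => (f_ k x)%:E)
  (EFin \o f) (cst 1%E).
- move=> k; apply/measurable_EFinP; apply: measurable_funTS; by case: (af k).
- by apply/measurable_EFinP; exact: measurable_funTS.
- by apply: aeW => x _; apply: cvg_EFin; [exact: nearW|exact: cf].
- by apply: (@integrable_bounded _ _ _ _ D (cst 1) 1) => // x _; rewrite normr1.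
- by apply: aeW => x k _; rewrite lee_fin f1.
move=> _ cv _; move: cv => /fine_cvgP[fin /cvgrPdist_le/(_ _ eta0) le_eta].
have [N _ /(_ N (leqnn N))[finN]] := filterI fin le_eta.
rewrite /= sub0r normrN => etaN; exists N.
apply: (@le_trans _ _ (\int[mu]_(x in D) `|(f_ N x)%:E - (f x)%:E|)%E).
  by apply: ge0_le_integral_nomeas => x _; rewrite ?lee_fin// distrC.
have finN' : (\int[mu]_(x in D) `|(f_ N x)%:E - (f x)%:E|)%E \is a fin_num by [].
by rewrite -(fineK finN') lee_fin; exact: le_trans (ler_norm _) etaN.
Qed.

Lemma L1_approxD f g : L1_approx f -> L1_approx g -> L1_approx (fun x => f x + g x).
Proof.
move=> [mf af] [mg ag]; split; first exact: measurable_funD.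
move=> eta eta0; have eta20 : 0 < eta / 2 by rewrite divr_gt0.
have [f' [lf Hf]] := af _ eta20; have [g' [lg Hg]] := ag _ eta20.
exists (fun x => f' x + g' x); split; first exact: lipschitz_rVD.
have md (p q : 'rV[R]_n -> R) : measurable_fun setT p -> measurable_fun setT q ->
    measurable_fun D (fun x => (`|p x - q x|)%:E).
  move=> mp mq; apply/measurable_EFinP; apply: measurable_funTS.
  by apply: measurableT_comp => //; exact: measurable_funB.
rewrite [eta]splitr EFinD; apply: le_trans (leeD Hf Hg).
rewrite -ge0_integralD//; [|by apply: md => //; case: lf|by apply: md => //; case: lg].
apply: ge0_le_integral_nomeas => x _; first by rewrite lee_fin.
by rewrite -EFinD lee_fin opprD addrACA ler_normD.
Qed.

Lemma L1_approx_max f g : L1_approx f -> L1_approx g ->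
  L1_approx (fun x => Num.max (f x) (g x)).
Proof.
move=> [mf af] [mg ag]; split; first exact: measurable_maxr.
move=> eta eta0; have eta20 : 0 < eta / 2 by rewrite divr_gt0.
have [f' [lf Hf]] := af _ eta20; have [g' [lg Hg]] := ag _ eta20.
exists (fun x => Num.max (f' x) (g' x)); split; first exact: lipschitz_rV_max.
have md (p q : 'rV[R]_n -> R) : measurable_fun setT p -> measurable_fun setT q ->
    measurable_fun D (fun x => (`|p x - q x|)%:E).
  move=> mp mq; apply/measurable_EFinP; apply: measurable_funTS.
  by apply: measurableT_comp => //; exact: measurable_funB.
rewrite [eta]splitr EFinD; apply: le_trans (leeD Hf Hg).
rewrite -ge0_integralD//; [|by apply: md => //; case: lf|by apply: md => //; case: lg].
apply: ge0_le_integral_nomeas => x _; first by rewrite lee_fin.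
by rewrite -EFinD lee_fin ler_norm_maxB.
Qed.

Lemma L1_approxZ (a : R) f : L1_approx f -> L1_approx (fun x => a * f x).
Proof.
move=> [mf af]; split; first exact: measurable_funM.
move=> eta eta0; have a1 : 0 < `|a| + 1 by rewrite ltr_wpDl.
have [f' [lf Hf]] := af _ (divr_gt0 eta0 a1).
exists (fun x => a * f' x); split; first exact: lipschitz_rVZ.
have mdf : measurable_fun D (fun x => (`|f x - f' x|)%:E).
  apply/measurable_EFinP; apply: measurable_funTS.
  by apply: measurableT_comp => //; apply: measurable_funB => //; case: lf.
under eq_integral do rewrite -mulrBr normrM EFinM.
rewrite ge0_integralZl_EFin//.
apply: (@le_trans _ _ ((`|a|)%:E * (eta / (`|a| + 1))%:E)%E).
  by rewrite lee_wpmul2l ?lee_fin.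
by rewrite -EFinM lee_fin mulrA ler_pdivrMr// mulrC ler_pM2l// lerDl.
Qed.

(** These sets form a sigma-algebra, so the half-spaces that generate the coordinate sigma-algebra
    suffice and no regularity of the measure is invoked. *)
Definition approximable : set (set 'rV[R]_n) := [set A | L1_approx (\1_A : _ -> R)].

Lemma approximableC A : approximable A -> approximable (~` A).
Proof.
move=> aA; rewrite /approximable/=.
rewrite (_ : \1_(~` A) = fun x => 1 + (-1) * \1_A x); last first.
  apply/funext => x; rewrite indicC/= indicE.
  by case: (x \in A) => /=; rewrite ?mulr1 ?subrr ?mulr0 ?addr0.
apply: L1_approxD; last exact: L1_approxZ.
by apply: L1_approx_lipschitz; exact: lipschitz_rV_cst.
Qed.

Lemma approximableU A B : approximable A -> approximable B -> approximable (A `|` B).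
Proof.
move=> aA aB; rewrite /approximable/=.
rewrite (_ : \1_(A `|` B) = fun x => Num.max (\1_A x) (\1_B x)); last first.
  apply/funext => x; rewrite !indicE in_setU.
  by case: (x \in A); case: (x \in B); rewrite /= /Num.max ?ltxx ?ltr01 ?ltr10.
exact: L1_approx_max.
Qed.

Lemma approximable0 : approximable set0.
Proof. by rewrite /approximable/= indic0; apply: L1_approx_lipschitz; exact: lipschitz_rV_cst. Qed.

(** Finite unions come from maxima of indicators; their indicators converge to that of the whole
    union, bounded by 1 on a set of finite measure. *)
Lemma approximable_bigcup (F : (set 'rV[R]_n)^nat) :
  (forall k, approximable (F k)) -> approximable (\bigcup_k F k).
Proof.
move=> aF.
pose G k := \big[setU/set0]_(i < k) F i.
have aG k : approximable (G k).
  rewrite /G; elim/big_ind : _ => //; [exact: approximable0|exact: approximableU].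
have cG x : (\1_(G k) x : R) @[k --> \oo] --> (\1_(\bigcup_k F k) x : R).
  have [[k _ Fkx]|nF] := pselect ((\bigcup_k F k) x).
    rewrite [X in _ --> X]indicE mem_set; last by exists k.
    apply: cvg_near_cst; exists k.+1 => // j /= kj.
    rewrite indicE mem_set//; rewrite /G.
    by rewrite -bigcup_mkord; exists k.
  rewrite [X in _ --> X]indicE memNset//.
  apply: cvg_near_cst; apply: nearW => j.
  rewrite indicE memNset// /G -bigcup_mkord => -[i _ Fi].
  by apply: nF; exists i.
apply: (L1_approx_dominated _ aG _ cG).
  apply: (@measurable_fun_cvg _ _ R setT (fun k => \1_(G k))) => //.
  by move=> k; case: (aG k).
by move=> k x; rewrite indicE; case: (_ \in _); rewrite ?normr1 ?normr0.
Qed.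

Lemma approximable_ray (i : 'I_n) (a : R) : approximable [set x | a < x ord0 i].
Proof.
(* The ramp min(1, max(0, k (x_i - a))), which converges to the indicator; the minimum is written
   through maxima and the factor -1, for which stability is available. *)
pose g (k : nat) (x : 'rV[R]_n) : R :=
  (- 1) * Num.max (- 1) ((- 1) * Num.max 0 (k%:R * (x ord0 i + (- a)))).
have lg k : lipschitz_rV (g k).
  apply: lipschitz_rVZ; apply: lipschitz_rV_max; first exact: lipschitz_rV_cst.
  apply: lipschitz_rVZ; apply: lipschitz_rV_max; first exact: lipschitz_rV_cst.
  apply: lipschitz_rVZ; apply: lipschitz_rVD; last exact: lipschitz_rV_cst.
  exact: lipschitz_rV_coord.
have gE k x : g k x = Num.min 1 (Num.max 0 (k%:R * (x ord0 i - a))).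
  rewrite /g /Num.min !mulN1r; move: (Num.max 0 _) => b.
  rewrite /Num.max ltrN2.
  by case: ifPn; rewrite -?leNgt => h; case: ifPn; rewrite -?leNgt => h'; lra.
have mA : measurable [set x : 'rV[R]_n | a < x ord0 i].
  rewrite -[X in measurable X]setTI.
  have := measurable_fun_ltr (@measurable_cst _ _ 'rV[R]_n _ setT a) (measurable_coord_rV i).
  by move=> /(_ measurableT [set true]); apply.
apply: (@L1_approx_dominated g); first exact: measurable_indic.
- by move=> k; exact: L1_approx_lipschitz.
- move=> k x; rewrite gE ger0_norm; first by rewrite ge_min lexx.
  by rewrite le_min ler01 le_max lexx.
- move=> x; rewrite indicE; have [ax|xa] := ltP a (x ord0 i).
    rewrite mem_set//; apply: cvg_near_cst.
    have xa0 : 0 < (x ord0 i - a)^-1 by rewrite invr_gt0 subr_gt0.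
    exists (Num.trunc (x ord0 i - a)^-1).+1 => // k /= kN.
    have k1 : 1 <= k%:R * (x ord0 i - a).
      rewrite -ler_pdivrMr ?subr_gt0// div1r ltW// (lt_le_trans (truncnS_gt _))//.
      by rewrite ler_nat.
    by rewrite gE max_r ?min_l// (le_trans ler01).
  rewrite memNset/=; last by apply/negP; rewrite -leNgt.
  apply: cvg_near_cst; apply: nearW => k; rewrite gE.
  have k0 : k%:R * (x ord0 i - a) <= 0 by rewrite mulr_ge0_le0// subr_le0.
  by rewrite max_l// min_r// ler01.
Qed.

(** Two generations are unfolded: the sigma-algebra on rows by preimages under coordinates, then the
    one on the line by half-open intervals, each the difference of two rays. *)
Lemma approximable_measurable A : measurable A -> approximable A.
Proof.
have sigA : sigma_algebra setT approximable.
  split; first exact: approximable0.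
    by move=> B aB; rewrite setTD; exact: approximableC.
  exact: approximable_bigcup.
move: A; apply: (smallest_sub sigA) => A.
rewrite -bigcup_seq => -[i _ [B mB <-]]; rewrite setTI.
have sigB : sigma_algebra setT [set B : set R |
    approximable ((fun x : 'rV[R]_n => x ord0 i) @^-1` B)].
  split => /=; first by rewrite preimage_set0; exact: approximable0.
    by move=> C aC; rewrite setTD preimage_setC; exact: approximableC.
  by move=> F aF; rewrite preimage_bigcup; exact: approximable_bigcup.
apply: (smallest_sub sigB _ mB) => _ [[a b] _ <-] /=.
rewrite (_ : _ @^-1` _ = [set x : 'rV[R]_n | a < x ord0 i] `&`
    ~` [set x : 'rV[R]_n | b < x ord0 i]); last first.
  apply/seteqP; split=> x /=; rewrite in_itv/= leNgt.
    by move=> /andP[h /negP].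
  by move=> [h /negP nh]; rewrite h.
rewrite -[X in approximable X]setCK setCI setCK; apply: approximableC.
by apply: approximableU; [apply: approximableC|]; exact: approximable_ray.
Qed.

Import HBSimple.

Lemma L1_approx_integrable f : measurable_fun setT f ->
  mu.-integrable D (EFin \o f) -> L1_approx f.
Proof.
move=> mf intf; have [g_ [intg _ gl1]] := approximation_sfun_integrable mD intf.
apply: (@L1_approx_lim (fun k x => g_ k x) f mf).
  move=> k; move: (g_ k) => g.
  rewrite (_ : (g : _ -> R) = fun x => \sum_(y <- finmap.enum_fset (fset_set (range g)))
      y * \1_(g @^-1` [set y]) x); last first.
    by apply/funext => x; rewrite [LHS]fimfunE fsbig_finite.
  elim: (finmap.enum_fset _) => [|y s IH].
    under eq_fun do rewrite big_nil.
    by apply: L1_approx_lipschitz; exact: lipschitz_rV_cst.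
  under eq_fun do rewrite big_cons.
  apply: L1_approxD => //; apply: L1_approxZ.
  exact: approximable_measurable.
move=> eta eta0.
move: gl1 => /fine_cvgP[fin /cvgrPdist_le/(_ _ eta0) le_eta].
have [N _ /(_ N (leqnn N))[finN]] := filterI fin le_eta.
rewrite /= sub0r normrN => etaN; exists N.
have finN' : (\int[mu]_(x in D) `|(EFin \o f) x - (g_ N x)%:E|)%E \is a fin_num by [].
rewrite -(fineK finN') lee_fin; exact: le_trans (ler_norm _) etaN.
Qed.

Lemma lipschitz_rV_clamp (M : R) g : lipschitz_rV g ->
  lipschitz_rV (fun x => clamp M (g x)).
Proof.
move=> [mg [L L0 gL]]; split.
  apply: measurable_maxr => //; apply: measurableT_comp => //.
  by apply: measurable_maxr => //; exact: measurableT_comp.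
by exists L => // x y; apply: le_trans (clamp_lipschitz _ _ _) (gL x y).
Qed.

Lemma L2_clamp_small f (eta : R) : measurable_fun setT f -> L2 mu D f -> 0 < eta ->
  exists k : nat, (\int[mu]_(x in D) ((f x - clamp k%:R (f x)) ^+ 2)%:E <= eta%:E)%E.
Proof.
move=> mf [_ f2] eta0.
have mc k : measurable_fun setT (fun x => clamp k%:R (f x)).
  apply: measurable_maxr => //; apply: measurableT_comp => //.
  by apply: measurable_maxr => //; exact: measurableT_comp.
have mdc k : measurable_fun D (fun x => ((f x - clamp k%:R (f x)) ^+ 2)%:E).
  apply/measurable_EFinP; apply: measurable_funTS; apply: measurable_funX.
  exact: measurable_funB.
have [] := @dominated_convergence _ _ _ mu D mD
  (fun k x => ((f x - clamp k%:R (f x)) ^+ 2)%:E) (cst 0%E)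
  (fun x => (f x ^+ 2)%:E).
- exact: mdc.
- exact: measurable_cst.
- apply: aeW => x _; apply: cvg_near_cst.
  exists (Num.trunc `|f x|).+1 => // k /= kN.
  rewrite clamp_id ?subrr ?expr0n// ltW// (lt_le_trans (truncnS_gt _))//.
  by rewrite ler_nat.
- exact: f2.
- apply: aeW => x k _; rewrite lee_fin ger0_norm ?sqr_ge0//.
  rewrite -real_normK ?num_real// -[leRHS]real_normK ?num_real//.
  by rewrite lerXn2r ?nnegrE// norm_subr_clamp_le.
move=> _ _; rewrite integral0 => /fine_cvgP[fin /cvgrPdist_le/(_ _ eta0) le_eta].
have [N _ /(_ N (leqnn N))[finN]] := filterI fin le_eta.
rewrite /= sub0r normrN => etaN; exists N.
have finN' : (\int[mu]_(x in D) ((f x - clamp N%:R (f x)) ^+ 2)%:E)%E \is a fin_num by [].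
rewrite -(fineK finN') lee_fin; exact: le_trans (ler_norm _) etaN.
Qed.

(** Clamping u costs eta / 4 in squared L2 norm. The clamped function f is approximated in L1 by a
    Lipschitz g, which is clamped at M in turn; both are then bounded by M, so their squared
    difference is at most 2 M |f - g|. The two errors combine through (a + b)^2 <= 2 a^2 + 2 b^2. *)
Lemma lipschitz_dense_L2 u (eta : R) : measurable_fun setT u -> L2 mu D u ->
  0 < eta -> exists v, lipschitz_rV v /\
  (\int[mu]_(x in D) ((v x - u x) ^+ 2)%:E <= eta%:E)%E.
Proof.
move=> mu_ u2 eta0.
have eta40 : 0 < eta / 4 by rewrite divr_gt0.
have [k Hk] := L2_clamp_small mu_ u2 eta40.
(* The 1 makes M positive, since the L1 tolerance is divided by 2 M. *)
pose M : R := k%:R + 1.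
have M0 : 0 < M by rewrite ltr_wpDl.
pose f x := clamp k%:R (u x).
have mf : measurable_fun setT f.
  apply: measurable_maxr => //; apply: measurableT_comp => //.
  by apply: measurable_maxr => //; exact: measurableT_comp.
have fk x : `|f x| <= M.
  by apply: le_trans (norm_clamp_le _ _) _ => //; rewrite lerDl.
have intf : mu.-integrable D (EFin \o f).
  by apply: (@integrable_bounded _ _ _ _ D f M) => //; exact: measurable_funTS.
have [_ approx] := L1_approx_integrable mf intf.
have e0 : 0 < eta / 4 / (2 * M) by rewrite divr_gt0// mulr_gt0.
have [g [lg Hg]] := approx _ e0.
exists (fun x => clamp M (g x)); split; first exact: lipschitz_rV_clamp.
have [mv _] := lipschitz_rV_clamp M lg.
have [mg _] := lg.
have m1 : measurable_fun D (fun x => ((clamp M (g x) - f x) ^+ 2)%:E).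
  apply/measurable_EFinP; apply: measurable_funTS; apply: measurable_funX.
  exact: measurable_funB.
have m2 : measurable_fun D (fun x => ((u x - f x) ^+ 2)%:E).
  apply/measurable_EFinP; apply: measurable_funTS; apply: measurable_funX.
  exact: measurable_funB.
have m3 : measurable_fun D (fun x => (`|f x - g x|)%:E).
  apply/measurable_EFinP; apply: measurable_funTS.
  by apply: measurableT_comp => //; exact: measurable_funB.
have I1 : (\int[mu]_(x in D) ((clamp M (g x) - f x) ^+ 2)%:E <= (eta / 4)%:E)%E.
  apply: (@le_trans _ _ (\int[mu]_(x in D) ((2 * M)%:E * (`|f x - g x|)%:E))%E).
    apply: ge0_le_integral_nomeas => x _; first by rewrite lee_fin sqr_ge0.
    rewrite -EFinM lee_fin -real_normK ?num_real// expr2 ler_pM//.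
      apply: le_trans (ler_normB _ _) _; rewrite mulr2n mulrDl mul1r lerD//.
      by rewrite norm_clamp_le// ltW.
    rewrite distrC -{1}(clamp_id (fk x)); exact: clamp_lipschitz.
  rewrite ge0_integralZl_EFin//; last by rewrite mulr_ge0// ltW.
  apply: (@le_trans _ _ ((2 * M)%:E * (eta / 4 / (2 * M))%:E)%E).
    by rewrite lee_wpmul2l// lee_fin mulr_ge0// ltW.
  by rewrite -EFinM lee_fin mulrC divfK// gt_eqF// mulr_gt0.
apply: (@le_trans _ _ (\int[mu]_(x in D) (2%:E * ((clamp M (g x) - f x) ^+ 2)%:E +
    2%:E * ((u x - f x) ^+ 2)%:E))%E).
  apply: ge0_le_integral_nomeas => x _; first by rewrite lee_fin sqr_ge0.
  rewrite -!EFinM -EFinD lee_fin -subr_ge0.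
  rewrite (_ : _ - _ = (clamp M (g x) + u x - 2 * f x) ^+ 2) ?sqr_ge0//; ring.
rewrite ge0_integralD//; last 4 first.
- by move=> x _; rewrite -EFinM lee_fin mulr_ge0// sqr_ge0.
- exact: measurable_funeM.
- by move=> x _; rewrite -EFinM lee_fin mulr_ge0// sqr_ge0.
- exact: measurable_funeM.
rewrite !ge0_integralZl_EFin//; last 2 first.
- by move=> x _; rewrite lee_fin sqr_ge0.
- by move=> x _; rewrite lee_fin sqr_ge0.
apply: (@le_trans _ _ (2%:E * (eta / 4)%:E + 2%:E * (eta / 4)%:E)%E).
  by apply: leeD; rewrite lee_wpmul2l.
by rewrite -!EFinM -EFinD lee_fin; lra.
Qed.

End lipschitz_density.

(** Only g has to be nonnegative: the integral of f is at most that of its positive part. It serves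
    for the signed affine expression in v of the lower bound. *)
Lemma integral_le_pos {R : realType} {d} {T : measurableType d}
    (mu : {measure set T -> \bar R}) (D : set T) (f g : T -> \bar R) :
  (forall x, D x -> (0 <= g x)%E) -> (forall x, D x -> (f x <= g x)%E) ->
  (\int[mu]_(x in D) f x <= \int[mu]_(x in D) g x)%E.
Proof.
move=> g0 fg; rewrite integralE.
apply: (@le_trans _ _ (\int[mu]_(x in D) f^\+ x)%E).
  by rewrite -[leRHS]adde0 leeD2l// oppe_le0 integral_ge0.
apply: ge0_le_integral_nomeas => x Dx; first exact: funepos_ge0.
by rewrite funeposE ge_max fg// g0.
Qed.

(** * Lower bound *)

Section antisymmetric_pairing.
Context {R : realType} {d} {T : measurableType d}.
Variables (mu : {sigma_finite_measure set T -> \bar R}) (X : set T).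
Hypotheses (mX : measurable X) (Xoo : (mu X < +oo)%E).
Variables (c : T * T -> R) (M : R).
Hypotheses (mc : measurable_fun setT c) (cM : forall w, `|c w| <= M).
Hypothesis c_antisym : forall x y, c (y, x) = - c (x, y).

(** The test function for the weak convergence: integrating c in one variable reduces a pairing with
    v x - v y to a single integral of v. *)
Definition marginal (x : T) : R := \int[mu]_(y in X) c (x, y).

Let mXX : measurable (X `*` X). Proof. exact: measurableX. Qed.

Lemma measurable_fst_in (v : T -> R) : measurable_fun X v ->
  measurable_fun (X `*` X) (fun w => v w.1).
Proof.
move=> mv; apply: (measurable_comp (F := X) (f := v) (g := fst)) => //.
  by move=> _ [w [Xw _] <-].
exact: measurable_funTS.
Qed.

Lemma measurable_snd_in (v : T -> R) : measurable_fun X v ->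
  measurable_fun (X `*` X) (fun w => v w.2).
Proof.
move=> mv; apply: (measurable_comp (F := X) (f := v) (g := snd)) => //.
  by move=> _ [w [_ Xw] <-].
exact: measurable_funTS.
Qed.

Let mc1 x : measurable_fun X (fun y => c (x, y)).
Proof.
apply: measurable_funTS; apply: (measurableT_comp mc (g := fun y => (x, y))).
exact: measurable_fun_pair.
Qed.

Let ic1 x : mu.-integrable X (fun y => (c (x, y))%:E).
Proof. exact: integrable_bounded (mc1 x) _. Qed.

Let marginalZ a x : a * marginal x = \int[mu]_(y in X) (a * c (x, y)).
Proof. by rewrite RintegralZl//; exact: ic1. Qed.

Lemma marginal_L2 : L2 mu X marginal.
Proof.
have mm : measurable_fun X marginal.
  by apply: measurable_Rintegral_in => //; exact: measurable_funTS.
split=> //.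
have mM x : `|marginal x| <= M * fine (mu X).
  apply: le_trans (le_normr_Rintegral mX (ic1 x)) _.
  rewrite -Rintegral_cst//; apply: le_Rintegral => //.
  - exact: (integrable_abse (ic1 x)).
  - by apply: (@integrable_bounded _ _ _ _ X (cst M) `|M|).
apply: (@integrable_bounded _ _ _ _ X (fun x => marginal x ^+ 2) ((M * fine (mu X)) ^+ 2)) => //.
  exact: measurable_funX.
move=> x _; rewrite ger0_norm ?sqr_ge0// -real_normK ?num_real//.
by rewrite lerXn2r ?nnegrE// (le_trans _ (mM x)).
Qed.

(** By Fubini, the terms in v x and in - v y each contribute the integral of v times the marginal,
    antisymmetry restoring the sign of the second. The factor 2 makes 4. *)
Lemma antisymmetric_pairing (v : T -> R) : L2 mu X v ->
  (\int[mu \x mu]_(w in X `*` X) (2 * (v w.1 - v w.2) * c w)%:E =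
   (4 * \int[mu]_(x in X) (v x * marginal x))%:E)%E.
Proof.
move=> v2; have [mv _] := v2.
have iv := L2_integrable mX Xoo v2.
have M0 : 0 <= M by apply: le_trans (cM (point, point)).
have mcX : measurable_fun (X `*` X) c by exact: measurable_funTS.
have i1 : (mu \x mu)%E.-integrable (X `*` X) (fun w => (v w.1 * c w)%:E).
  apply/integrableP; split.
    by apply/measurable_EFinP; apply: measurable_funM => //; exact: measurable_fst_in.
  apply: (@le_lt_trans _ _ (\int[mu \x mu]_(w in X `*` X) (`|v w.1| * M)%:E)%E).
    apply: ge0_le_integral_nomeas => w _ //=.
    by rewrite lee_fin normrM ler_wpM2l.
  rewrite -(@tonelli_in _ _ _ _ _ mu mu X X mX mX (fun w => (`|v w.1| * M)%:E)); last 2 first.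
  - apply/measurable_EFinP; apply: measurable_funM => //.
    by apply: measurableT_comp => //; exact: measurable_fst_in.
  - by move=> w _; rewrite lee_fin mulr_ge0.
  apply: (@le_lt_trans _ _ (\int[mu]_(x in X) ((`|v x|)%:E * (M%:E * mu X)))%E).
    apply: ge0_le_integral_nomeas => x _.
      by apply: integral_ge0 => y _; rewrite lee_fin mulr_ge0.
    by rewrite /= integral_cst// EFinM muleA.
  rewrite ge0_integralZr//; last 2 first.
  - by apply/measurable_EFinP; apply: measurableT_comp.
  - by rewrite mule_ge0.
  rewrite lte_mul_pinfty//.
  - exact: integral_ge0.
  - rewrite ge0_fin_numE ?integral_ge0//.
    by case/integrableP: iv.
  - by rewrite lte_mul_pinfty.
have i2 : (mu \x mu)%E.-integrable (X `*` X) (fun w => (- (v w.2 * c w))%:E).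
  apply/integrableP; split.
    apply/measurable_EFinP; apply: measurableT_comp => //.
    by apply: measurable_funM => //; exact: measurable_snd_in.
  apply: (@le_lt_trans _ _ (\int[mu \x mu]_(w in X `*` X) (`|v w.2| * M)%:E)%E).
    apply: ge0_le_integral_nomeas => w _ //=.
    by rewrite lee_fin normrN normrM ler_wpM2l.
  rewrite -(@tonelli_in_sym _ _ _ _ _ mu mu X X mX mX (fun w => (`|v w.2| * M)%:E)); last 2 first.
  - apply/measurable_EFinP; apply: measurable_funM => //.
    by apply: measurableT_comp => //; exact: measurable_snd_in.
  - by move=> w _; rewrite lee_fin mulr_ge0.
  apply: (@le_lt_trans _ _ (\int[mu]_(x in X) ((`|v x|)%:E * (M%:E * mu X)))%E).
    apply: ge0_le_integral_nomeas => x _.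
      by apply: integral_ge0 => y _; rewrite lee_fin mulr_ge0.
    by rewrite /= integral_cst// EFinM muleA.
  rewrite ge0_integralZr//; last 2 first.
  - by apply/measurable_EFinP; apply: measurableT_comp.
  - by rewrite mule_ge0.
  rewrite lte_mul_pinfty//.
  - exact: integral_ge0.
  - rewrite ge0_fin_numE ?integral_ge0//.
    by case/integrableP: iv.
  - by rewrite lte_mul_pinfty.
have [_ m2] := marginal_L2; have [mm _] := marginal_L2.
have ivm : mu.-integrable X (fun x => (v x * marginal x)%:E).
  have iq : mu.-integrable X (fun x => (v x ^+ 2 + marginal x ^+ 2)%:E).
    by have := integrableD mX v2.2 m2.
  apply: (integrable_dom mX _ iq); first exact: measurable_funM.
  move=> x _; rewrite normrM -(@real_normK _ (v x)) ?num_real//.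
  rewrite -(@real_normK _ (marginal x)) ?num_real//.
  have := sqr_ge0 (`|v x| - `|marginal x|); have := normr_ge0 (v x).
  by have := normr_ge0 (marginal x); nra.
have e1 : (\int[mu \x mu]_(w in X `*` X) (v w.1 * c w)%:E =
    (\int[mu]_(x in X) (v x * marginal x))%R%:E)%E.
  rewrite -(fubini_in mX mX i1) integral_EFin_fineK//.
  apply: eq_integral => x _ /=.
  rewrite (marginalZ (v x) x) integral_EFin_fineK//.
  exact: (integrableZl mX (v x) (ic1 x)).
have e2 : (\int[mu \x mu]_(w in X `*` X) (- (v w.2 * c w))%:E =
    (\int[mu]_(x in X) (v x * marginal x))%R%:E)%E.
  rewrite -(fubini_in_sym mX mX i2) integral_EFin_fineK//.
  apply: eq_integral => y _ /=.
  rewrite (marginalZ (v y) y) integral_EFin_fineK//; last first.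
    exact: (integrableZl mX (v y) (ic1 y)).
  by apply: eq_integral => x _; rewrite c_antisym mulrN opprK.
transitivity (2%:E * (\int[mu \x mu]_(w in X `*` X) ((v w.1 * c w)%:E + (- (v w.2 * c w))%:E)))%E.
  rewrite -integralZl//; last exact: integrableD.
  by apply: eq_integral => w _; rewrite -EFinD -EFinM; congr EFin; ring.
by rewrite integralD// e1 e2 -EFinD -EFinM; congr EFin; ring.
Qed.

End antisymmetric_pairing.

(** * Rescaling of the vertical variable *)

Section scaling.
Context {R : realType}.
Local Open Scope ereal_scope.

(** Uniqueness of Lebesgue measure: eps times the image measure agrees with it on half-open
    intervals. *)
Lemma lebesgue_measure_scale (eps : R) (A : set (measurableTypeR R)) :
  (0 < eps)%R -> measurable A ->
  lebesgue_measure A = eps%:E * lebesgue_measure (( *%R eps) @^-1` A).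
Proof.
move=> e0 mA.
have me : measurable_fun setT (( *%R eps) : measurableTypeR R -> measurableTypeR R).
  exact: measurable_funM.
have e0' : (0 <= eps)%R by exact: ltW.
pose nu := mscale (NngNum e0')
  (measure_function_pushforward__canonical__measure_function_Measure
    (@lebesgue_measure R) me).
rewrite (@lebesgue_measure_unique R nu)// => _ [[a b] _ <-].
have E : ( *%R eps) @^-1` `]a, b]%classic = `](a / eps)%R, (b / eps)%R]%classic.
  apply/seteqP; split=> t /=; rewrite !in_itv/=.
    by rewrite ltr_pdivrMr// ler_pdivlMr// ![(t * eps)%R]mulrC.
  by rewrite ltr_pdivrMr// ler_pdivlMr// ![(t * eps)%R]mulrC.
transitivity (eps%:E * lebesgue_measure
    (`](a / eps)%R, (b / eps)%R]%classic : set (measurableTypeR R))).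
  2: by rewrite -E.
rewrite !lebesgue_measure_itv/= !lte_fin ltr_pM2r ?invr_gt0//.
case: ifPn => _; last by rewrite mule0.
by rewrite -!EFinD -EFinM -mulrBl mulrC divfK// gt_eqF.
Qed.

Lemma integral_scale (eps : R) (f : measurableTypeR R -> \bar R) : (0 < eps)%R ->
  measurable_fun `]0%R, eps[ f -> (forall t, `]0%R, eps[%classic t -> 0 <= f t) ->
  \int[lebesgue_measure]_(t in `]0%R, eps[) f t =
  eps%:E * \int[lebesgue_measure]_(t in `]0%R, 1%R[) f (eps * t)%R.
Proof.
move=> e0 mf f0.
have me : measurable_fun setT (( *%R eps) : measurableTypeR R -> measurableTypeR R).
  exact: measurable_funM.
have e0' : (0 <= eps)%R by exact: ltW.
have mI (b : R) : measurable (`]0%R, b[%classic : set (measurableTypeR R)) by exact: measurable_itv.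
pose nu := measure_function_pushforward__canonical__measure_function_Measure
    (@lebesgue_measure R) me.
rewrite (@eq_measure_integral _ _ _ _ (mscale (NngNum e0') nu)); last first.
  by move=> A mA _; exact: lebesgue_measure_scale.
rewrite ge0_integral_mscale//=; congr (_ * _).
rewrite ge0_integral_pushforward//; last by move=> t /set_mem; exact: f0.
have -> : ( *%R eps) @^-1` `]0%R, eps[ = `]0%R, 1%R[%classic.
  apply/seteqP; split=> t /=; rewrite !in_itv/=.
    by rewrite pmulr_rgt0// gtr_pMr.
  by rewrite pmulr_rgt0// gtr_pMr.
by [].
Qed.

Section thin_sets.
Context {n : nat} (omega : set 'rV[R]_n).
Hypothesis momega : measurable omega.
Local Notation Rd := ('rV[R]_n * measurableTypeR R)%type.
Local Notation lRd := (lebesgue_pair (lebesgue_rV n)).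
Local Notation thin := (@thin R n.+1 omega).

Let mI (b : R) : measurable (`]0%R, b[%classic : set (measurableTypeR R)).
Proof. exact: measurable_itv. Qed.

Lemma measurable_thin eps : measurable (thin eps : set Rd).
Proof. exact: measurableX. Qed.

Lemma thin_tonelli eps (f : Rd -> \bar R) : measurable_fun (thin eps) f ->
  (forall x, thin eps x -> 0 <= f x) ->
  \int[lRd]_(x in thin eps) f x =
  \int[lebesgue_rV n]_(x in omega) \int[lebesgue_measure]_(t in `]0%R, eps[) f (x, t).
Proof.
move=> mf f0.
by rewrite (@tonelli_in _ _ _ _ _ (lebesgue_rV n) lebesgue_measure omega `]0%R, eps[%classic).
Qed.

Lemma integral_thin_scale eps (f : Rd -> \bar R) : (0 < eps)%R ->
  measurable_fun (thin eps) f -> (forall x, thin eps x -> 0 <= f x) ->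
  \int[lRd]_(x in thin eps) f x =
  eps%:E * \int[lRd]_(x in thin 1%R) f (x.1, (eps * x.2)%R).
Proof.
move=> e0 mf f0; rewrite thin_tonelli//.
have sub x : thin 1%R x -> thin eps (x.1, (eps * x.2)%R).
  move=> [ox] /=; rewrite !in_itv/= => /andP[t0 t1]; split => //=.
  by rewrite in_itv/= mulr_gt0//= gtr_pMr.
have mS : measurable_fun setT (fun x : Rd => (x.1, (eps * x.2)%R) : Rd).
  apply: measurable_fun_pair => //=.
  by apply: measurable_funM => //; exact: measurableT_comp.
have mfS : measurable_fun (thin 1%R) (fun x => f (x.1, (eps * x.2)%R)).
  apply: (measurable_comp (F := thin eps) (f := f) (g := fun x : Rd => (x.1, (eps * x.2)%R))) => //.
  - exact: measurable_thin.
  - by move=> _ [x /sub h <-].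
  - exact: measurable_funTS.
rewrite thin_tonelli//; last by move=> x /sub; exact: f0.
rewrite -ge0_integralZl_EFin//; last 3 first.
- by move=> x ox; apply: integral_ge0 => t /= t01; apply: f0; exact: (@sub (x, t) (conj ox t01)).
- apply: (@measurable_tonelli_in _ _ _ _ _ lebesgue_measure omega `]0%R, 1%R[%classic momega (mI 1)
    (fun x => f (x.1, (eps * x.2)%R))) => //.
  by move=> x /sub; exact: f0.
- exact: ltW.
apply: eq_integral => x /set_mem ox; rewrite integral_scale//.
- apply: (measurable_comp (F := thin eps) (f := f)
    (g := fun t : measurableTypeR R => (x, t))) => //.
  + exact: measurable_thin.
  + by move=> _ [t /= t01 <-].
  + by apply: measurable_funTS; exact: measurable_fun_pair.
- by move=> t t01; apply: f0; split.
Qed.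

Lemma integral_thin_fst eps (f : 'rV[R]_n -> \bar R) : (0 < eps)%R ->
  measurable_fun omega f -> (forall x, omega x -> 0 <= f x) ->
  \int[lRd]_(x in thin eps) f x.1 = eps%:E * \int[lebesgue_rV n]_(x in omega) f x.
Proof.
move=> e0 mf f0; rewrite thin_tonelli; last 2 first.
- apply: (measurable_comp (F := omega) (f := f) (g := fst)) => //.
    by move=> _ [w [ow _] <-].
  by apply: measurable_funTS; exact: measurable_fst.
- by move=> x [ox _]; exact: f0.
rewrite -ge0_integralZl_EFin ?(ltW e0)//.
apply: eq_integral => x /set_mem ox /=.
rewrite integral_cst//.
have E : lebesgue_measure (`]0%R, eps[%classic : set R) = eps%:E.
  by rewrite lebesgue_measure_itv/= lte_fin e0 oppr0 adde0.
by transitivity (f x * lebesgue_measure (`]0%R, eps[%classic : set R)) => //; rewrite E muleC.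
Qed.

Lemma integral_thin_fst2 (f : 'rV[R]_n * 'rV[R]_n -> R) :
  measurable_fun setT f -> (forall w, (0 <= f w)%R) ->
  \int[lRd]_(x in thin 1%R) \int[lRd]_(y in thin 1%R) (f (x.1, y.1))%:E =
  \int[lebesgue_rV n]_(x in omega) \int[lebesgue_rV n]_(y in omega) (f (x, y))%:E.
Proof.
move=> mf f0.
pose F x := \int[lebesgue_rV n]_(y in omega) (f (x, y))%:E.
have inner x : \int[lRd]_(y in thin 1%R) (f (x, y.1))%:E = F x.
  apply: etrans; last exact: mul1e.
  apply: (integral_thin_fst (f := fun y => (f (x, y))%:E)); first exact: ltr01.
    apply/measurable_EFinP; apply: measurable_funTS.
    apply: (measurableT_comp mf (g := fun y => (x, y))).
    exact: measurable_fun_pair.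
  by move=> y _; rewrite lee_fin.
transitivity (\int[lRd]_(x in thin 1%R) F x.1).
  by apply: eq_integral => x _; exact: inner.
apply: etrans; last exact: mul1e.
apply: (integral_thin_fst (f := F)); first exact: ltr01.
  have mfD : measurable_fun (omega `*` omega) (EFin \o f).
    by apply/measurable_EFinP; exact: measurable_funTS.
  apply: (@measurable_tonelli_in _ _ _ _ _ (lebesgue_rV n) omega omega momega momega _ mfD).
  by move=> w _; rewrite lee_fin.
by move=> x _; apply: integral_ge0 => y _; rewrite lee_fin.
Qed.

End thin_sets.

End scaling.

(** * Comparison of the thin kernel with the limit kernel *)

Section kernel_comparison.
Context {R : realType}.

Lemma powR_base_near1 (p e : R) : 0 < p -> 0 < e -> exists2 delta : R, 0 < delta &
  forall x, 0 <= x <= delta -> (1 + x) `^ p <= 1 + e.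
Proof.
move=> p0 e0; have e1 : 0 <= 1 + e by rewrite addr_ge0// ltW.
have pi0 : 0 < p^-1 by rewrite invr_gt0.
exists ((1 + e) `^ p^-1 - 1).
  rewrite subr_gt0; have : 1 `^ p^-1 < (1 + e) `^ p^-1.
    by apply: gt0_ltr_powR; rewrite ?nnegrE ?ltrDl.
  by rewrite powR1.
move=> x /andP[x0]; rewrite lerBrDl => xd.
apply: (@le_trans _ _ (((1 + e) `^ p^-1) `^ p)).
  by rewrite ge0_ler_powR ?nnegrE ?powR_ge0 ?(ltW p0)// addr_ge0.
by rewrite -powRrM mulVf ?gt_eqF// powRr1.
Qed.

(** Here D is the distance in the squeezed cylinder and r that of the projections. From D <= r + eps
    <= r (1 + eps / delta), the thickness costs a factor 1 + lam, and replacing p by p0 costs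
    another, uniformly for r between delta and diam. *)
Lemma thin_kernel_le (p0 delta diam Lam : R) : 0 < p0 -> 0 < delta -> 1 < Lam ->
  exists2 d : R, 0 < d & forall p eps r D : R, `|p - p0| <= d -> 0 < eps <= d ->
  delta <= r <= diam -> 0 <= D -> D ^+ 2 <= r ^+ 2 + eps ^+ 2 ->
  D `^ p <= Lam * r `^ p0.
Proof.
move=> p00 delta0 Lam1.
(* For lam <= 1, (1 + lam)^2 <= 1 + 3 lam <= Lam. *)
pose lam := Num.min 1 ((Lam - 1) / 3).
have lam0 : 0 < lam by rewrite lt_min ltr01 divr_gt0// subr_gt0.
have lam1 : lam <= 1 by rewrite ge_min lexx.
have lam3 : lam <= (Lam - 1) / 3 by rewrite ge_min lexx orbT.
have lam_sqr : (1 + lam) * (1 + lam) <= Lam by nra.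
pose M := 1 + `|diam| + delta^-1.
have M1 : 1 <= M by rewrite /M -addrA lerDl addr_ge0// invr_ge0 ltW.
have [d1 d10 Hd1] := powR_le_near0 M1 lam0.
have p20 : 0 < 2 * p0 by rewrite mulr_gt0.
have [d2 d20 Hd2] := powR_base_near1 p20 lam0.
(* The bound p0 / 2 keeps p positive and at most 2 p0, the exponent at which d2 was chosen; d2 *
   delta gives eps / delta <= d2. *)
exists (Num.min d1 (Num.min (p0 / 2) (d2 * delta))).
  by rewrite !lt_min d10 divr_gt0// mulr_gt0.
move=> p eps r D; rewrite !le_min => /and3P[pd1 pd2 _] /andP[eps0 /and3P[_ _ epsd]].
move=> /andP[dr rdiam] D0 Dr.
have r0 : 0 < r by exact: lt_le_trans dr.
have p_gt0 : 0 < p by move: pd2; rewrite ler_norml => /andP[h _]; lra.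
have p_le : p <= 2 * p0 by move: pd2; rewrite ler_norml => /andP[_ h]; lra.
have ed0 : 0 <= eps / delta by rewrite divr_ge0// ltW.
have Dle : D <= r * (1 + eps / delta).
  apply: (@le_trans _ _ (r + eps)).
    rewrite -(@ler_pXn2r _ 2) ?nnegrE ?addr_ge0 ?(ltW r0) ?(ltW eps0)//.
    apply: le_trans Dr _; have := mulr_gt0 r0 eps0; rewrite sqrrD; lra.
  by rewrite mulrDr mulr1 lerD2l mulrCA ler_peMr ?(ltW eps0)// ler_pdivlMr// mul1r.
apply: (@le_trans _ _ ((r * (1 + eps / delta)) `^ p)).
  by rewrite ge0_ler_powR ?nnegrE ?(ltW p_gt0)// mulr_ge0 ?(ltW r0)// addr_ge0.
rewrite powRM ?(ltW r0) ?addr_ge0//.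
have h1 : r `^ p <= (1 + lam) * r `^ p0.
  have rM : r <= M.
    apply: le_trans rdiam _; apply: le_trans (ler_norm _) _.
    by rewrite /M addrAC lerDr addr_ge0// invr_ge0 ltW.
  have rVM : r^-1 <= M.
    apply: (@le_trans _ _ delta^-1); first by rewrite lef_pV2.
    by rewrite lerDr addr_ge0.
  (* Negated exponents turn the bound on inverse powers into one on powers. *)
  have := @invr_powR_le _ r (- p) (- p0) M r0 rM rVM.
  rewrite !powRN !invrK opprK => H; apply: le_trans H _.
  by rewrite ler_wpM2r ?powR_ge0// Hd1// addrC distrC.
have h2 : (1 + eps / delta) `^ p <= 1 + lam.
  apply: (@le_trans _ _ ((1 + eps / delta) `^ (2 * p0))).
    by rewrite ler_powR// lerDl.
  by apply: Hd2; rewrite ed0 ler_pdivrMr.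
apply: le_trans (ler_pM (powR_ge0 _ _) (powR_ge0 _ _) h1 h2) _.
by rewrite mulrAC ler_wpM2r ?powR_ge0.
Qed.

Lemma limn_einf_ge (a : \bar R) (f : nat -> \bar R) :
  (\forall j \near \oo, (a <= f j)%E) -> (a <= limn_einf f)%E.
Proof.
move=> [N _ HN]; rewrite limn_einf_lim; apply: lime_ge; first exact: is_cvg_einfs.
exists N => // j /= Nj; apply: le_ereal_inf_tmp => _ [i /= ji <-].
by apply: HN; exact: leq_trans ji.
Qed.

Lemma limn_esup_le (a : \bar R) (f : nat -> \bar R) :
  (\forall j \near \oo, (f j <= a)%E) -> (limn_esup f <= a)%E.
Proof.
move=> [N _ HN]; rewrite limn_esup_lim; apply: lime_le; first exact: is_cvg_esups.
exists N => // j /= Nj; apply: ge_ereal_sup => _ [i /= ji <-].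
by apply: HN; exact: leq_trans ji.
Qed.

End kernel_comparison.

Section thin_energy.
Context {R : realType} {n : nat} (omega : set 'rV[R]_n).
Hypothesis momega : measurable omega.
Local Notation Rd := ('rV[R]_n * measurableTypeR R)%type.
Local Notation lRd := (lebesgue_pair (lebesgue_rV n)).
Local Notation thin := (@thin R n.+1 omega).

Definition squeeze (eps : R) (x : Rd) : Rd := (x.1, eps * x.2).

Lemma measurable_squeeze eps : measurable_fun setT (squeeze eps).
Proof.
apply: measurable_fun_pair => //=.
by apply: measurable_funM => //; exact: measurableT_comp.
Qed.

Lemma squeeze_thin eps x : 0 < eps -> thin 1 x -> thin eps (squeeze eps x).
Proof.
move=> e0 [ox] /=; rewrite !in_itv/= => /andP[t0 t1]; split => //=.
by rewrite in_itv/= mulr_gt0//= gtr_pMr.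
Qed.

Lemma measurable_comp_squeeze eps (u : Rd -> R) : 0 < eps ->
  measurable_fun (thin eps) u -> measurable_fun (thin 1) (fun x => u (squeeze eps x)).
Proof.
move=> e0 mu_; apply: (measurable_comp (F := thin eps) (f := u) (g := squeeze eps)) => //.
- exact: measurable_thin.
- by move=> _ [x /(squeeze_thin e0) h <-].
- by apply: measurable_funTS; exact: measurable_squeeze.
Qed.

(** Each of the two integrations over the cylinder yields a factor eps when rescaled to height 1,
    and together they cancel the normalisation eps^-2. *)
Lemma F_thin_squeeze eps s (u : Rd -> R) : 0 < eps -> measurable_fun (thin eps) u ->
  @F_thin R n.+1 omega eps s u =
  (\int[lRd]_(x in thin 1) \int[lRd]_(y in thin 1)
    ((u (squeeze eps x) - u (squeeze eps y)) ^+ 2 /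
      eucl_dist_pair (squeeze eps x) (squeeze eps y) `^ (n.+1%:R + 2 * s))%:E)%E.
Proof.
move=> e0 mu_.
have mt e : measurable (thin e : set Rd) := measurable_thin momega e.
pose p := n.+1%:R + 2 * s.
pose h (w : Rd * Rd) : R := (u w.1 - u w.2) ^+ 2 / eucl_dist_pair w.1 w.2 `^ p.
have h0 w : 0 <= h w by rewrite divr_ge0 ?powR_ge0 ?sqr_ge0.
have md (S : Rd -> Rd) : measurable_fun setT S ->
    measurable_fun setT (fun w : Rd * Rd => (eucl_dist_pair (S w.1) (S w.2) `^ p)^-1).
  move=> mS; apply: measurable_funV_ge0 => [w _|]; first exact: powR_ge0.
  apply: (measurableT_comp (measurable_powR p)).
  apply: (measurableT_comp (@measurable_eucl_dist_pair R n)
    (g := fun w : Rd * Rd => (S w.1, S w.2))).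
  by apply: measurable_fun_pair; apply: measurableT_comp.
have mh : measurable_fun (thin eps `*` thin eps) (EFin \o h).
  apply/measurable_EFinP; apply: measurable_funM; last first.
    by apply: measurable_funTS; exact: (md id).
  apply: measurable_funX; apply: measurable_funB.
    exact: measurable_fst_in.
  exact: measurable_snd_in.
have mhS : measurable_fun (thin 1 `*` thin 1)
    (fun w => (h (squeeze eps w.1, squeeze eps w.2))%:E).
  apply/measurable_EFinP; apply: measurable_funM; last first.
    by apply: measurable_funTS; exact: (md _ (measurable_squeeze eps)).
  have mv := measurable_comp_squeeze e0 mu_.
  apply: measurable_funX; apply: measurable_funB.
    exact: (measurable_fst_in (mt 1) mv).
  exact: (measurable_snd_in (mt 1) mv).
pose H x := (\int[lRd]_(y in thin 1) (h (squeeze eps x, squeeze eps y))%:E)%E.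
have inner x : thin 1 x ->
    (\int[lRd]_(y in thin eps) (h (squeeze eps x, y))%:E = eps%:E * H x)%E.
  move=> Xx; apply: (@integral_thin_scale R n omega momega eps
    (fun y => (h (squeeze eps x, y))%:E)) => //; last first.
    by move=> y _; rewrite lee_fin.
  apply/measurable_EFinP; apply: measurable_funM; last first.
    apply: measurable_funTS.
    apply: (measurableT_comp (md id _) (g := fun y => (squeeze eps x, y))) => //.
    exact: measurable_fun_pair.
  by apply: measurable_funX; apply: measurable_funB => /=; [exact: measurable_cst|exact: mu_].
have outer : (\int[lRd]_(x in thin eps) \int[lRd]_(y in thin eps) (h (x, y))%:E =
    eps%:E * \int[lRd]_(x in thin 1) (eps%:E * H x))%E.
  apply: etrans.
    apply: (@integral_thin_scale R n omega momega eps
      (fun x => \int[lRd]_(y in thin eps) (h (x, y))%:E)%E e0).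
    - apply: (@measurable_tonelli_in _ _ _ _ _ lRd (thin eps) (thin eps)
        (mt eps) (mt eps) (EFin \o h) mh).
      by move=> w _; rewrite lee_fin.
    - by move=> z _; apply: integral_ge0 => y _; rewrite lee_fin.
  congr (_ * _)%E; apply: eq_integral => z /set_mem Xz; exact: inner.
have mH : measurable_fun (thin 1) H.
  apply: (@measurable_tonelli_in _ _ _ _ _ lRd (thin 1) (thin 1) (mt 1) (mt 1) _ mhS).
  by move=> w _; rewrite lee_fin.
have H0 x : (0 <= H x)%E by apply: integral_ge0 => y _; rewrite lee_fin.
have outer2 : (\int[lRd]_(x in thin 1) (eps%:E * H x) = eps%:E * \int[lRd]_(x in thin 1) H x)%E.
  by rewrite ge0_integralZl_EFin// ltW.
rewrite outer2 in outer.
apply: (@etrans _ _ (((eps ^+ 2)^-1)%:E * (eps%:E * (eps%:E * \int[lRd]_(x in thin 1) H x)))%E).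
  by congr (_ * _)%E.
rewrite !muleA -!EFinM -mulrA -expr2 mulVf ?mul1e// expf_neq0// gt_eqF//.
Qed.

End thin_energy.

(** * Truncation of the limit energy *)

Section truncation.
Context {R : realType} {n : nat} (u : 'rV[R]_n -> R) (p0 : R).
Hypothesis mu_ : measurable_fun setT u.
Hypothesis p00 : 0 < p0.
Local Notation rV2 := ('rV[R]_n * 'rV[R]_n)%type.

(** The cutoff is symmetric in the two points, so that the flux is antisymmetric; its bounds on u
    and on the distance make the flux bounded. *)
Definition trunc_ind (k : nat) (w : rV2) : bool :=
  [&& `|u w.1| <= k%:R, `|u w.2| <= k%:R & k.+1%:R^-1 <= eucl_dist w.1 w.2].

Definition trunc_flux k (w : rV2) : R :=
  (trunc_ind k w)%:R * ((u w.1 - u w.2) / eucl_dist w.1 w.2 `^ p0).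

Definition trunc_energy k (w : rV2) : R :=
  (trunc_ind k w)%:R * ((u w.1 - u w.2) ^+ 2 / eucl_dist w.1 w.2 `^ p0).

Let mkernel : measurable_fun setT (fun w : rV2 => (eucl_dist w.1 w.2 `^ p0)^-1).
Proof.
apply: measurable_funV_ge0 => [w _|]; first exact: powR_ge0.
exact: (measurableT_comp (measurable_powR p0) (@measurable_eucl_dist R n)).
Qed.

Let mdiff : measurable_fun setT (fun w : rV2 => u w.1 - u w.2).
Proof. by apply: measurable_funB; exact: measurableT_comp. Qed.

Lemma measurable_trunc_ind k :
  measurable_fun setT (fun w => (trunc_ind k w)%:R : R).
Proof.
apply: measurable_natr_bool.
apply: measurable_and; first last.
  apply: measurable_and.
    apply: measurable_fun_ler => //; apply: measurableT_comp => //.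
    exact: (measurableT_comp mu_ (g := snd)).
  by apply: measurable_fun_ler => //; exact: measurable_eucl_dist.
apply: measurable_fun_ler => //; apply: measurableT_comp => //.
exact: (measurableT_comp mu_ (g := fst)).
Qed.

Lemma measurable_trunc_flux k : measurable_fun setT (trunc_flux k).
Proof.
apply: measurable_funM; first exact: measurable_trunc_ind.
exact: measurable_funM.
Qed.

Lemma measurable_trunc_energy k : measurable_fun setT (trunc_energy k).
Proof.
apply: measurable_funM; first exact: measurable_trunc_ind.
by apply: measurable_funM => //; exact: measurable_funX.
Qed.

Lemma trunc_energy_ge0 k w : 0 <= trunc_energy k w.
Proof. by rewrite mulr_ge0// divr_ge0 ?powR_ge0 ?sqr_ge0. Qed.

Lemma trunc_flux_mul k w : (u w.1 - u w.2) * trunc_flux k w = trunc_energy k w.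
Proof. by rewrite /trunc_energy expr2 /trunc_flux; ring. Qed.

Lemma trunc_flux_antisym k x y : trunc_flux k (y, x) = - trunc_flux k (x, y).
Proof.
rewrite /trunc_flux /trunc_ind/= (eucl_dist_sym y x) andbCA -mulrN -mulNr opprB.
by rewrite !andbA.
Qed.

Lemma trunc_flux_bounded k w :
  `|trunc_flux k w| <= (k%:R + k%:R) / k.+1%:R^-1 `^ p0.
Proof.
rewrite /trunc_flux; have [/and3P[u1 u2 uw]|_] := boolP (trunc_ind k w); last first.
  by rewrite mul0r normr0 divr_ge0 ?powR_ge0.
have k0 : 0 < k.+1%:R^-1 :> R by rewrite invr_gt0.
rewrite mul1r normrM (@ger0_norm _ (_ `^ _)^-1) ?invr_ge0 ?powR_ge0//.
rewrite ler_pM ?invr_ge0 ?powR_ge0//.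
  by apply: le_trans (ler_normB _ _) _; exact: lerD.
rewrite lef_pV2 ?posrE ?powR_gt0// ?(lt_le_trans k0)//.
by rewrite ge0_ler_powR ?nnegrE ?(ltW p00) ?(ltW k0) ?eucl_dist_ge0.
Qed.

Lemma trunc_energy_nondecreasing w : nondecreasing_seq (trunc_energy ^~ w).
Proof.
move=> j k jk; rewrite ler_wpM2r ?divr_ge0 ?powR_ge0 ?sqr_ge0//.
rewrite /trunc_ind; case: and3P => // -[u1 u2 uw].
have jk' : j%:R <= k%:R :> R by rewrite ler_nat.
rewrite (le_trans u1 jk') (le_trans u2 jk')/=.
by rewrite (le_trans _ uw)// lef_pV2 ?posrE// ler_nat ltnS.
Qed.

Lemma trunc_energy_cvg w :
  trunc_energy k w @[k --> \oo] --> (u w.1 - u w.2) ^+ 2 / eucl_dist w.1 w.2 `^ p0.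
Proof.
have := eucl_dist_ge0 w.1 w.2; rewrite le_eqVlt => /predU1P[/esym w0|w0].
  rewrite (_ : trunc_energy ^~ w = fun=> 0); last first.
    by apply/funext => k; rewrite /trunc_energy (eucl_dist_eq0 w0) subrr expr0n/= mul0r mulr0.
  by rewrite (eucl_dist_eq0 w0) subrr expr0n/= mul0r; exact: cvg_cst.
have near_le (t : R) : \forall k \near \oo, t <= k%:R.
  exists (Num.trunc t).+1 => // k /= kt.
  by rewrite ltW// (lt_le_trans (truncnS_gt _))// ler_nat.
apply: cvg_near_cst.
have := near_infty_natSinv_lt (PosNum w0).
apply: filterS3 (near_le `|u w.1|) (near_le `|u w.2|) => k h1 h2 h3.
by rewrite /trunc_energy /trunc_ind h1 h2 ltW// mul1r.
Qed.

End truncation.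

(** * Lower bound at a fixed truncation *)

Section thin_liminf.
Context {R : realType} {n : nat} (omega : set 'rV[R]_n) (diam : R).
Hypotheses (momega : measurable omega) (omega_lty : (lebesgue_rV n omega < +oo)%E).
Hypothesis omega_diam : forall x y, omega x -> omega y -> eucl_dist x y < diam.
Local Notation Rd := ('rV[R]_n * measurableTypeR R)%type.
Local Notation lRd := (lebesgue_pair (lebesgue_rV n)).
Local Notation thin := (@thin R n.+1 omega).
Local Notation X := (thin 1).

Lemma thin_measure eps : 0 < eps ->
  (lRd (thin eps) = eps%:E * lebesgue_rV n omega)%E.
Proof.
move=> e0; have := @integral_thin_fst R n omega momega eps (cst 1%E) e0 _ _.
rewrite !integral_cst//; last exact: measurable_thin.
by rewrite !mul1e; apply.
Qed.

Lemma thin_measure_lty eps : 0 < eps -> (lRd (thin eps) < +oo)%E.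
Proof. by move=> e0; rewrite thin_measure// lte_mul_pinfty// lee_fin ltW. Qed.

Variables (u : 'rV[R]_n -> R) (p0 : R).
Hypotheses (mu_ : measurable_fun setT u) (p00 : 0 < p0).

Definition thin_integrand (v : Rd -> R) eps p (w : Rd * Rd) : R :=
  (v w.1 - v w.2) ^+ 2 / eucl_dist_pair (squeeze eps w.1) (squeeze eps w.2) `^ p.

Lemma thin_integrand_ge0 v eps p w : 0 <= thin_integrand v eps p w.
Proof. by rewrite divr_ge0 ?powR_ge0 ?sqr_ge0. Qed.

Lemma measurable_thin_integrand v eps p : measurable_fun X v ->
  measurable_fun (X `*` X) (thin_integrand v eps p).
Proof.
move=> mv; have mX := measurable_thin momega 1.
apply: measurable_funM.
  apply: measurable_funX; apply: measurable_funB.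
    exact: (measurable_fst_in mX mv).
  exact: (measurable_snd_in mX mv).
apply: measurable_funTS; apply: measurable_funV_ge0 => [w _|]; first exact: powR_ge0.
apply: (measurableT_comp (measurable_powR p)).
apply: (measurableT_comp (@measurable_eucl_dist_pair R n)
  (g := fun w : Rd * Rd => (squeeze eps w.1, squeeze eps w.2))).
by apply: measurable_fun_pair; apply: (measurableT_comp (measurable_squeeze eps)).
Qed.

Let half_four (I : R) : 2^-1 * (4 * I) = 2 * I.
Proof. lra. Qed.

Let four_le (I J e : R) : I - J <= e / 4 -> 2 * I - e <= 4 * J - 2 * I.
Proof. lra. Qed.

Let sqr_sub_unit_le1 (s t : R) : 0 < s -> s < 1 -> 0 < t -> t < 1 -> (s - t) ^+ 2 <= 1.
Proof.
move=> s0 s1 t0 t1; rewrite -real_normK ?num_real// expr_le1// ler_norml.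
by apply/andP; split; lra.
Qed.

Let base (w : Rd * Rd) : 'rV[R]_n * 'rV[R]_n := (w.1.1, w.2.1).

Let mbase : measurable_fun setT base.
Proof.
apply: measurable_fun_pair.
  exact: (measurableT_comp (f := fst) measurable_fst (g := fst)).
exact: (measurableT_comp (f := fst) measurable_fst (g := snd)).
Qed.

Let flux k w := trunc_flux u p0 k (base w).
Let energy k w := trunc_energy u p0 k (base w).

Let mflux k : measurable_fun setT (flux k).
Proof. exact: (measurableT_comp (measurable_trunc_flux p0 mu_ k) mbase). Qed.

Let menergy k : measurable_fun setT (energy k).
Proof. exact: (measurableT_comp (measurable_trunc_energy p0 mu_ k) mbase). Qed.

Lemma trunc_energy_thin k :
  (\int[lRd \x lRd]_(w in X `*` X) (energy k w)%:E =
   \int[lebesgue_rV n]_(x in omega) \int[lebesgue_rV n]_(y in omega)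
     (trunc_energy u p0 k (x, y))%:E)%E.
Proof.
have mX := measurable_thin momega 1.
rewrite -(@tonelli_in _ _ _ _ _ lRd lRd X X mX mX (EFin \o energy k)); last 2 first.
- by apply/measurable_EFinP; exact: measurable_funTS.
- by move=> w _; rewrite lee_fin trunc_energy_ge0.
apply: (integral_thin_fst2 momega (f := trunc_energy u p0 k)) => [|w].
  exact: measurable_trunc_energy.
exact: trunc_energy_ge0.
Qed.

Let v (x : Rd) : R := u x.1.

(* With q = flux the truncated difference quotient of u, and G the integrand of
   the rescaled functional, 2 (v_j(x) - v_j(y)) q <= Lam G + energy pointwise;
   the left-hand side is linear in v_j and passes to the weak limit. *)
Lemma thin_lower_bound k (Lam e : R) : L2 lRd X v -> 1 < Lam -> 0 < e ->
  forall (eps_ p_ : nat -> R) (v_ : nat -> Rd -> R),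
  (forall j, 0 < eps_ j) -> eps_ j @[j --> \oo] --> 0 ->
  p_ j @[j --> \oo] --> p0 -> weak_cvg_L2 lRd X v_ v ->
  \forall j \near \oo,
    (\int[lRd \x lRd]_(w in X `*` X) (energy k w)%:E - e%:E <=
     Lam%:E * \int[lRd \x lRd]_(w in X `*` X) (thin_integrand (v_ j) (eps_ j) (p_ j) w)%:E)%E.
Proof.
move=> v2 Lam1 e0 eps_ p_ v_ eps0 ceps cp [v2_ _ wcv].
have mX := measurable_thin momega 1.
have Xoo := thin_measure_lty (ltr01 : 0 < 1 :> R).
have mXX : measurable (X `*` X) by exact: measurableX.
have bounded w : `|flux k w| <= (k%:R + k%:R) / k.+1%:R^-1 `^ p0.
  exact: trunc_flux_bounded.
have antisym x y : flux k (y, x) = - flux k (x, y) by exact: trunc_flux_antisym.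
pose phi := marginal lRd X (flux k).
have phi2 : L2 lRd X phi by exact: marginal_L2 (mflux k) bounded.
have pair f : L2 lRd X f -> (\int[lRd \x lRd]_(w in X `*` X)
    (2 * (f w.1 - f w.2) * flux k w)%:E = (4 * \int[lRd]_(x in X) (f x * phi x))%:E)%E.
  by move=> f2; exact: (antisymmetric_pairing mX Xoo (mflux k) bounded antisym f2).
(* Pairing the limit v with its own flux gives twice the truncated energy on one side and 4 times
   this integral on the other, so a is the truncated energy. *)
pose a := 2 * \int[lRd]_(x in X) (v x * phi x).
have Ia : (\int[lRd \x lRd]_(w in X `*` X) (energy k w)%:E = a%:E)%E.
  have := pair v v2.
  have -> : (\int[lRd \x lRd]_(w in X `*` X) (2 * (v w.1 - v w.2) * flux k w)%:E =
      2%:E * \int[lRd \x lRd]_(w in X `*` X) (energy k w)%:E)%E.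
    rewrite -ge0_integralZl_EFin//; last 2 first.
    - by move=> w _; rewrite lee_fin trunc_energy_ge0.
    - by apply/measurable_EFinP; exact: measurable_funTS.
    apply: eq_integral => w _; rewrite -EFinM; congr EFin.
    by rewrite -mulrA (trunc_flux_mul u p0 k (base w)).
  move=> H; have : (2^-1%:E * (2%:E * \int[lRd \x lRd]_(w in X `*` X) (energy k w)%:E) = a%:E)%E.
    by rewrite H -EFinM /a; congr EFin; exact: half_four.
  by rewrite muleA -EFinM mulVf// mul1e.
rewrite Ia.
have delta0 : 0 < k.+1%:R^-1 :> R by rewrite invr_gt0.
have [d d0 Hd] := thin_kernel_le diam p00 delta0 Lam1.
have near_p : \forall j \near \oo, `|p_ j - p0| <= d.
  have := cp; move/cvgrPdist_le => /(_ d d0); apply: filterS => j.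
  by rewrite distrC.
have near_eps : \forall j \near \oo, 0 < eps_ j <= d.
  have := ceps; move/cvgrPdist_le => /(_ d d0); apply: filterS => j.
  rewrite sub0r normrN => h; rewrite eps0/=; exact: le_trans (ler_norm _) h.
have near_w : \forall j \near \oo,
    `|\int[lRd]_(x in X) (v x * phi x) - \int[lRd]_(x in X) (v_ j x * phi x)| <= e / 4.
  have := wcv phi phi2; move/cvgrPdist_le => /(_ (e / 4)); apply.
  by rewrite divr_gt0.
apply: filterS3 near_p near_eps near_w => j pj ej wj.
pose G w := thin_integrand (v_ j) (eps_ j) (p_ j) w.
have G0 w : 0 <= G w by exact: thin_integrand_ge0.
have mG : measurable_fun (X `*` X) (EFin \o G).
  by apply/measurable_EFinP; apply: measurable_thin_integrand; case: (v2_ j).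
have Lam0 : 0 <= Lam by rewrite ltW// (lt_trans ltr01).
have q0 w : 0 <= energy k w by exact: trunc_energy_ge0.
have pointwise w : (X `*` X) w ->
    2 * (v_ j w.1 - v_ j w.2) * flux k w <= Lam * G w + energy k w.
  move=> [[X1 t1] [X2 t2]].
  rewrite /flux /energy /trunc_flux /trunc_energy.
  have [/and3P[_ _ rd]|_] := boolP (trunc_ind u k (base w)); last first.
    by rewrite !mul0r mulr0 addr0 mulr_ge0.
  rewrite !mul1r /G /thin_integrand.
  set r := eucl_dist (base w).1 (base w).2 in rd *.
  set Dp := eucl_dist_pair _ _.
  set x := v_ j w.1 - v_ j w.2; set y := u _ - u _.
  have r0 : 0 < r by exact: lt_le_trans rd.
  have rD : r <= Dp by exact: (eucl_dist_le_pair (squeeze (eps_ j) w.1) (squeeze (eps_ j) w.2)).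
  have D0 : 0 < Dp by exact: lt_le_trans rD.
  (* Both vertical coordinates lie in (0,1), so after squeezing they differ by at most eps. *)
  have Dr : Dp ^+ 2 <= r ^+ 2 + eps_ j ^+ 2.
    rewrite eucl_dist_pair_sqr lerD2l/= -mulrBr exprMn ler_piMr ?sqr_ge0//.
    move: t1 t2; rewrite /= !in_itv/= => /andP[a1 a2] /andP[b1 b2].
    exact: sqr_sub_unit_le1.
  have rdd : k.+1%:R^-1 <= r <= diam by rewrite rd ltW// omega_diam.
  have K := Hd (p_ j) (eps_ j) r Dp pj ej rdd (ltW D0) Dr.
  have A0 : 0 < Dp `^ p_ j by rewrite powR_gt0.
  have B0 : 0 < r `^ p0 by rewrite powR_gt0.
  have K' : (r `^ p0)^-1 <= Lam / Dp `^ p_ j.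
    by rewrite ler_pdivlMr// mulrC ler_pdivrMr.
  have h1 : x ^+ 2 / r `^ p0 <= Lam * (x ^+ 2 / Dp `^ p_ j).
    by rewrite mulrCA ler_wpM2l ?sqr_ge0.
  (* This is 2 x y <= x^2 + y^2 weighted by the limit kernel; h1 then trades the term in x for the
     thin kernel. *)
  have h2 : 0 <= (x - y) ^+ 2 / r `^ p0 by rewrite divr_ge0 ?sqr_ge0// ltW.
  apply: le_trans (lerD h1 (lexx _)).
  rewrite -subr_ge0 (_ : _ - _ = (x - y) ^+ 2 / r `^ p0)//; ring.
have vj2 := v2_ j.
have H : ((4 * \int[lRd]_(x in X) (v_ j x * phi x))%:E <=
    Lam%:E * (\int[lRd \x lRd]_(w in X `*` X) (G w)%:E) + a%:E)%E.
  rewrite -(pair _ vj2) -Ia -ge0_integralZl_EFin//; last first.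
    by move=> w _; rewrite lee_fin.
  rewrite -ge0_integralD//; last 4 first.
  - by move=> w _; rewrite -EFinM lee_fin mulr_ge0.
  - exact: measurable_funeM.
  - by move=> w _; rewrite lee_fin.
  - by apply/measurable_EFinP; exact: measurable_funTS.
  apply: integral_le_pos => w Xw.
    rewrite -EFinM -EFinD lee_fin; apply: addr_ge0; last exact: q0.
    exact: mulr_ge0.
  by rewrite -EFinM -EFinD lee_fin; exact: pointwise.
(* With I and J the integrals of v and of v_j against phi, a = 2 I, and 4 J - a falls below a by at
   most e once I - J <= e / 4. *)
have : ((4 * \int[lRd]_(x in X) (v_ j x * phi x) - a)%:E <=
    Lam%:E * (\int[lRd \x lRd]_(w in X `*` X) (G w)%:E))%E.
  by rewrite EFinB leeBlDr.
apply: le_trans; rewrite -EFinB lee_fin /a.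
exact: four_le (le_trans (ler_norm _) wj).
Qed.

End thin_liminf.

(** * The liminf inequality *)

Section liminf_inequality.
Context {R : realType} {n : nat} (omega : set 'rV[R]_n) (diam : R).
Hypotheses (momega : measurable omega) (omega_lty : (lebesgue_rV n omega < +oo)%E).
Hypothesis omega_diam : forall x y, omega x -> omega y -> eucl_dist x y < diam.
Local Notation Rd := ('rV[R]_n * measurableTypeR R)%type.
Local Notation lRd := (lebesgue_pair (lebesgue_rV n)).
Local Notation thin := (@thin R n.+1 omega).
Local Notation X := (thin 1).

Lemma integral_trunc_energy_lty (u : 'rV[R]_n -> R) (p0 : R) k :
  measurable_fun setT u -> 0 < p0 ->
  (\int[lebesgue_rV n \x lebesgue_rV n]_(w in omega `*` omega) (trunc_energy u p0 k w)%:E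
   < +oo)%E.
Proof.
move=> mu_ p00.
have mo : measurable (omega `*` omega) by exact: measurableX.
have bound w : `|trunc_energy u p0 k w| <=
    (k%:R + k%:R) * ((k%:R + k%:R) / k.+1%:R^-1 `^ p0).
  rewrite -trunc_flux_mul normrM.
  have [/and3P[u1 u2 _]|h] := boolP (trunc_ind u k w).
    rewrite ler_pM ?trunc_flux_bounded//.
    by apply: le_trans (ler_normB _ _) _; exact: lerD.
  rewrite /trunc_flux (negbTE h) mul0r normr0 mulr0.
  by rewrite mulr_ge0 ?addr_ge0// divr_ge0 ?powR_ge0.
have /integrableP[_] := integrable_bounded mo
  (product_measure_setX_lty momega momega omega_lty omega_lty)
  (measurable_funTS (measurable_trunc_energy p0 mu_ k)) (fun w _ => bound w).
apply: le_lt_trans; apply: ge0_le_integral_nomeas => w _.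
  by rewrite lee_fin trunc_energy_ge0.
by rewrite lee_fin ler_norm.
Qed.

(** Absorbs the factor Lam: if F were below a - e, the excess of Lam over 1 would add at most e / 2
    to F, contradicting the hypothesis. *)
Lemma le_of_scaled_le (a e : R) (F : \bar R) : 0 <= a -> 0 < e -> (0 <= F)%E ->
  ((a - e / 2)%:E <= (1 + e / 2 / (a + 1))%:E * F)%E -> ((a - e)%:E <= F)%E.
Proof.
move=> a0 e0; case: F => [r|_ _|//]; last by rewrite leey.
rewrite !lee_fin => r0 h; rewrite leNgt; apply/negP => ra.
have a1 : 0 < a + 1 by rewrite ltr_wpDl.
have : e / 2 / (a + 1) * r <= e / 2.
  rewrite mulrAC -mulrA ler_piMr ?divr_ge0 ?(ltW e0)// ler_pdivrMr// mul1r.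
  by rewrite ltW// (lt_trans ra)//; lra.
by move: h; rewrite mulrDl mul1r; lra.
Qed.

Variables (u : 'rV[R]_n -> R) (p0 : R).
Hypotheses (mu_ : measurable_fun setT u) (p00 : 0 < p0).
Variables (eps_ s_ : nat -> R) (u_ : nat -> Rd -> R).
Hypotheses (eps0 : forall j, 0 < eps_ j) (ceps : eps_ j @[j --> \oo] --> 0).
Hypothesis cp : n.+1%:R + 2 * s_ j @[j --> \oo] --> p0.
Hypothesis mu_j : forall j, measurable_fun (thin (eps_ j)) (u_ j).
Hypothesis wcv : weak_cvg_L2 lRd X (fun j x => u_ j (squeeze (eps_ j) x))
  (fun x => u x.1).

Lemma F_thinE j : @F_thin R n.+1 omega (eps_ j) (s_ j) (u_ j) =
  (\int[lRd \x lRd]_(w in X `*` X) (thin_integrand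
    (fun x => u_ j (squeeze (eps_ j) x)) (eps_ j) (n.+1%:R + 2 * s_ j) w)%:E)%E.
Proof.
have mX := measurable_thin momega 1.
rewrite F_thin_squeeze//.
apply: (@tonelli_in _ _ _ _ _ lRd lRd X X mX mX (EFin \o thin_integrand
  (fun x => u_ j (squeeze (eps_ j) x)) (eps_ j) (n.+1%:R + 2 * s_ j))).
- apply/measurable_EFinP; apply: measurable_thin_integrand => //.
  exact: measurable_comp_squeeze.
- by move=> w _; rewrite lee_fin thin_integrand_ge0.
Qed.

(** By monotone convergence the limit energy is the limit of the truncated ones, so each truncation
    can be treated alone. Its energy is finite, which allows Lam to be chosen in terms of it. *)
Lemma liminf_inequality : (gagliardo (lebesgue_rV n) eucl_dist p0 omega u <=
  limn_einf (fun j => @F_thin R n.+1 omega (eps_ j) (s_ j) (u_ j)))%E.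
Proof.
have mo : measurable (omega `*` omega) by exact: measurableX.
rewrite (gagliardoE _ momega (@measurable_eucl_dist R n) p0 mu_).
have -> : (\int[lebesgue_rV n \x lebesgue_rV n]_(w in omega `*` omega)
      ((u w.1 - u w.2) ^+ 2 / eucl_dist w.1 w.2 `^ p0)%:E =
    \int[lebesgue_rV n \x lebesgue_rV n]_(w in omega `*` omega)
      limn (fun k => (trunc_energy u p0 k w)%:E))%E.
  apply: eq_integral => w _; apply/esym/cvg_lim => //.
  apply: cvg_EFin; first exact: nearW.
  exact: trunc_energy_cvg.
rewrite monotone_convergence//; last 3 first.
- move=> k; apply/measurable_EFinP; apply: measurable_funTS.
  exact: measurable_trunc_energy.
- by move=> k w _; rewrite lee_fin trunc_energy_ge0.
- by move=> w _ j k jk; rewrite lee_fin; exact: trunc_energy_nondecreasing.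
apply: lime_le.
  apply: ereal_nondecreasing_is_cvgn => j k jk.
  apply: ge0_le_integral_nomeas => w _; first by rewrite lee_fin trunc_energy_ge0.
  by rewrite lee_fin; exact: trunc_energy_nondecreasing.
apply: nearW => k.
set Ik := (X in (X <= _)%E).
have Ik0 : (0 <= Ik)%E.
  by apply: integral_ge0 => w _; rewrite lee_fin trunc_energy_ge0.
have Ikfin : Ik \is a fin_num.
  by rewrite ge0_fin_numE// /Ik integral_trunc_energy_lty.
have IkE : (\int[lRd \x lRd]_(w in X `*` X) (trunc_energy u p0 k (w.1.1, w.2.1))%:E)%E = Ik.
  rewrite (trunc_energy_thin momega p0 mu_ k).
  apply: (@tonelli_in _ _ _ _ _ (lebesgue_rV n) (lebesgue_rV n) omega omega momega momega
    (EFin \o trunc_energy u p0 k)).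
    by apply/measurable_EFinP; apply: measurable_funTS; exact: measurable_trunc_energy.
  by move=> w _; rewrite lee_fin trunc_energy_ge0.
rewrite -(fineK Ikfin); set a := fine Ik.
have a0 : 0 <= a by exact: fine_ge0.
apply/lee_subgt0Pr => e e0; apply: limn_einf_ge.
have a1 : 0 < a + 1 by rewrite ltr_wpDl.
have Lam1 : 1 < 1 + e / 2 / (a + 1) by rewrite ltrDl !divr_gt0.
have e20 : 0 < e / 2 by rewrite divr_gt0.
have v2 : L2 lRd X (fun x : Rd => u x.1) by case: wcv.
have := thin_lower_bound momega omega_lty omega_diam mu_ p00 k v2 Lam1 e20 eps0 ceps cp wcv.
apply: filterS => j.
rewrite IkE -(fineK Ikfin) -/a -EFinB -F_thinE => h.
rewrite -EFinB; apply: le_of_scaled_le h => //.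
rewrite F_thinE; apply: integral_ge0 => w _; rewrite lee_fin.
exact: thin_integrand_ge0.
Qed.

End liminf_inequality.

(** * Recovery sequences *)

Section strong_convergence.
Context {R : realType} {d} {T : measurableType d}.
Variables (mu : {measure set T -> \bar R}) (X : set T).
Hypotheses (mX : measurable X).

Lemma L2_integrable_mul (f g : T -> R) : L2 mu X f -> L2 mu X g ->
  mu.-integrable X (fun x => (f x * g x)%:E).
Proof.
move=> [mf f2] [mg g2].
have iq : mu.-integrable X (fun x => (f x ^+ 2 + g x ^+ 2)%:E).
  by have := integrableD mX f2 g2.
apply: (integrable_dom mX _ iq); first exact: measurable_funM.
move=> x _; rewrite normrM -(@real_normK _ (f x)) ?num_real//.
rewrite -(@real_normK _ (g x)) ?num_real//.
have := sqr_ge0 (`|f x| - `|g x|); have := normr_ge0 (f x).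
by have := normr_ge0 (g x); nra.
Qed.

(** Young's inequality |(w_j - w) phi| <= (t / 2) (w_j - w)^2 + phi^2 / (2 t), with t large in terms
    of the norm of phi, replaces Cauchy-Schwarz. *)
Lemma weak_cvg_of_strong (w_ : nat -> T -> R) (w : T -> R) :
  (forall j, L2 mu X (w_ j)) -> L2 mu X w ->
  (forall e : R, 0 < e -> \forall j \near \oo,
    (\int[mu]_(x in X) ((w_ j x - w x) ^+ 2)%:E <= e%:E)%E) ->
  weak_cvg_L2 mu X w_ w.
Proof.
move=> w2_ w2 cw; split=> // phi phi2.
apply/cvgrPdist_le => e e0.
have [mphi iphi2] := phi2; have [mw _] := w2.
pose Phi := \int[mu]_(x in X) phi x ^+ 2.
have Phi0 : 0 <= Phi by apply: Rintegral_ge0 => x _; exact: sqr_ge0.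
have Phi1 : 0 < Phi + 1 by rewrite ltr_wpDl.
(* Chosen so that Phi / (2 t) is at most e / 2; an L2 error of at most e / t gives the other
   half. *)
pose t := (Phi + 1) / e.
have t0 : 0 < t by rewrite divr_gt0.
have et0 : 0 < e / t by rewrite divr_gt0.
apply: filterS (cw _ et0) => j Hj.
have [mwj _] := w2_ j.
have i1 := L2_integrable_mul (w2_ j) phi2.
have i2 := L2_integrable_mul w2 phi2.
have idiff : mu.-integrable X (fun x => (w x * phi x - w_ j x * phi x)%:E).
  exact: (integrableB mX i2 i1).
rewrite -RintegralB//.
apply: le_trans (le_normr_Rintegral mX idiff) _.
rewrite -lee_fin integral_EFin_fineK//; last exact: (integrable_abse idiff).
have md : measurable_fun X (fun x => ((w_ j x - w x) ^+ 2)%:E).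
  by apply/measurable_EFinP; apply: measurable_funX; exact: measurable_funB.
have mp : measurable_fun X (fun x => (phi x ^+ 2)%:E).
  by apply/measurable_EFinP; exact: measurable_funX.
apply: (@le_trans _ _ (\int[mu]_(x in X) ((t / 2)%:E * ((w_ j x - w x) ^+ 2)%:E +
    (t^-1 / 2)%:E * (phi x ^+ 2)%:E))%E).
  apply: ge0_le_integral_nomeas => x _; first by rewrite lee_fin.
  rewrite -!EFinM -EFinD lee_fin.
  have -> : w x * phi x - w_ j x * phi x = - (w_ j x - w x) * phi x by ring.
  rewrite normrM normrN -(@real_normK _ (w_ j x - w x)) ?num_real//.
  rewrite -(@real_normK _ (phi x)) ?num_real//.
  move: `|w_ j x - w x| `|phi x| => p q.
  rewrite -subr_ge0 (_ : _ - _ = (t * p - q) ^+ 2 / (2 * t)); last by field; rewrite gt_eqF.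
  by rewrite divr_ge0 ?sqr_ge0// mulr_ge0// ltW.
have t20 : 0 <= t / 2 by rewrite divr_ge0// ltW.
have tV20 : 0 <= t^-1 / 2 by rewrite divr_ge0// invr_ge0 ltW.
rewrite ge0_integralD//; last 4 first.
- by move=> x _; rewrite -EFinM lee_fin mulr_ge0// sqr_ge0.
- exact: measurable_funeM.
- by move=> x _; rewrite -EFinM lee_fin mulr_ge0// sqr_ge0.
- exact: measurable_funeM.
rewrite !ge0_integralZl_EFin//; last 2 first.
- by move=> x _; rewrite lee_fin sqr_ge0.
- by move=> x _; rewrite lee_fin sqr_ge0.
rewrite -(integral_EFin_fineK mX iphi2) -/Phi.
apply: (@le_trans _ _ ((t / 2)%:E * (e / t)%:E + (t^-1 / 2)%:E * Phi%:E)%E).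
  by apply: leeD => //; rewrite lee_wpmul2l.
rewrite -!EFinM -EFinD lee_fin.
have -> : t / 2 * (e / t) = e / 2 by field; rewrite gt_eqF.
rewrite [leRHS]splitr lerD2l mulrAC ler_pM2r ?invr_gt0//.
rewrite /t invf_div mulrAC ler_pdivrMr// ler_pM2l// lerDl//.
Qed.

End strong_convergence.

(** If J i is the rank from which the i-th approximant is good, [k j] is the largest index up to j
    already good at rank j; it tends to infinity. *)
Lemma diagonal_index (J : nat -> nat) : exists k : nat -> nat,
  forall i, \forall j \near \oo, (i <= k j)%N /\ (J (k j) <= j)%N.
Proof.
exists (fun j => \max_(i < j.+1 | (J i <= j)%N) i)%N => i.
(* J 0 takes part because 0 is the base value of the maximum and must itself be good at rank j. *)
exists (maxn (J 0) (maxn i (J i))) => // j /=.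
rewrite !geq_max => /and3P[j0 ij Jij]; split.
  exact: (leq_bigmax_cond (Ordinal (ij : (i < j.+1)%N))).
elim/big_ind : _ => //.
by move=> a b; rewrite /maxn; case: ifP.
Qed.

Lemma gagliardo_eq {R : realType} {d} {T : measurableType d}
    (mu : {measure set T -> \bar R}) (dist : T -> T -> R) p (D : set T) (u v : T -> R) :
  (forall x, D x -> u x = v x) -> gagliardo mu dist p D u = gagliardo mu dist p D v.
Proof.
move=> uv; apply: eq_integral => x /set_mem Dx; apply: eq_integral => y /set_mem Dy.
by rewrite !uv.
Qed.

Section recovery.
Context {R : realType} {n : nat} (omega : set 'rV[R]_n).
Hypotheses (omega_bounded : bounded_set omega) (omega_open : open omega)
  (omega_lipschitz : lipschitz_boundary omega).
Local Notation Rd := ('rV[R]_n * measurableTypeR R)%type.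
Local Notation lRd := (lebesgue_pair (lebesgue_rV n)).
Local Notation thin := (@thin R n.+1 omega).
Local Notation X := (thin 1).

Let momega : measurable omega. Proof. exact: open_measurable_rV. Qed.

Let omega_lty : (lebesgue_rV n omega < +oo)%E.
Proof. exact: bounded_measure_lty. Qed.

Lemma L2_fst eps (g : 'rV[R]_n -> R) : 0 < eps -> L2 (lebesgue_rV n) omega g ->
  L2 lRd (thin eps) (fun x => g x.1).
Proof.
move=> e0 [mg ig2].
have mgf : measurable_fun (thin eps) (fun x : Rd => g x.1).
  apply: (measurable_comp (F := omega) (f := g) (g := fst)) => //.
    by move=> _ [w [ow _] <-].
  by apply: measurable_funTS; exact: measurable_fst.
split=> //; apply/integrableP; split.
  by apply/measurable_EFinP; exact: measurable_funX.
have mg2 : measurable_fun omega (fun x => `|(g x ^+ 2)%:E|%E).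
  by apply: measurableT_comp => //; apply/measurable_EFinP; exact: measurable_funX.
apply: (@le_lt_trans _ _ (eps%:E * \int[lebesgue_rV n]_(x in omega) `|(g x ^+ 2)%:E|)%E).
  rewrite le_eqVlt; apply/orP; left; apply/eqP.
  exact: (integral_thin_fst momega (f := fun x => `|(g x ^+ 2)%:E|%E)).
case/integrableP : ig2 => _ h.
by rewrite lte_mul_pinfty// lee_fin ltW.
Qed.

Lemma lipschitz_L2 (g : 'rV[R]_n -> R) (L : R) : measurable_fun setT g -> 0 <= L ->
  (forall x y, omega x -> omega y -> `|g x - g y| <= L * eucl_dist x y) ->
  L2 (lebesgue_rV n) omega g.
Proof.
move=> mg L0 gL; have mg' : measurable_fun omega g by exact: measurable_funTS.
split=> //.
have [diam diam0 Hdiam] := bounded_diameter omega_bounded.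
have [[x0 ox0]|no] := pselect (exists x, omega x); last first.
  rewrite (_ : omega = set0); last by rewrite -subset0 => x ox; apply: no; exists x.
  exact: integrable_set0.
apply: (@integrable_bounded _ _ _ _ omega (fun x => g x ^+ 2) ((`|g x0| + L * diam) ^+ 2)) => //.
  exact: measurable_funX.
move=> x ox; rewrite ger0_norm ?sqr_ge0// -real_normK ?num_real//.
rewrite lerXn2r ?nnegrE ?addr_ge0 ?mulr_ge0 ?(ltW diam0)//.
rewrite -{1}(subrK (g x0) (g x)) addrC; apply: le_trans (ler_normD _ _) _.
rewrite lerD2l; apply: le_trans (gL _ _ ox ox0) _.
by rewrite ler_wpM2l// ltW// Hdiam.
Qed.

Lemma sqrD_lt_sqr (a b A B : R) : 0 <= a -> a < A -> `|b| <= B ->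
  a ^+ 2 + b ^+ 2 < (A + B) ^+ 2.
Proof.
rewrite -(@real_normK _ b) ?num_real// => a0 aA bB.
by have := normr_ge0 b; nra.
Qed.

(** The cylinder has dimension n + 1, where the critical exponent is n + 3: n + 1 + 2 s stays below
    it for every s < 1. Thus the recovery sequence is admissible for every j, even where [s_ j] is
    far from its limit. *)
Lemma lipschitz_Hs eps s (g : 'rV[R]_n -> R) (L : R) : 0 < eps -> 0 < s < 1 ->
  measurable_fun setT g -> 0 <= L ->
  (forall x y, omega x -> omega y -> `|g x - g y| <= L * eucl_dist x y) ->
  @Hs R n.+1 s (thin eps) (fun x => g x.1).
Proof.
move=> e0 /andP[s0 s1] mg L0 gL; split.
  apply: L2_fst => //; exact: lipschitz_L2 gL.
have [diam diam0 Hdiam] := bounded_diameter omega_bounded.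
have mt := measurable_thin momega eps.
have toy := thin_measure_lty momega omega_lty e0.
apply: (@gagliardo_lipschitz_lty _ _ _ lRd eucl_dist_pair (thin eps) n.+1
  (2 ^+ n.+1) (diam + eps) mt toy _ _ _ _ _ _ L) => //.
- exact: (measurable_dist1 (@measurable_eucl_dist_pair R n)).
- exact: eucl_dist_pair_ge0.
- by move=> x rho _ rho0; exact: eucl_pair_ball_measure_le.
- move=> x y [ox] /=; rewrite in_itv/= => /andP[x0 x1] [oy]/=.
  rewrite in_itv/= => /andP[y0 y1].
  rewrite -(@ltr_pXn2r _ 2) ?nnegrE ?eucl_dist_pair_ge0 ?addr_ge0 ?(ltW e0) ?(ltW diam0)//.
  rewrite eucl_dist_pair_sqr; apply: sqrD_lt_sqr; rewrite ?eucl_dist_ge0 ?Hdiam//.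
  by rewrite ler_norml; apply/andP; split; lra.
- by apply/andP; split; [rewrite addr_ge0// mulr_ge0// ltW|rewrite ltrD2l; lra].
- move=> x y [ox _] [oy _]; apply: le_trans (gL _ _ ox oy) _.
  by rewrite ler_wpM2l// eucl_dist_le_pair.
Qed.

Lemma F_thin_fst_le eps s (g : 'rV[R]_n -> R) : 0 < eps -> 0 <= s ->
  measurable_fun setT g ->
  (@F_thin R n.+1 omega eps s (fun x => g x.1) <=
   gagliardo (lebesgue_rV n) eucl_dist (n.+1%:R + 2 * s) omega g)%E.
Proof.
move=> e0 s0 mg; set p := n.+1%:R + 2 * s.
have p0 : 0 < p by rewrite ltr_wpDr// mulr_ge0.
rewrite F_thin_squeeze//; last first.
  by apply: measurable_funTS; exact: (measurableT_comp mg (g := fst)).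
have mf := measurable_gagliardo_integrand (@measurable_eucl_dist R n) p mg.
have f0 (w : 'rV[R]_n * 'rV[R]_n) : 0 <= (g w.1 - g w.2) ^+ 2 / eucl_dist w.1 w.2 `^ p.
  by rewrite divr_ge0 ?powR_ge0 ?sqr_ge0.
apply: (@le_trans _ _ (\int[lRd]_(x in X) \int[lRd]_(y in X)
    ((g x.1 - g y.1) ^+ 2 / eucl_dist x.1 y.1 `^ p)%:E)%E); last first.
  by rewrite (integral_thin_fst2 momega mf f0).
apply: ge0_le_integral_nomeas => x _.
  by apply: integral_ge0 => y _; rewrite lee_fin divr_ge0 ?powR_ge0 ?sqr_ge0.
apply: ge0_le_integral_nomeas => y _; rewrite lee_fin.
  by rewrite divr_ge0 ?powR_ge0 ?sqr_ge0.
rewrite /squeeze/=; have := eucl_dist_ge0 x.1 y.1; rewrite le_eqVlt => /predU1P[/esym h|h].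
  by rewrite (eucl_dist_eq0 h) subrr expr0n/= !mul0r.
rewrite ler_wpM2l ?sqr_ge0// lef_pV2 ?posrE ?powR_gt0//; last first.
  exact: lt_le_trans (eucl_dist_le_pair (x.1, eps * x.2) (y.1, eps * y.2)).
rewrite ge0_ler_powR ?nnegrE ?eucl_dist_pair_ge0 ?(ltW p0) ?(ltW h)//.
exact: (eucl_dist_le_pair (x.1, eps * x.2) (y.1, eps * y.2)).
Qed.

End recovery.

Section recovery_sequence.
Context {R : realType} {n : nat} (omega : set 'rV[R]_n).
Hypotheses (omega_bounded : bounded_set omega) (omega_open : open omega)
  (omega_lipschitz : lipschitz_boundary omega).
Local Notation Rd := ('rV[R]_n * measurableTypeR R)%type.
Local Notation lRd := (lebesgue_pair (lebesgue_rV n)).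
Local Notation thin := (@thin R n.+1 omega).
Local Notation X := (thin 1).
Local Notation energy := (gagliardo (lebesgue_rV n) eucl_dist).

Let momega : measurable omega. Proof. exact: open_measurable_rV. Qed.

Let omega_lty : (lebesgue_rV n omega < +oo)%E.
Proof. exact: bounded_measure_lty. Qed.

Variables (u : 'rV[R]_n -> R) (p0 : R).
Hypotheses (mu_ : measurable_fun setT u) (u2 : L2 (lebesgue_rV n) omega u).
Hypothesis mp : n%:R < p0 < n%:R + 2.

Let p00 : 0 < p0. Proof. by case/andP: mp => + _; exact: le_lt_trans. Qed.

Lemma lipschitz_approximation_rV (e : R) : 0 < e ->
  exists g : 'rV[R]_n -> R, [/\ measurable_fun setT g,
    exists2 L : R, 0 <= L &
      forall x y, omega x -> omega y -> `|g x - g y| <= L * eucl_dist x y,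
    (\int[lebesgue_rV n]_(x in omega) ((g x - u x) ^+ 2)%:E <= e%:E)%E &
    (energy p0 omega g <= energy p0 omega u + e%:E)%E].
Proof.
move=> e0; have [ufin|] := ltP (energy p0 omega u) +oo%E.
  have [c [r0 [c0 r00 ball_ge]]] :=
    eucl_ball_measure_ge momega omega_bounded omega_open omega_lipschitz.
  exact: (lipschitz_approximation momega omega_lty (@measurable_eucl_dist R n)
    eucl_dist_ge0 eucl_dist_sym eucl_dist_tri (exprn_gt0 n (ltr0Sn R 1)) c0
    (fun x rho _ => @eucl_ball_measure_le R n omega x rho momega) ball_ge r00
    (@eucl_dist_eq0 R n) mu_ u2 mp ufin e0).
rewrite leye_eq => /eqP ->.
have [g [[mg [L L0 gL]] gu]] := lipschitz_dense_L2 momega omega_lty mu_ u2 e0.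
exists g; split=> //; first by exists L => // x y _ _; exact: gL.
by rewrite addye// leey.
Qed.

Variables (eps_ s_ : nat -> R).
Hypotheses (eps0 : forall j, 0 < eps_ j) (s01 : forall j, 0 < s_ j < 1).
Hypothesis cp : n.+1%:R + 2 * s_ j @[j --> \oo] --> p0.

Lemma F_thin_fst_near (g : 'rV[R]_n -> R) (L e : R) : measurable_fun setT g -> 0 <= L ->
  (forall x y, omega x -> omega y -> `|g x - g y| <= L * eucl_dist x y) -> 0 < e ->
  \forall j \near \oo, (@F_thin R n.+1 omega (eps_ j) (s_ j) (fun x => g x.1) <=
    energy p0 omega g + e%:E)%E.
Proof.
move=> mg L0 gL e0.
have [diam diam0 Hdiam] := bounded_diameter omega_bounded.
have p0m : 0 < p0 < n%:R + 2 by rewrite p00; case/andP: mp.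
have [delta delta0 Hdelta] := gagliardo_exponent momega omega_lty
  (@measurable_eucl_dist R n) eucl_dist_ge0 (exprn_ge0 n (ler0n R 2))
  (fun x rho _ => @eucl_ball_measure_le R n omega x rho momega) Hdiam p0m L0 mg gL e0.
move/cvgrPdist_lt : cp => /(_ _ delta0); apply: filterS => j pj.
apply: le_trans (F_thin_fst_le omega_open (eps0 j) _ mg) (Hdelta _ _).
  by case/andP: (s01 j) => /ltW.
by rewrite distrC.
Qed.

Lemma recovery_sequence : exists u_ : nat -> Rd -> R,
  [/\ forall j, @Hs R n.+1 (s_ j) (thin (eps_ j)) (u_ j),
    weak_cvg_L2 lRd X (fun j x => u_ j (squeeze (eps_ j) x)) (fun x => u x.1) &
    (limn_esup (fun j => @F_thin R n.+1 omega (eps_ j) (s_ j) (u_ j)) <=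
      energy p0 omega u)%E].
Proof.
pose e k : R := k.+1%:R^-1.
have e0 k : 0 < e k by rewrite invr_gt0.
(* One error [e k] comes from approximating u by a Lipschitz function, the other from the variable
   exponent; the rank J beyond which the second holds depends on k, hence the diagonal choice. *)
have step k : exists gJ : ('rV[R]_n -> R) * nat, [/\ measurable_fun setT gJ.1,
    exists2 L : R, 0 <= L &
      forall x y, omega x -> omega y -> `|gJ.1 x - gJ.1 y| <= L * eucl_dist x y,
    (\int[lebesgue_rV n]_(x in omega) ((gJ.1 x - u x) ^+ 2)%:E <= (e k)%:E)%E &
    forall j, (gJ.2 <= j)%N ->
      (@F_thin R n.+1 omega (eps_ j) (s_ j) (fun x => gJ.1 x.1) <=
       energy p0 omega u + (e k + e k)%:E)%E].
  have [g [mg [L L0 gL] gu gE]] := lipschitz_approximation_rV (e0 k).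
  have [J _ HJ] := F_thin_fst_near mg L0 gL (e0 k).
  exists (g, J); split=> //; first by exists L.
  move=> j /HJ /le_trans; apply; rewrite EFinD addeA; exact: leeD2r.
have {step}[gJ HgJ] := choice step.
have [k Hk] := diagonal_index (fun i => (gJ i).2).
have near_small (e' : R) : 0 < e' -> \forall j \near \oo,
    e (k j) <= e' /\ ((gJ (k j)).2 <= j)%N.
  move=> e'0.
  have := Hk (Num.trunc e'^-1).
  apply: filterS => j [kj Jj]; split=> //.
  rewrite /e -[leRHS]invrK lef_pV2 ?posrE ?invr_gt0//.
  have := truncnS_gt e'^-1; move/ltW/le_trans; apply.
  by rewrite ler_nat.
exists (fun j x => (gJ (k j)).1 x.1); split.
- move=> j; have [mg [L L0 gL] _ _] := HgJ (k j).
  exact: (lipschitz_Hs omega_bounded omega_open (eps0 j) (s01 j) mg L0 gL).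
- have X0 : (0 : R) < 1 by [].
  apply: weak_cvg_of_strong.
  + exact: measurable_thin.
  + move=> j; have [mg [L L0 gL] _ _] := HgJ (k j).
    apply: (L2_fst omega_open X0 (g := (gJ (k j)).1)).
    exact: (lipschitz_L2 omega_bounded omega_open mg L0 gL).
  + exact: L2_fst.
  + move=> e' e'0; apply: filterS (near_small _ e'0) => j [ek _].
    have [mg _ gu _] := HgJ (k j).
    have mgu : measurable_fun omega (fun x => (((gJ (k j)).1 x - u x) ^+ 2)%:E).
      apply: measurable_funTS; apply/measurable_EFinP; apply: measurable_funX.
      exact: measurable_funB.
    have -> := integral_thin_fst momega X0 mgu (fun x _ => sqr_ge0 _).
    by rewrite mul1e; apply: le_trans gu _; rewrite lee_fin.
- apply/lee_addgt0Pr => e' e'0; apply: limn_esup_le.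
  have e'20 : 0 < e' / 2 by rewrite divr_gt0.
  apply: filterS (near_small _ e'20) => j [ek Jj].
  have [_ _ _ gF] := HgJ (k j).
  apply: le_trans (gF j Jj) _; rewrite leeD2l// lee_fin.
  by rewrite [leRHS]splitr lerD.
Qed.

End recovery_sequence.

Theorem theorem4p13 (R : realType) (d : nat) (hd : (2 <= d)%N)
    (omega : set 'rV[R]_d.-1)
    (omega_bounded : bounded_set omega) (omega_connected : connected omega)
    (omega_open : open omega) (omega_lipschitz : lipschitz_boundary omega)
    (s : R -> R) (s0 : R)
    (hs : forall eps : R, 0 < eps -> 0 < s eps < 1)
    (hs0 : 0 <= s0 < 2^-1)
    (hs_lim : s eps @[eps --> 0^'+] --> s0) :
  is_Gamma_limit (dimred_cvg omega)
    (fun eps => Hs (s eps) (thin omega eps))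
    (fun eps u => F_thin omega eps (s eps) u)
    (L2 (lebesgue_rV d.-1) omega)
    (F_lim omega s0).
Proof.
case: d hd omega omega_bounded omega_connected omega_open omega_lipschitz => [//|n] _
  /= omega omega_bounded _ omega_open omega_lipschitz.
move=> eps_ eps0 ceps u u2.
have momega : measurable omega by exact: open_measurable_rV.
have omega_lty := bounded_measure_lty momega omega_bounded.
have [diam diam0 Hdiam] := bounded_diameter omega_bounded.
(* u is only measurable on omega; its extension by 0 is measurable everywhere and changes neither
   the energy nor the convergence. *)
pose v : 'rV[R]_n -> R := u \_ omega.
have vu x : omega x -> v x = u x by move=> ox; rewrite /v patchE mem_set.
have mv : measurable_fun setT v by apply/(measurable_restrictT _ momega); case: u2.
have L2v : L2 (lebesgue_rV n) omega v.
  split; first exact: measurable_funTS.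
  by case: u2 => _; apply: eq_integrable => // x /set_mem ox; rewrite vu.
have -> : F_lim (d := n.+1) omega s0 u =
    gagliardo (lebesgue_rV n) eucl_dist (n.+1%:R + 2 * s0) omega v.
  by apply: gagliardo_eq => x /vu.
have cs : s (eps_ j) @[j --> \oo] --> s0.
  (* Positivity of the parameters upgrades convergence to 0 to convergence from the right, along
     which s has a limit. *)
  have ceps' : eps_ j @[j --> \oo] --> 0^'+.
    move=> A hA; have := ceps _ hA.
    by apply: (@filterS _ _ _ (fun j => 0 < eps_ j -> A (eps_ j))) => j; apply.
  by apply: cvg_comp hs_lim; exact: ceps'.
have cp : n.+1%:R + 2 * s (eps_ j) @[j --> \oo] --> n.+1%:R + 2 * s0.
  by apply: cvgD; [exact: cvg_cst|apply: cvgM => //; exact: cvg_cst].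
(* The upper bound is exactly s0 < 1/2. *)
have p0n : n%:R < n.+1%:R + 2 * s0 < n%:R + 2.
  by have := @natr1 R n; case/andP: hs0 => s00 s0h <-; apply/andP; split; lra.
have p00 : 0 < n.+1%:R + 2 * s0 by case/andP: p0n => + _; exact: le_lt_trans.
have s01 j : 0 < s (eps_ j) < 1 by exact: hs.
have cvgE (u_ : nat -> 'rV[R]_n * measurableTypeR R -> R) :
    dimred_cvg (d := n.+1) omega eps_ u_ u <->
    weak_cvg_L2 (lebesgue_pair (lebesgue_rV n)) (thin (d := n.+1) omega 1)
      (fun j x => u_ j (squeeze (eps_ j) x)) (fun x => v x.1).
  have X1 (w : 'rV[R]_n * measurableTypeR R) : thin (d := n.+1) omega 1 w -> v w.1 = u w.1.
    by move=> [/vu].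
  have E phi : \int[lebesgue_pair (lebesgue_rV n)]_(x in thin (d := n.+1) omega 1) (v x.1 * phi x) =
      \int[lebesgue_pair (lebesgue_rV n)]_(x in thin (d := n.+1) omega 1) (u x.1 * phi x).
    by apply: eq_Rintegral => x /set_mem /X1 ->.
  split=> -[a b c]; split=> //; try exact: (L2_fst omega_open).
  - by move=> phi /c; rewrite E.
  - by move=> phi /c; rewrite E.
split.
- move=> u_ Hu_ /cvgE wc.
  apply: (liminf_inequality momega omega_lty Hdiam mv p00 eps0 ceps cp _ wc).
  by move=> j; have [[]] := Hu_ j.
- have [u_ [h1 h2 h3]] := recovery_sequence omega_bounded omega_open omega_lipschitz
    mv L2v p0n eps0 s01 cp.
  by exists u_; split=> //; apply/cvgE.
Qed.
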